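(* Let $A$ be a Barbasch–Sahi algebra over a field $\mathbb{F}$ of characteristic $0$, with underlying pointed cocommutative Hopf algebra $H$, orthogonal module $V$, Clifford algebra $C=C(V)$, Dirac element $D\in A\otimes C$, pin cover $(\tilde H,\pi,\gamma)$, diagonal map $\Delta_C$ and quotient algebra $H'=\tilde H/\ker\Delta_C$. Then there is an algebra map $\zeta: Z(A)\to Z(H')$ such that for every $z\in Z(A)$ there exists an element $b\in A\otimes C$ such that $$ z\otimes 1=\Delta_C(\zeta(z))+bD+Db .$$ Here $Z(\cdot)$ denotes the center of an algebra.
   Context: All vector spaces and tensor products are over a field $\mathbb{F}$ of characteristic $0$; modules are left modules. Hopf–Hecke algebras. Let $H$ be a cocommutative Hopf algebra with counit $\varepsilon$, coproduct $\Delta(h)=h_{(1)}\otimes h_{(2)}$ (Sweedler notation) and antipode $S$. Let $V$ be a finite-dimensional orthogonal $H$-module, i.e. $V$ carries a (fixed) non-degenerate symmetric bilinear form $\langle\cdot,\cdot\rangle$ with $\langle h_{(1)}\cdot v,h_{(2)}\cdot w\rangle=\varepsilon(h)\langle v,w\rangle$ for all $h\in H$, $v,w\in V$. Let $T(V)\rtimes H$ be the smash product, the algebra generated by $T(V)$ and $H$ with relations $hv=(h_{(1)}\cdot v)h_{(2)}$. Let $\kappa:V\wedge V\to H$ be linear, let $I_\kappa$ be the ideal generated by all $vw-wv-\kappa(v\wedge w)$, $v,w\in V$, and $A=(T(V)\rtimes H)/I_\kappa$. $A$ is called a Hopf–Hecke algebra if it has the PBW property: the natural surjection from $S(V)\rtimes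 H$ to the associated graded algebra of $A$ (for the filtration coming from $T(V)$) is an isomorphism. Let $C=C(V)$ be the quotient of $T(V)$ by the ideal generated by all $vw+wv-2\langle v,w\rangle$; it has its usual $\mathbb{Z}_2$-gradation, with $V$ odd. The Dirac element is $D=\sum_i v_i\otimes v^i\in A\otimes C$ for any pair $(v_i)_i,(v^i)_i$ of dual bases of $V$ with respect to $\langle\cdot,\cdot\rangle$. Pin cover. Assume $H$ is pointed (every simple subcoalgebra is one-dimensional). Let $G=G(H)$ be the group of group-like elements and $L=P(H)$ the Lie algebra of primitive elements, so $H=\mathcal{U}(L)\rtimes\mathbb{F}[G]$. The algebra $H$ is $\mathbb{Z}_2$-graded by $(-1)^{|g|}=\det(g|_V)$ for $g\in G$ and $(-1)^{|x|}=1$ for $x\in L$. The pin cover of $H$ with respect to $V$ is a triple $(\tilde H,\pi,\gamma)$ where $\tilde H$ is a pointed cocommutative Hopf algebra, $\pi:\tilde H\to H$ is a Hopf algebra epimorphism and $\gamma:\tilde H\to C$ is an algebra map, such that: $(\tilde H,\pi)$ is a double cover of $H$ ($\tilde H\cong H\oplus H$ as coalgebras and $\pi$ restricts to a coalgebra isomorphism on each copy of $H$); $\gamma$ preserves the $\mathbb{Z}_2$-gradation (where $\tilde H$ is graded by the same recipe as $H$, using that $V$ is an orthogonal $\tilde H$-module via $\pi$); and $(-1)^{|\tilde h|}\pi(\tilde h)\cdot v=\gamma(\tilde h_{(1)})\,v\,\gamma(S\tilde h_{(2)})$ in $C$ for all homogeneous $\tilde h\in\tilde H$, $v\in V$. Concretely,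 $\tilde H=\mathcal{U}(L)\rtimes\mathbb{F}[\tilde G]$, where $\tilde G$, $\pi|_{\tilde G}:\tilde G\to G$ and $\gamma|_{\tilde G}:\tilde G\to\mathrm{Pin}(V)$ form the pullback of $G\to O(V)$ and the map $\mathrm{Pin}(V)\to O(V)$ sending a unit vector $v$ to the reflection $\tau_v$ ($\mathrm{Pin}(V)\subset C^\times$ is the subgroup generated by all $v\in V$ with $\langle v,v\rangle=1$), $\tilde G$ acts on $L$ via $G$, $\pi|_L=\mathrm{id}$, and $\gamma|_L$ maps $x\in L$ to the unique element $\gamma(x)$ in the span of the elements $vw-wv$ with $[\gamma(x),u]=x\cdot u$ for all $u\in V$. The diagonal map is the algebra map $\Delta_C:\tilde H\to H\otimes C\subset A\otimes C$, $\Delta_C(\tilde h)=\pi(\tilde h_{(1)})\otimes\gamma(\tilde h_{(2)})$, and $H':=\tilde H/\ker\Delta_C$; the induced injective map $H'\to A\otimes C$ is also denoted $\Delta_C$. $D$ satisfies the Parthasarathy condition if $D^2\in Z(A\otimes C)+\Delta_C(\tilde H^{\mathrm{even}})$. A Hopf–Hecke algebra whose Dirac element satisfies the Parthasarathy condition is called a Barbasch–Sahi algebra. *)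

(* Defs.v *)
From HB Require Import structures.
From mathcomp Require Import all_boot all_algebra.
From mathcomp Require Import boolp.
From mathcomp.classical Require classical_sets.
From mathcomp Require Import finmap.
From mathcomp Require Import monalg.

(* MathComp library, with the classical axioms of mathcomp.classical.boolp.   *)
(* Quotients, tensor products and free algebras are built once and then       *)
(* sealed: only the properties recorded in the corresponding _spec statements *)
(* (which determine the objects up to isomorphism) are visible afterwards.    *)

Set Implicit Arguments.
Unset Strict Implicit.
Unset Printing Implicit Defensive.

Import GRing.Theory.
Local Open Scope ring_scope.

Notation is_bilinear := (bilinear_for *:%R *:%R).

Section Span.
Variables (F : fieldType) (M : lmodType F).

Inductive span (X : M -> Prop) : M -> Prop :=
| span0 : span X 0
| span_gen x : X x -> span X x
| span_lin a x y : span X x -> span X y -> span X (a *: x + y).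

Variable X : M -> Prop.

Lemma spanZ a x : span X x -> span X (a *: x).
Proof. by move=> Xx; rewrite -[_ *: _]addr0; apply: span_lin => //; exact: span0. Qed.
Lemma spanD x y : span X x -> span X y -> span X (x + y).
Proof. by rewrite -[x in x + y]scale1r; exact: span_lin. Qed.
End Span.

Lemma span_ind_in (F : fieldType) (M : lmodType F) (X Y : M -> Prop) :
  Y 0 -> (forall a x y, Y x -> Y y -> Y (a *: x + y)) ->
  (forall x, X x -> Y x) -> forall x, span X x -> Y x.
Proof. by move=> Y0 Yl YX x; elim=> [|{}x /YX|a {}x y _ Yx _ Yy] //; exact: Yl. Qed.

(* M -> Q is the quotient of M by the subspace N *)
Definition is_quotient (F : fieldType) (M Q : lmodType F) (q : M -> Q)
    (N : M -> Prop) : Prop :=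
  (forall y, exists x, q x = y) /\ (forall x, q x = 0 <-> N x).

Section QuotientModule.
Variables (F : fieldType) (M : lmodType F) (X : M -> Prop).

Let N : {pred M} := fun m => `[< span X m >].
Let NP m : reflect (span X m) (m \in N). Proof. exact: asboolP. Qed.
Fact qmod_subproof : submod_closed N.
Proof.
split; first by apply/NP; exact: span0.
by move=> a u v /NP hu /NP hv; apply/NP; exact: span_lin.
Qed.
HB.instance Definition _ := GRing.isSubmodClosed.Build F M N qmod_subproof.

Let Q := {ideal_quot N}.
Let q (m : M) : Q := (\pi_Q m)%qT.
Let qr (x : Q) : M := repr x.
Let qrK : cancel qr q. Proof. by move=> x; exact: reprK. Qed.
Let eq_q m m' : (q m = q m') <-> (m - m' \in N).
Proof.
split; first by move/eqP; rewrite eqquotE.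
by move=> h; apply/eqP; rewrite eqquotE.
Qed.
Let qD : {morph q : x y / x + y}.
Proof. by move=> x y; rewrite /q Quotient.pi_add. Qed.
Let sc (a : F) (x : Q) : Q := q (a *: qr x).
Let qZ a m : q (a *: m) = sc a (q m).
Proof.
apply/eq_q; rewrite -scalerBr; apply: rpredZ.
by apply/eq_q; rewrite qrK.
Qed.
Fact qmod_scA a b x : sc a (sc b x) = sc (a * b) x.
Proof. by rewrite -[x]qrK -!qZ scalerA. Qed.
Fact qmod_sc1 : left_id 1 sc.
Proof. by move=> x; rewrite -[x]qrK -qZ scale1r. Qed.
Fact qmod_scDr : right_distributive sc +%R.
Proof. by move=> a x y; rewrite -[x]qrK -[y]qrK -qD -!qZ -qD scalerDr. Qed.
Fact qmod_scDl x : {morph sc^~ x : a b / a + b}.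
Proof. by move=> a b; rewrite -[x]qrK -!qZ -qD scalerDl. Qed.

Definition qmod_carrier : Type := Q.
HB.instance Definition _ := GRing.Zmodule.on qmod_carrier.
HB.instance Definition _ := GRing.Zmodule_isLmodule.Build F qmod_carrier
  qmod_scA qmod_sc1 qmod_scDr qmod_scDl.
Definition qmod_pi : M -> qmod_carrier := q.
Fact qmod_pi_linear : linear qmod_pi.
Proof. by move=> a x y; rewrite /qmod_pi qD qZ. Qed.
HB.instance Definition _ :=
  GRing.isLinear.Build F M qmod_carrier *:%R qmod_pi qmod_pi_linear.

Fact qmod_spec :
  {Q : lmodType F & {q : M -> Q | linear q /\ is_quotient q (span X)}}.
Proof.
exists (qmod_carrier : lmodType F), qmod_pi; split; first exact: qmod_pi_linear.
split=> [y|x]; first by exists (qr y); exact: qrK.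
have -> : qmod_pi x = 0 <-> qmod_pi x = qmod_pi 0 by rewrite raddf0.
split=> [/eq_q|h]; first by rewrite subr0 => /NP.
by apply/eq_q; rewrite subr0; apply/NP.
Qed.

Definition qmod : Type := projT1 qmod_spec.
HB.instance Definition _ := GRing.Lmodule.on qmod.
Definition qmap : M -> qmod := sval (projT2 qmod_spec).
Fact qmap_linear : linear qmap.
Proof. exact: (svalP (projT2 qmod_spec)).1. Qed.
HB.instance Definition _ := GRing.isLinear.Build F M qmod *:%R qmap qmap_linear.
Lemma qmapP : is_quotient qmap (span X).
Proof. exact: (svalP (projT2 qmod_spec)).2. Qed.
End QuotientModule.

Section QuotientAlgebra.
Variables (F : fieldType) (R : algType F).

(* the two-sided ideal generated by X *)
Definition ideal (X : R -> Prop) : R -> Prop :=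
  span (fun y => exists r x s, X x /\ y = r * x * s).

Lemma ideal_mull X r x : ideal X x -> ideal X (r * x).
Proof.
elim=> [|{}x [s [y [t [Xy ->]]]]|a {}x y _ Ix _ Iy].
- by rewrite mulr0; exact: span0.
- by apply: span_gen; exists (r * s), y, t; rewrite !mulrA.
- by rewrite mulrDr -scalerAr; exact: span_lin.
Qed.

Lemma ideal_mulr X r x : ideal X x -> ideal X (x * r).
Proof.
elim=> [|{}x [s [y [t [Xy ->]]]]|a {}x y _ Ix _ Iy].
- by rewrite mul0r; exact: span0.
- by apply: span_gen; exists s, y, (t * r); rewrite !mulrA.
- by rewrite mulrDl -scalerAl; exact: span_lin.
Qed.

Lemma ideal_gen X x : X x -> ideal X x.
Proof. by move=> Xx; apply: span_gen; exists 1, x, 1; rewrite mul1r mulr1. Qed.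

Lemma ideal_ker (B : algType F) (f : {lrmorphism R -> B}) X :
  (forall x, X x -> f x = 0) -> forall x, ideal X x -> f x = 0.
Proof.
move=> fX x; elim=> [|_ [r [y [s [/fX fy ->]]]]|a {}x y _ fx _ fy].
- exact: rmorph0.
- by rewrite !rmorphM /= fy mulr0 mul0r.
- by rewrite linearP /= fx fy scaler0 addr0.
Qed.

Lemma ideal_proper (B : algType F) (f : {lrmorphism R -> B}) X :
  (forall x, X x -> f x = 0) -> ~ ideal X 1.
Proof.
move=> fX /(ideal_ker fX); rewrite rmorph1 => /eqP.
by rewrite oner_eq0.
Qed.

Variables (X : R -> Prop) (proper : ~ ideal X 1).
Let Q := qmod (fun y => exists r x s, X x /\ y = r * x * s).
Let q : {linear R -> Q} := qmap _.
Let q_surj (x : Q) : exists r, x = q r.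
Proof. by have [r <-] := (qmapP _).1 x; exists r. Qed.
Let qr (x : Q) : R := projT1 (cid (q_surj x)).
Let qrK x : q (qr x) = x. Proof. by rewrite /qr; case: cid. Qed.
Let q0P x : q x = 0 <-> ideal X x. Proof. exact: (qmapP _).2. Qed.
Let mul (x y : Q) : Q := q (qr x * qr y).
Let qM r s : q (r * s) = mul (q r) (q s).
Proof.
have rP t : ideal X (t - qr (q t)) by apply/q0P; rewrite raddfB /= qrK subrr.
apply/eqP; rewrite -subr_eq0 -raddfB; apply/eqP/q0P.
rewrite -(subrK (r * qr (q s)) (r * s)) -mulrBr -addrA -mulrBl.
by apply: spanD; [exact: ideal_mull | exact: ideal_mulr].
Qed.
Fact qalg_mulA : associative mul.
Proof.
move=> x y z; have [r ->] := q_surj x; have [s ->] := q_surj y.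
by have [t ->] := q_surj z; rewrite -!qM mulrA.
Qed.
Fact qalg_mul1 : left_id (q 1) mul.
Proof. by move=> x; have [r ->] := q_surj x; rewrite -qM mul1r. Qed.
Fact qalg_mulr1 : right_id (q 1) mul.
Proof. by move=> x; have [r ->] := q_surj x; rewrite -qM mulr1. Qed.
Fact qalg_mulDl : left_distributive mul +%R.
Proof.
move=> x y z; have [r ->] := q_surj x; have [s ->] := q_surj y.
by have [t ->] := q_surj z; rewrite -raddfD -!qM -raddfD mulrDl.
Qed.
Fact qalg_mulDr : right_distributive mul +%R.
Proof.
move=> x y z; have [r ->] := q_surj x; have [s ->] := q_surj y.
by have [t ->] := q_surj z; rewrite -raddfD -!qM -raddfD mulrDr.
Qed.
Fact qalg_scaleAl a (x y : Q) : a *: mul x y = mul (a *: x) y.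
Proof.
have [r ->] := q_surj x; have [s ->] := q_surj y.
by rewrite -qM -!linearZ -qM /= scalerAl.
Qed.
Fact qalg_scaleAr a (x y : Q) : a *: mul x y = mul x (a *: y).
Proof.
have [r ->] := q_surj x; have [s ->] := q_surj y.
by rewrite -qM -!linearZ -qM /= scalerAr.
Qed.
Fact qalg_one_neq0 : q 1 != 0. Proof. by apply/eqP => /q0P. Qed.

Definition qalg_carrier : Type := Q.
HB.instance Definition _ := GRing.Lmodule.on qalg_carrier.
HB.instance Definition _ := GRing.Zmodule_isNzRing.Build qalg_carrier
  qalg_mulA qalg_mul1 qalg_mulr1 qalg_mulDl qalg_mulDr qalg_one_neq0.
Definition qalg_pi : R -> qalg_carrier := q.
HB.instance Definition _ := GRing.Linear.on qalg_pi.
Fact qalg_pi_monoid : monoid_morphism qalg_pi.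
Proof. by split => // r s; rewrite /qalg_pi qM. Qed.
HB.instance Definition _ :=
  GRing.isMonoidMorphism.Build R qalg_carrier qalg_pi qalg_pi_monoid.
HB.instance Definition _ := GRing.Lmodule_isLalgebra.Build F qalg_carrier qalg_scaleAl.
HB.instance Definition _ := GRing.Lalgebra_isAlgebra.Build F qalg_carrier qalg_scaleAr.
HB.instance Definition _ := GRing.RMorphism.on qalg_pi.

Fact qalg_spec :
  {Q : algType F & {q : R -> Q |
    [/\ linear q, monoid_morphism q & is_quotient q (ideal X)]}}.
Proof.
exists (qalg_carrier : algType F), qalg_pi; split; first exact: linearP.
  exact: qalg_pi_monoid.
by split=> [y|x]; [exists (qr y); exact: qrK | exact: q0P].
Qed.

Definition qalg : Type := projT1 qalg_spec.
HB.instance Definition _ := GRing.Algebra.on qalg.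
Definition qproj : R -> qalg := sval (projT2 qalg_spec).
Fact qproj_linear : linear qproj.
Proof. by case: (svalP (projT2 qalg_spec)). Qed.
HB.instance Definition _ := GRing.isLinear.Build F R qalg *:%R qproj qproj_linear.
Fact qproj_monoid : monoid_morphism qproj.
Proof. by case: (svalP (projT2 qalg_spec)). Qed.
HB.instance Definition _ := GRing.isMonoidMorphism.Build R qalg qproj qproj_monoid.
Lemma qprojP : is_quotient qproj (ideal X).
Proof. by case: (svalP (projT2 qalg_spec)). Qed.
End QuotientAlgebra.

Section LinearExtension.
Variables (F : fieldType) (K : choiceType) (Z : lmodType F) (f : K -> Z).

Definition mlin (m : {malg F[K]}) : Z := \sum_(k <- msupp m) m@_k *: f k.

Fact mlinE (m : {malg F[K]}) (d : {fset K}) :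
  (forall k, k \in msupp m -> k \in d) -> mlin m = \sum_(k <- d) m@_k *: f k.
Proof.
move=> h; have le : (msupp m `<=` d)%fset by apply/fsubsetP => k; apply: h.
rewrite /mlin; apply: big_fset_incl => // k kd km.
by rewrite mcoeff_outdom ?scale0r.
Qed.

Fact mlin_linear : linear mlin.
Proof.
move=> a x y; pose d := (msupp x `|` msupp y `|` msupp (a *: x + y))%fset.
rewrite !(@mlinE _ d) => [|k kx|k kx|k kx]; try by rewrite !in_fsetU kx ?orbT.
rewrite scaler_sumr -big_split /=; apply: eq_bigr => k _.
by rewrite mcoeffD mcoeffZ scalerDl scalerA.
Qed.
HB.instance Definition _ :=
  GRing.isLinear.Build F {malg F[K]} Z *:%R mlin mlin_linear.

Fact mlinU k : mlin << k >> = f k.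
Proof.
rewrite (@mlinE _ [fset k]%fset) => [|j]; last by rewrite msuppU oner_eq0.
by rewrite big_seq_fset1 mcoeffUU scale1r.
Qed.

Fact malg_span (m : {malg F[K]}) : span (fun x => exists k, x = << k >>) m.
Proof.
rewrite (monalgE m).
elim: (enum_fset (msupp m)) => [|k s IHs]; first by rewrite big_nil; exact: span0.
rewrite big_cons; have -> : << m@_k *g k >> = m@_k *: << k >> :> {malg F[K]}.
  by apply/malgP => j; rewrite mcoeffZ !mcoeffU mulr_natr.
by apply: span_lin => //; apply: span_gen; exists k.
Qed.
End LinearExtension.

Section TensorSpec.
Variables (F : fieldType) (U W : lmodType F).

Inductive tensor_rel : {malg F[(U * W)%type]} -> Prop :=
| tensor_rell a u u' w :
    tensor_rel (<< (a *: u + u', w) >> - (a *: << (u, w) >> + << (u', w) >>))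
| tensor_relr a u w w' :
    tensor_rel (<< (u, a *: w + w') >> - (a *: << (u, w) >> + << (u, w') >>)).

Fact tensor_spec :
  {T : lmodType F & {t : U -> W -> T |
     [/\ is_bilinear t,
        forall P : T -> Prop, (forall u w, P (t u w)) ->
          (forall a x y, P x -> P y -> P (a *: x + y)) -> forall x, P x
      & forall (Z : lmodType F) (f : U -> W -> Z), is_bilinear f ->
          exists2 g : T -> Z, linear g & forall u w, g (t u w) = f u w]}}.
Proof.
pose q : {linear _ -> _} := qmap tensor_rel; have qP := qmapP tensor_rel.
rewrite -[qmap _]/(q : _ -> _) in qP.
have q_eq x y : tensor_rel (x - y) -> q x = q y.
  move=> h; apply/eqP; rewrite -subr_eq0 -raddfB; apply/eqP/qP.2.
  exact: span_gen.
exists (qmod tensor_rel : lmodType F), (fun u w => q << (u, w) >>); split.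
- split=> [w a u u'|u a w w']; rewrite -linearP; apply: q_eq;
    [exact: tensor_rell | exact: tensor_relr].
- move=> P Pt PD x; have [m <-] := qP.1 x.
  elim: (malg_span m) => [|_ [[u w] ->]|a y z _ Py _ Pz].
  + rewrite raddf0 -(addNr (q << (0, 0) >>)) -scaleN1r.
    by apply: PD; exact: Pt.
  + exact: Pt.
  + by rewrite linearP; exact: PD.
- move=> Z f hf; pose g : {linear _ -> Z} := mlin (fun p : U * W => f p.1 p.2).
  have gU p : g << p >> = f p.1 p.2 by exact: mlinU.
  have gN m : span tensor_rel m -> g m = 0.
    elim=> [|{}m [a u u' w|a u w w']|a x y _ gx _ gy]; first exact: raddf0.
    + by rewrite raddfB raddfD /= linearZ /= !gU /= (hf.1 w a u u') subrr.
    + by rewrite raddfB raddfD /= linearZ /= !gU /= (hf.2 u a w w') subrr.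
    + by rewrite linearP /= gx gy scaler0 addr0.
  have qg m m' : q m = q m' -> g m = g m'.
    move=> /eqP; rewrite -subr_eq0 -raddfB => /eqP/qP.2/gN/eqP.
    by rewrite raddfB subr_eq0 => /eqP.
  pose r x := projT1 (cid (qP.1 x)).
  have rK x : q (r x) = x by rewrite /r; case: cid.
  exists (fun x => g (r x)) => [a x y|u w]; last by rewrite (qg _ _ (rK _)) gU.
  by rewrite -linearP; apply: qg; rewrite linearP !rK.
Qed.
End TensorSpec.

Section TensorProduct.
Variables (F : fieldType) (U W : lmodType F).

Definition tensor : Type := projT1 (tensor_spec U W).
HB.instance Definition _ := GRing.Lmodule.on tensor.
Definition tens : U -> W -> tensor := sval (projT2 (tensor_spec U W)).

Lemma tens_bilinear : is_bilinear tens.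
Proof. by case: (svalP (projT2 (tensor_spec U W))). Qed.

Lemma tensor_ind (P : tensor -> Prop) :
    (forall u w, P (tens u w)) -> (forall a x y, P x -> P y -> P (a *: x + y)) ->
  forall t, P t.
Proof. by case: (svalP (projT2 (tensor_spec U W))) => _ + _; exact. Qed.

Fact tens_univ (Z : lmodType F) (f : U -> W -> Z) : is_bilinear f ->
  exists2 g : tensor -> Z, linear g & forall u w, g (tens u w) = f u w.
Proof. by case: (svalP (projT2 (tensor_spec U W))) => _ _; exact. Qed.

(* The linear map induced by a bilinear map f. In Sweedler notation,          *)
(* tlift (fun a b => E a b) (comul h) stands for E h_(1) h_(2); the value is  *)
(* only meaningful for bilinear f.                                            *)
Definition tlift (Z : lmodType F) (f : U -> W -> Z) : tensor -> Z :=
  if pselect (is_bilinear f) is left hf then s2val (cid2 (tens_univ hf))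
  else fun=> 0.

Lemma tlift_linear (Z : lmodType F) (f : U -> W -> Z) :
  is_bilinear f -> linear (tlift f).
Proof. by move=> hf; rewrite /tlift; case: pselect => // h; case: cid2. Qed.

Lemma tlift_tens (Z : lmodType F) (f : U -> W -> Z) :
  is_bilinear f -> forall u w, tlift f (tens u w) = f u w.
Proof. by move=> hf; rewrite /tlift; case: pselect => // h; case: cid2. Qed.
End TensorProduct.

Notation "u ⊗ w" := (tens u w) (at level 40, left associativity) : ring_scope.

Section TensorMap.
Variables (F : fieldType) (U U' W W' : lmodType F).
Variables (f : {linear U -> U'}) (g : {linear W -> W'}).

Definition tmap : tensor U W -> tensor U' W' := tlift (fun u w => f u ⊗ g w).

Fact tmap_bilinear : is_bilinear (fun u w => f u ⊗ g w).
Proof.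
split=> [w a u u'|u a w w'] /=; rewrite linearP.
  exact: (tens_bilinear U' W').1.
exact: (tens_bilinear U' W').2.
Qed.

Lemma tmapE u w : tmap (u ⊗ w) = f u ⊗ g w.
Proof. exact: (tlift_tens tmap_bilinear). Qed.

HB.instance Definition _ := GRing.isLinear.Build F _ _ *:%R tmap
  (tlift_linear tmap_bilinear).
End TensorMap.

(* existence of a linear form with value 1 at m0; used to see 1 ⊗ 1 != 0 *)
Fact linear_form_exists (F : fieldType) (M : lmodType F) (m0 : M) :
  m0 != 0 -> exists2 f : M -> F^o, linear f & f m0 = 1.
Proof.
move=> m0_neq0; pose P (X : classical_sets.set M) :=
  (forall a u v, X u -> X v -> X (a *: u + v)) /\ ~ X m0.
have [|X [[XD Xm0] Xmax]] := @classical_sets.Zorn_bigcup M P.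
  move=> G GP Gtot; split=> [a u v [A GA Au] [B GB Bv]|[A /GP[_ Am0] /Am0]//].
  case: (Gtot A B GA GB) => [AB|BA].
    by exists B => //; apply: (GP B GB).1 => //; apply: AB.
  by exists A => //; apply: (GP A GA).1 => //; apply: BA.
have XZ a u : X u -> X (a *: u).
  move=> Xu; have := XD (a - 1) u u Xu Xu.
  by rewrite -{2}[u]scale1r -scalerDl subrK.
have X0 : X 0.
  apply: contrapT => X0; apply: (Xmax (fun x => X x \/ x = 0)).
    split; [by left | by move=> h; apply/X0/h; right].
  split=> [a u v [Xu|->] [Xv|->]|[//|/eqP]]; last exact/negP.
  - by left; apply: XD.
  - by left; rewrite addr0; apply: XZ.
  - by left; rewrite scaler0 add0r.
  - by right; rewrite scaler0 add0r.
have dec x : exists c, X (x - c *: m0).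
  have [Xx|Xx] := EM (X x); first by exists 0; rewrite scale0r subr0.
  apply: contrapT => nc.
  apply: (Xmax (fun y => exists u c, X u /\ y = u + c *: x)).
    split; first by move=> y Xy; exists y, 0; rewrite scale0r addr0.
    by move=> h; apply/Xx/h; exists 0, 1; rewrite scale1r add0r.
  split=> [a _ _ [u [c [Xu ->]]] [v [d [Xv ->]]]|[u [c [Xu m0E]]]].
    exists (a *: u + v), (a * c + d); split; first exact: XD.
    by rewrite scalerDr scalerDl addrACA scalerA.
  have [c0|c0] := eqVneq c 0; first by apply: Xm0; rewrite m0E c0 scale0r addr0.
  apply: nc; exists c^-1; rewrite m0E scalerDr scalerA mulVf // scale1r.
  by rewrite opprD addrCA subrr addr0 -scaleN1r; exact: XZ (XZ _ _ Xu).
have uniq x c d : X (x - c *: m0) -> X (x - d *: m0) -> c = d.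
  move=> Xc Xd; apply: contrapT => /eqP; rewrite -subr_eq0 => cd; apply: Xm0.
  have := XZ (c - d)^-1 _ (XD (-1) _ _ Xc Xd); rewrite scaleN1r opprB addrA subrK.
  by rewrite -scalerBl scalerA mulVf // scale1r.
pose f x := projT1 (cid (dec x)).
have fP x : X (x - f x *: m0) by rewrite /f; case: cid.
exists f => [a x y|]; last by apply: (uniq m0) => //; rewrite scale1r subrr.
apply: (uniq (a *: x + y)) => //.
by rewrite scalerDl -scalerA opprD addrACA -scalerBr; exact: XD.
Qed.

Section TensorAlgebra.
Variables (F : fieldType) (A B : algType F).
Implicit Types s t : tensor A B.

Definition tmull (a : A) (b : B) (t : tensor A B) : tensor A B :=
  tlift (fun a' b' => (a * a') ⊗ (b * b')) t.

Fact tmull_bilinear a b :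
  is_bilinear (fun a' b' => (a * a') ⊗ (b * b') : tensor A B).
Proof.
split=> [b' c x y|a' c x y] /=; rewrite mulrDr -scalerAr.
  exact: (tens_bilinear A B).1.
exact: (tens_bilinear A B).2.
Qed.

Fact tmull_tens a b a' b' : tmull a b (a' ⊗ b') = (a * a') ⊗ (b * b').
Proof. exact: (tlift_tens (tmull_bilinear a b)). Qed.

Fact tmull_linear a b : linear (tmull a b).
Proof. exact: (tlift_linear (tmull_bilinear a b)). Qed.

Definition tmul s t : tensor A B := tlift (fun a b => tmull a b t) s.

Fact tmul_bilinear t : is_bilinear (fun a b => tmull a b t).
Proof.
split=> [b c x y|a c x y] /=; elim/tensor_ind: t => [a' b'|d t t' IH IH'].
- by rewrite !tmull_tens mulrDl -scalerAl (tens_bilinear A B).1.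
- rewrite !tmull_linear IH IH' !scalerDr !scalerA [d * c]mulrC.
  exact: addrACA.
- by rewrite !tmull_tens mulrDl -scalerAl (tens_bilinear A B).2.
- rewrite !tmull_linear IH IH' !scalerDr !scalerA [d * c]mulrC.
  exact: addrACA.
Qed.

Fact tmul_tensl a b t : tmul (a ⊗ b) t = tmull a b t.
Proof. exact: (tlift_tens (tmul_bilinear t)). Qed.

Fact tmul_tens a b a' b' : tmul (a ⊗ b) (a' ⊗ b') = (a * a') ⊗ (b * b').
Proof. by rewrite tmul_tensl tmull_tens. Qed.

Fact tmulPl t : linear (tmul^~ t).
Proof. exact: (tlift_linear (tmul_bilinear t)). Qed.

Fact tmulPr s : linear (tmul s).
Proof.
elim/tensor_ind: s => [a b|c s s' IH IH'] d t t'.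
  by rewrite !tmul_tensl tmull_linear.
rewrite !tmulPl IH IH' !scalerDr !scalerA [c * d]mulrC.
exact: addrACA.
Qed.

Fact tmulA : associative tmul.
Proof.
move=> r s t; elim/tensor_ind: r => [a b|c x y IHx IHy]; last first.
  by rewrite !tmulPl IHx IHy.
elim/tensor_ind: s => [a' b'|c x y IHx IHy]; last first.
  by rewrite tmulPl !tmulPr tmulPl IHx IHy.
elim/tensor_ind: t => [a'' b''|c x y IHx IHy]; last first.
  by rewrite !tmulPr IHx IHy.
by rewrite !tmul_tens !mulrA.
Qed.

Fact tmul1 : left_id (1 ⊗ 1) tmul.
Proof.
elim/tensor_ind=> [a b|c x y IHx IHy]; first by rewrite tmul_tens !mul1r.
by rewrite tmulPr IHx IHy.
Qed.

Fact tmulr1 : right_id (1 ⊗ 1) tmul.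
Proof.
elim/tensor_ind=> [a b|c x y IHx IHy]; first by rewrite tmul_tens !mulr1.
by rewrite tmulPl IHx IHy.
Qed.

Fact tmulDl : left_distributive tmul +%R.
Proof. by move=> x y z; have := tmulPl z 1 x y; rewrite !scale1r. Qed.
Fact tmulDr : right_distributive tmul +%R.
Proof. by move=> x y z; have := tmulPr x 1 y z; rewrite !scale1r. Qed.

Fact tone_neq0 : (1 ⊗ 1 : tensor A B) != 0.
Proof.
have [f f_lin f1] := @linear_form_exists F A 1 (oner_neq0 A).
have hf : is_bilinear (fun (a : A) (b : B) => (f a : F) *: b).
  split=> [b c x y|a c x y] /=; first by rewrite f_lin scalerDl scalerA.
  by rewrite scalerDr !scalerA mulrC.
apply/eqP => /(congr1 (tlift (fun (a : A) (b : B) => (f a : F) *: b))).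
have := scalable_linear (tlift_linear hf) 0 0; rewrite /= !scale0r => ->.
rewrite (tlift_tens hf) f1 scale1r => B10.
by have /eqP := oner_neq0 B; apply; exact: B10.
Qed.

HB.instance Definition _ := GRing.Zmodule_isNzRing.Build (tensor A B)
  tmulA tmul1 tmulr1 tmulDl tmulDr tone_neq0.

Lemma tensM (a a' : A) (b b' : B) : (a ⊗ b) * (a' ⊗ b') = (a * a') ⊗ (b * b').
Proof. exact: tmul_tens. Qed.

Fact tscaleAl c (s t : tensor A B) : c *: (s * t) = (c *: s) * t.
Proof. exact: (esym (scalable_linear (tmulPl t) c s)). Qed.
HB.instance Definition _ := GRing.Lmodule_isLalgebra.Build F (tensor A B) tscaleAl.
Fact tscaleAr c (s t : tensor A B) : c *: (s * t) = s * (c *: t).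
Proof. exact: (esym (scalable_linear (tmulPr s) c t)). Qed.
HB.instance Definition _ := GRing.Lalgebra_isAlgebra.Build F (tensor A B) tscaleAr.
End TensorAlgebra.

Section TensorMapAlgebra.
Variables (F : fieldType) (A A' B B' : algType F).
Variables (f : {lrmorphism A -> A'}) (g : {lrmorphism B -> B'}).

Fact tmap_monoid : monoid_morphism (tmap f g).
Proof.
split=> [|s t]; first by rewrite tmapE !rmorph1.
elim/tensor_ind: s => [a b|c x y IHx IHy]; last first.
  by rewrite mulrDl -scalerAl !linearP /= IHx IHy mulrDl -scalerAl.
elim/tensor_ind: t => [a' b'|c x y IHx IHy]; last first.
  by rewrite mulrDr -scalerAr !linearP /= IHx IHy mulrDr -scalerAr.
by rewrite tensM !tmapE tensM !rmorphM.
Qed.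
HB.instance Definition _ := GRing.isMonoidMorphism.Build _ _ (tmap f g) tmap_monoid.
End TensorMapAlgebra.

Section FreeAlgebraSpec.
Variables (F : fieldType) (X : choiceType).

Definition word : Type := seq X.
HB.instance Definition _ := Choice.on word.
Fact word_unit (x y : word) : x ++ y = [::] -> x = [::] /\ y = [::].
Proof. by case: x. Qed.
HB.instance Definition _ :=
  Choice_isMonomialDef.Build word (@catA X) (@cat0s X) (@cats0 X) word_unit.

Definition free_carrier : Type := {malg F[word]}.
HB.instance Definition _ := GRing.Lalgebra.on free_carrier.
Fact free_scaleAr a (x y : free_carrier) : a *: (x * y) = x * (a *: y).
Proof.
have U (m : free_carrier) : span (fun x => exists k : word, x = << k >>) m.
  exact: malg_span.
elim: (U x) => [|_ [u ->]|b {}x z _ IHx _ IHz]; first by rewrite !mul0r scaler0.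
  elim: (U y) a => [|_ [v ->]|c {}y z _ IHy _ IHz] a.
  - by rewrite scaler0 mulr0 scaler0.
  - have Z d (k : word) : << d *g k >> = d *: << k >> :> {malg F[word]}.
      by apply/malgP => j; rewrite mcoeffZ !mcoeffU mulr_natr.
    by rewrite -Z !malgM_def !fgmulUU !mul1r -Z.
  - by rewrite mulrDr scalerDr -IHy scalerA scalerDr mulrDr -IHz scalerA -IHy.
by rewrite !mulrDl scalerDr IHz -!scalerAl -IHx !scalerA mulrC.
Qed.
HB.instance Definition _ := GRing.Lalgebra_isAlgebra.Build F free_carrier free_scaleAr.

Fact free_mulU (u v : word) :
  (<< u >> * << v >> : {malg F[word]}) = << (u ++ v : word) >>.
Proof. by rewrite malgM_def fgmulUU mul1r. Qed.

Fact free_spec :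
  {A : algType F & {i : X -> A |
    (forall P : A -> Prop, (forall w : seq X, P (\prod_(x <- w) i x)) ->
        (forall a x y, P x -> P y -> P (a *: x + y)) -> forall x, P x)
    /\ (forall (B : algType F) (f : X -> B), exists g : A -> B,
          [/\ linear g, monoid_morphism g & forall x, g (i x) = f x])}}.
Proof.
exists (free_carrier : algType F), (fun x => << [:: x] : word >> : free_carrier).
have prodE (w : seq X) :
    \prod_(x <- w) (<< [:: x] : word >> : free_carrier) = << w : word >>.
  elim: w => [|x w IHw]; first by rewrite big_nil.
  by rewrite big_cons IHw; exact: free_mulU.
split=> [P Pw Pl x|B f].
  elim: (malg_span (x : {malg F[word]})) => [|_ [k ->]|a {}x y _ Px _ Py].
  - rewrite -(addNr (\prod_(x <- [::]) (<< [:: x] : word >> : free_carrier))).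
    by rewrite -scaleN1r; apply: Pl; exact: Pw.
  - by rewrite -prodE; exact: Pw.
  - exact: Pl.
pose g := mlin (fun w : word => \prod_(x <- (w : seq X)) f x).
exists g; split; first exact: mlin_linear.
  have g1 : g 1 = 1.
    by have := prodE [::]; rewrite big_nil /g => ->; rewrite mlinU big_nil.
  split=> // x y.
  have gl : linear g by exact: mlin_linear.
  elim: (malg_span (x : {malg F[word]})) => [|_ [u ->]|a {}x z _ IHx _ IHz].
  + by rewrite mul0r /g raddf0 mul0r.
  + elim: (malg_span (y : {malg F[word]})) => [|_ [v ->]|a {}y z _ IHy _ IHz].
    * by rewrite mulr0 /g raddf0 mulr0.
    * by rewrite free_mulU /g !mlinU big_cat.
    * rewrite mulrDr -[_ * (a *: y)](free_scaleAr a _ y) gl IHy IHz gl mulrDr.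
      by rewrite scalerAr.
  + by rewrite mulrDl -scalerAl gl IHx IHz gl mulrDl scalerAl.
by move=> x; rewrite /g mlinU big_seq1.
Qed.
End FreeAlgebraSpec.

Section FreeAlgebra.
Variables (F : fieldType) (X : choiceType).

Definition free_alg : Type := projT1 (free_spec F X).
HB.instance Definition _ := GRing.Algebra.on free_alg.
Definition free_var : X -> free_alg := sval (projT2 (free_spec F X)).

Lemma free_ind (P : free_alg -> Prop) :
  (forall w : seq X, P (\prod_(x <- w) free_var x)) ->
  (forall a x y, P x -> P y -> P (a *: x + y)) -> forall x, P x.
Proof. by case: (svalP (projT2 (free_spec F X))) => + _; exact. Qed.

Fact free_univ (B : algType F) (f : X -> B) : exists g : free_alg -> B,
  [/\ linear g, monoid_morphism g & forall x, g (free_var x) = f x].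
Proof. by case: (svalP (projT2 (free_spec F X))) => _; exact. Qed.

Section Eval.
Variables (B : algType F) (f : X -> B).
Definition free_eval : free_alg -> B := projT1 (cid (free_univ f)).
Fact free_eval_linear : linear free_eval.
Proof. by rewrite /free_eval; case: cid => ? []. Qed.
HB.instance Definition _ :=
  GRing.isLinear.Build F free_alg B *:%R free_eval free_eval_linear.
Fact free_eval_monoid : monoid_morphism free_eval.
Proof. by rewrite /free_eval; case: cid => ? []. Qed.
HB.instance Definition _ :=
  GRing.isMonoidMorphism.Build free_alg B free_eval free_eval_monoid.
Lemma free_eval_var x : free_eval (free_var x) = f x.
Proof. by rewrite /free_eval; case: cid => ? []. Qed.
End Eval.
End FreeAlgebra.

Section Center.
Variables (F : fieldType) (A : algType F).

Definition central : {pred A} := fun z => `[< forall x, z * x = x * z >].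

Lemma centralP z : reflect (forall x, z * x = x * z) (z \in central).
Proof. exact: asboolP. Qed.

Fact central_subalg_closed : subalg_closed central.
Proof.
split.
- by apply/centralP => x; rewrite mul1r mulr1.
- move=> a u v /centralP uC /centralP vC; apply/centralP => x.
  by rewrite mulrDl mulrDr -scalerAl -scalerAr uC vC.
- move=> u v /centralP uC /centralP vC; apply/centralP => x.
  by rewrite -mulrA vC mulrA uC mulrA.
Qed.
HB.instance Definition _ :=
  GRing.isSubalgClosed.Build F A central central_subalg_closed.

Record center := Center { center_val :> A; _ : center_val \in central }.
HB.instance Definition _ := [isSub for center_val].
HB.instance Definition _ := [Choice of center by <:].
HB.instance Definition _ := [SubChoice_isSubAlgebra of center by <:].
End Center.

Section KernelQuotient.
Variables (F : fieldType) (R B : algType F) (f : {lrmorphism R -> B}).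

Fact ker_proper : ~ ideal (fun x => f x = 0) 1.
Proof. exact: (@ideal_proper F R B f). Qed.

Definition kerquot : Type := qalg ker_proper.
HB.instance Definition _ := GRing.Algebra.on kerquot.
Definition kerproj : R -> kerquot := qproj ker_proper.
HB.instance Definition _ := GRing.LRMorphism.on kerproj.

Lemma kerproj_surj x : exists r, kerproj r = x.
Proof. exact: (qprojP ker_proper).1. Qed.
Lemma kerproj_eq0 r : kerproj r = 0 <-> f r = 0.
Proof.
split=> [/(qprojP ker_proper).2|fr]; first exact: ideal_ker.
by apply/(qprojP ker_proper).2; exact: ideal_gen.
Qed.

(* the injective map R / ker f -> B induced by f *)
Definition kermap (x : kerquot) : B := f (projT1 (cid (kerproj_surj x))).
Lemma kermapE r : kermap (kerproj r) = f r.
Proof.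
rewrite /kermap; case: cid => s /= /eqP; rewrite -subr_eq0 -raddfB => /eqP.
by move/kerproj_eq0/eqP; rewrite raddfB subr_eq0 => /eqP.
Qed.
End KernelQuotient.

Section ExteriorSquare.
Variables (F : fieldType) (V : lmodType F).
Definition ext_square : Type := qmod (fun t : tensor V V => exists v, t = v ⊗ v).
HB.instance Definition _ := GRing.Lmodule.on ext_square.
Definition wedge (v w : V) : ext_square := qmap _ (v ⊗ w).
End ExteriorSquare.

(* associated graded algebra *)
Section AssociatedGraded.
Variables (F : fieldType) (A : algType F).

Record filtration := Filtration {
  fil :> nat -> A -> Prop;
  fil0 : forall n, fil n 0;
  fil_lin : forall n a x y, fil n x -> fil n y -> fil n (a *: x + y);
  filS : forall n x, fil n x -> fil n.+1 x;
  fil_1 : fil 0 1;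
  filM : forall m n x y, fil m x -> fil n y -> fil (m + n) (x * y)
}.

(* A[X] as an algebra over F (in the library, {poly A} is a module over A) *)
Definition polyF : Type := {poly A}.
HB.instance Definition _ := GRing.NzRing.on polyF.
Definition polyF_scale (a : F) (p : polyF) : polyF := (a%:A : A)%:P * (p : {poly A}).
Fact polyF_scaleA a b p : polyF_scale a (polyF_scale b p) = polyF_scale (a * b) p.
Proof. by rewrite /polyF_scale mulrA -polyCM -scalerAl mul1r scalerA. Qed.
Fact polyF_scale1 : left_id 1 polyF_scale.
Proof. by move=> p; rewrite /polyF_scale scale1r mul1r. Qed.
Fact polyF_scaleDr : right_distributive polyF_scale +%R.
Proof. by move=> a p q; rewrite /polyF_scale mulrDr. Qed.
Fact polyF_scaleDl p : {morph polyF_scale^~ p : a b / a + b}.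
Proof. by move=> a b; rewrite /polyF_scale scalerDl polyCD mulrDl. Qed.
HB.instance Definition _ := GRing.Zmodule_isLmodule.Build F polyF
  polyF_scaleA polyF_scale1 polyF_scaleDr polyF_scaleDl.
Fact polyF_scaleAl a (p q : polyF) : a *: (p * q) = (a *: p) * q.
Proof. exact: mulrA. Qed.
HB.instance Definition _ := GRing.Lmodule_isLalgebra.Build F polyF polyF_scaleAl.
Fact polyF_scaleAr a (p q : polyF) : a *: (p * q) = p * (a *: q).
Proof.
rewrite -[LHS]/((a%:A : A)%:P * (p * q : {poly A})).
rewrite -[RHS]/((p : {poly A}) * ((a%:A : A)%:P * (q : {poly A}))) !mulrA.
congr (_ * _); apply/polyP => i.
by rewrite coefCM coefMC -scalerAl mul1r -scalerAr mulr1.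
Qed.
HB.instance Definition _ := GRing.Lalgebra_isAlgebra.Build F polyF polyF_scaleAr.

Lemma coef_polyFZ a (p : polyF) i : (a *: p : polyF)`_i = a *: (p : {poly A})`_i.
Proof. by rewrite -[a *: p]/((a%:A : A)%:P * (p : {poly A})) coefCM -scalerAl mul1r. Qed.

Variable (fA : filtration).

(* rees is the direct sum of all F_n, seen as the polynomials whose n-th      *)
(* coefficient is in F_n; gr is its quotient by the sum of all F_(n-1), with  *)
(* F_(-1) = 0.                                                                *)
Definition fil_pred (n : nat) : A -> Prop :=
  if n is m.+1 then fA m else fun a => a = 0.

Definition rees_pred : {pred polyF} :=
  fun p => `[< forall n, fA n (p : {poly A})`_n >].

Lemma rees_predP p : reflect (forall n, fA n (p : {poly A})`_n) (p \in rees_pred).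
Proof. exact: asboolP. Qed.

Fact fil_sum n (I : Type) (s : seq I) (a : I -> A) :
  (forall i, fA n (a i)) -> fA n (\sum_(i <- s) a i).
Proof.
move=> h; elim: s => [|i s IHs]; first by rewrite big_nil; exact: fil0.
by rewrite big_cons -[a i]scale1r; apply: fil_lin.
Qed.

Fact rees_subalg_closed : subalg_closed rees_pred.
Proof.
split.
- apply/rees_predP => -[|n]; rewrite coef1 /=; first exact: fil_1.
  exact: fil0.
- move=> a p q /rees_predP hp /rees_predP hq; apply/rees_predP => n.
  by rewrite coefD coef_polyFZ; apply: fil_lin.
- move=> p q /rees_predP hp /rees_predP hq; apply/rees_predP => n.
  rewrite coefM; apply: fil_sum => i.
  by rewrite -[X in fA X](subnKC (ltn_ord i : i <= n)%N); apply: filM.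
Qed.
HB.instance Definition _ :=
  GRing.isSubalgClosed.Build F polyF rees_pred rees_subalg_closed.

Record rees := Rees { rees_val : polyF; _ : rees_val \in rees_pred }.
HB.instance Definition _ := [isSub for rees_val].
HB.instance Definition _ := [Choice of rees by <:].
HB.instance Definition _ := [SubChoice_isSubAlgebra of rees by <:].

Definition rees_lower (p : rees) : Prop :=
  forall n, fil_pred n (rees_val p : {poly A})`_n.

Fact fil_predW n x : fil_pred n x -> fA n x.
Proof. by case: n => [->|n /filS//]; exact: fil0. Qed.
Fact fil_pred_lin n a x y : fil_pred n x -> fil_pred n y -> fil_pred n (a *: x + y).
Proof. by case: n => [-> ->|n]; [rewrite scaler0 addr0 | exact: fil_lin]. Qed.
Fact fil_predMr m n x y : fil_pred m x -> fA n y -> fil_pred (m + n) (x * y).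
Proof.
case: m => [->|m]; last exact: filM.
by rewrite mul0r; case: n => //= n _; exact: fil0.
Qed.
Fact fil_predMl m n x y : fA m x -> fil_pred n y -> fil_pred (m + n) (x * y).
Proof.
case: n => [_ ->|n]; last by rewrite addnS; exact: filM.
by rewrite mulr0; case: (m + 0)%N => //= k; exact: fil0.
Qed.
Fact fil_pred_sum n (I : Type) (s : seq I) (a : I -> A) :
  (forall i, fil_pred n (a i)) -> fil_pred n (\sum_(i <- s) a i).
Proof.
move=> h; elim: s => [|i s IHs]; last by rewrite big_cons -[a i]scale1r; apply: fil_pred_lin.
by rewrite big_nil; case: n {h} => //= n; exact: fil0.
Qed.

Lemma rees_lower_ideal p : ideal rees_lower p -> rees_lower p.
Proof.
apply: span_ind_in => [n|a x y hx hy n|_ [r [x [s [hx ->]]]] n].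
- by rewrite coef0; case: n => //= n; exact: fil0.
- by rewrite coefD coef_polyFZ; apply: fil_pred_lin.
- have hr : forall n, fA n (rees_val r : {poly A})`_n by apply/rees_predP; exact: valP.
  have hs : forall n, fA n (rees_val s : {poly A})`_n by apply/rees_predP; exact: valP.
  rewrite -[rees_val _]/(rees_val r * rees_val x * rees_val s) coefM.
  apply: fil_pred_sum => i; rewrite -[X in fil_pred X](subnKC (ltn_ord i : i <= n)%N).
  apply: fil_predMr => //; rewrite coefM; apply: fil_pred_sum => j.
  rewrite -[X in fil_pred X](subnKC (ltn_ord j : j <= i)%N).
  exact: fil_predMl.
Qed.

Fact gr_proper : ~ ideal rees_lower 1.
Proof. by move=> /rees_lower_ideal/(_ 0)/= /eqP; rewrite coef1 oner_eq0. Qed.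

Definition gr : Type := qalg gr_proper.
HB.instance Definition _ := GRing.Algebra.on gr.

Fact rees_monomial_subproof n (a : A) : fA n a -> (a *: 'X^n : {poly A}) \in rees_pred.
Proof.
move=> fa; apply/rees_predP => m; rewrite coefZ coefXn.
by case: eqP => [->|_]; rewrite ?mulr1 ?mulr0 //; exact: fil0.
Qed.

(* the class of a in F_n / F_(n-1); junk if a is not in F_n *)
Definition symbol (n : nat) (a : A) : gr :=
  if pselect (fA n a) is left fa
  then qproj gr_proper (Rees (rees_monomial_subproof fa)) else 0.
End AssociatedGraded.

(* Hopf algebras *)
Record hopfAlg (F : fieldType) := HopfAlg {
  hopf_algebra :> algType F;
  comul : {lrmorphism hopf_algebra -> tensor hopf_algebra hopf_algebra};
  counit : {lrmorphism hopf_algebra -> F^o};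
  antipode : {linear hopf_algebra -> hopf_algebra};
  comulA : forall h,
    tlift (fun a b => tlift (fun a1 a2 => a1 ⊗ (a2 ⊗ b)) (comul a)) (comul h)
    = tlift (fun a b => a ⊗ comul b) (comul h);
  counitl : forall h, tlift (fun a b => (counit a : F) *: b) (comul h) = h;
  counitr : forall h, tlift (fun a b => (counit b : F) *: a) (comul h) = h;
  antipodel : forall h,
    tlift (fun a b => antipode a * b) (comul h) = (counit h : F) *: 1;
  antipoder : forall h,
    tlift (fun a b => a * antipode b) (comul h) = (counit h : F) *: 1
}.

Section HopfAlgebra.
Variables (F : fieldType) (H : hopfAlg F).

Definition cocommutative : Prop :=
  forall h : H, tlift (fun a b => b ⊗ a) (comul H h) = comul H h.

Definition grouplike (g : H) : Prop := comul H g = g ⊗ g /\ counit H g = 1.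
Definition primitive (x : H) : Prop := comul H x = x ⊗ 1 + 1 ⊗ x.

Definition subcoalgebra (D : H -> Prop) : Prop :=
  [/\ D 0, forall a x y, D x -> D y -> D (a *: x + y)
    & forall x, D x ->
        span (fun t => exists a b, [/\ D a, D b & t = a ⊗ b]) (comul H x)].

Definition simple_subcoalgebra (D : H -> Prop) : Prop :=
  [/\ subcoalgebra D, exists2 d, D d & d != 0
    & forall E, subcoalgebra E -> (forall x, E x -> D x) ->
        (forall x, E x -> x = 0) \/ (forall x, D x -> E x)].

Definition pointed : Prop := forall D, simple_subcoalgebra D ->
  exists2 d, d != 0 & forall x, D x <-> exists a, x = a *: d.
End HopfAlgebra.

Section HopfMorphism.
Variables (F : fieldType) (K H : hopfAlg F).

Definition coalgebra_map (f : {linear K -> H}) : Prop :=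
  (forall x, comul H (f x) = tmap f f (comul K x)) /\
  (forall x, counit H (f x) = counit K x).

Definition hopf_morphism (f : {lrmorphism K -> H}) : Prop :=
  coalgebra_map f /\ forall x, f (antipode K x) = antipode H (f x).
End HopfMorphism.

Record is_module (F : fieldType) (H : algType F) (V : lmodType F)
    (act : H -> V -> V) : Prop := {
  act_bilinear : is_bilinear act;
  act1 : forall v, act 1 v = v;
  actM : forall g h v, act (g * h) v = act g (act h v)
}.

Section Orthogonal.
Variables (F : fieldType) (H : hopfAlg F) (V : vectType F).
Variables (form : {symmetric V}) (act : H -> V -> V).

Definition orthogonal_module : Prop :=
  is_module act /\
  forall h v w, tlift (fun a b => form (act a v) (act b w) : F^o) (comul H h)
                = (counit H h : F) * form v w.

Definition detV (f : V -> V) : F :=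
  \det (passmx.mxof (vbasis {:V}) (vbasis {:V}) (linfun f)).

(* homogeneous elements of parity b for the Z/2-grading with                  *)
(* (-1)^|g| = det(g|V) for g group-like and |x| = 0 for x primitive; H is     *)
(* spanned by the products x_1 ... x_k g.                                     *)
Definition parity (b : bool) : H -> Prop :=
  span (fun h => exists (xs : seq H) (g : H),
    [/\ forall x, x \in xs -> primitive x, grouplike g,
        detV (act g) = (-1) ^+ b & h = (\prod_(x <- xs) x) * g]).
End Orthogonal.

(* T(V), as the free algebra on V modulo linearity of V *)
Section TensorAlgebraOf.
Variables (F : fieldType) (V : lmodType F).

Inductive talg_rel : free_alg F V -> Prop :=
| talg_rel_lin a u v :
    talg_rel (free_var F (a *: u + v) - (a *: free_var F u + free_var F v)).

Fact talg_proper : ~ ideal talg_rel 1.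
Proof.
apply: (@ideal_proper F _ F^o (free_eval (fun _ : V => 0 : F^o))) => _ [a u v].
by rewrite raddfB /= linearP /= !free_eval_var scaler0 addr0 subrr.
Qed.

Definition talg : Type := qalg talg_proper.
HB.instance Definition _ := GRing.Algebra.on talg.
Definition talg_in (v : V) : talg := qproj talg_proper (free_var F v).
End TensorAlgebraOf.

(* T(V) x| H and S(V) x| H *)
Section Smash.
Variables (F : fieldType) (H : hopfAlg F) (V : lmodType F) (act : H -> V -> V).

Let gen : choiceType := (V + H)%type.
Let v_ (v : V) : free_alg F gen := free_var F (inl v : gen).
Let h_ (h : H) : free_alg F gen := free_var F (inr h : gen).

Inductive smash_rel : free_alg F gen -> Prop :=
| smash_rel_linV a u v : smash_rel (v_ (a *: u + v) - (a *: v_ u + v_ v))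
| smash_rel_linH a g h : smash_rel (h_ (a *: g + h) - (a *: h_ g + h_ h))
| smash_rel_1 : smash_rel (h_ 1 - 1)
| smash_rel_M g h : smash_rel (h_ (g * h) - h_ g * h_ h)
| smash_rel_act h v (s : seq (H * H)) :
    comul H h = \sum_(p <- s) p.1 ⊗ p.2 ->
    smash_rel (h_ h * v_ v - \sum_(p <- s) v_ (act p.1 v) * h_ p.2).

Definition sym_smash_rel (r : free_alg F gen) : Prop :=
  smash_rel r \/ exists v w, r = v_ v * v_ w - v_ w * v_ v.

Let aug := free_eval (fun x : gen => if x is inr h then counit H h else 0 : F^o).
Let aug_v v : aug (v_ v) = 0. Proof. exact: free_eval_var. Qed.
Let aug_h h : aug (h_ h) = counit H h. Proof. exact: free_eval_var. Qed.

Fact smash_rel_aug r : smash_rel r -> aug r = 0.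
Proof.
case=> [a u v|a g h||g h|h v s _].
- by rewrite /aug raddfB /= linearP /= -/aug !aug_v scaler0 addr0 subrr.
- by rewrite /aug raddfB /= linearP /= -/aug !aug_h linearP subrr.
- by rewrite /aug raddfB /= rmorph1 -/aug aug_h rmorph1 subrr.
- by rewrite /aug raddfB /= rmorphM /= -/aug !aug_h rmorphM subrr.
- rewrite /aug raddfB /= rmorphM raddf_sum /= -/aug aug_v mulr0 sub0r.
  by rewrite big1 ?oppr0 // => p _; rewrite /aug rmorphM /= -/aug aug_v mul0r.
Qed.

Fact smash_proper : ~ ideal smash_rel 1.
Proof. exact: (@ideal_proper F _ F^o aug smash_rel smash_rel_aug). Qed.

Fact sym_smash_proper : ~ ideal sym_smash_rel 1.
Proof.
apply: (@ideal_proper F _ F^o aug) => r [/smash_rel_aug//|[v [w ->]]].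
by rewrite /aug raddfB /= !rmorphM /= -/aug !aug_v mul0r subrr.
Qed.

Definition smash : Type := qalg smash_proper.
HB.instance Definition _ := GRing.Algebra.on smash.
Definition smashV (v : V) : smash := qproj smash_proper (v_ v).
Definition smashH (h : H) : smash := qproj smash_proper (h_ h).

Fact smash_eq x y : smash_rel (x - y) -> qproj smash_proper x = qproj smash_proper y.
Proof.
move=> r; apply/eqP; rewrite -subr_eq0 -raddfB; apply/eqP.
by apply/(qprojP smash_proper).2; exact: ideal_gen.
Qed.
Fact smashV_linear : linear smashV.
Proof. by move=> a u v; rewrite /smashV (smash_eq (smash_rel_linV a u v)) linearP. Qed.
HB.instance Definition _ := GRing.isLinear.Build F V smash *:%R smashV smashV_linear.
Fact smashH_linear : linear smashH.
Proof. by move=> a g h; rewrite /smashH (smash_eq (smash_rel_linH a g h)) linearP. Qed.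
HB.instance Definition _ := GRing.isLinear.Build F H smash *:%R smashH smashH_linear.
Fact smashH_monoid : monoid_morphism smashH.
Proof.
split; first by rewrite /smashH (smash_eq smash_rel_1) rmorph1.
by move=> g h; rewrite /smashH (smash_eq (smash_rel_M g h)) rmorphM.
Qed.
HB.instance Definition _ := GRing.isMonoidMorphism.Build H smash smashH smashH_monoid.

Definition sym_smash : Type := qalg sym_smash_proper.
HB.instance Definition _ := GRing.Algebra.on sym_smash.
Definition sym_smashV (v : V) : sym_smash := qproj sym_smash_proper (v_ v).
Definition sym_smashH (h : H) : sym_smash := qproj sym_smash_proper (h_ h).
End Smash.

(* the filtration of A by the number of factors from V *)
Section WordFiltration.
Variables (F : fieldType) (A : algType F) (V H : lmodType F).
Variables (jV : V -> A) (jH : H -> A).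

Let letter (x : V + H) : A := match x with inl v => jV v | inr h => jH h end.
Let isV (x : V + H) : bool := if x is inl _ then true else false.

Definition word_fil (n : nat) : A -> Prop :=
  span (fun a => exists w : seq (V + H),
    (count isV w <= n)%N /\ a = \prod_(x <- w) letter x).

Fact word_fil0 n : word_fil n 0. Proof. exact: span0. Qed.
Fact word_fil_lin n a x y : word_fil n x -> word_fil n y -> word_fil n (a *: x + y).
Proof. exact: span_lin. Qed.
Fact word_filS n x : word_fil n x -> word_fil n.+1 x.
Proof.
elim=> [|_ [w [wn ->]]|a {}x y _ hx _ hy]; [exact: span0| |exact: span_lin].
by apply: span_gen; exists w; split=> //; apply: leqW.
Qed.
Fact word_fil_1 : word_fil 0 1.
Proof. by apply: span_gen; exists [::]; rewrite big_nil. Qed.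
Fact word_filM m n x y : word_fil m x -> word_fil n y -> word_fil (m + n) (x * y).
Proof.
move=> hx hy; elim: hx => [|_ [u [um ->]]|a {}x z _ hx _ hz].
- by rewrite mul0r; exact: span0.
- elim: hy => [|_ [w [wn ->]]|a {}y z _ hy _ hz].
  + by rewrite mulr0; exact: span0.
  + by apply: span_gen; exists (u ++ w); rewrite count_cat big_cat leq_add.
  + by rewrite mulrDr -scalerAr; exact: span_lin.
- by rewrite mulrDl -scalerAl; exact: span_lin.
Qed.

Definition word_filtration : filtration A :=
  Filtration word_fil0 word_fil_lin word_filS word_fil_1 word_filM.
End WordFiltration.

Section HopfHecke.
Variables (F : fieldType) (H : hopfAlg F) (V : vectType F) (act : H -> V -> V).
Variable kappa : {linear ext_square V -> H}.
Variables (A : algType F) (qA : {lrmorphism smash act -> A}).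

Definition kappa_rel (r : smash act) : Prop := exists v w,
  r = smashV act v * smashV act w - smashV act w * smashV act v
      - smashH act (kappa (wedge v w)).

Definition heckeV : {linear V -> A} := qA \o smashV act.
Definition heckeH : {lrmorphism H -> A} := qA \o smashH act.

Definition hecke_fil : filtration A := word_filtration heckeV heckeH.

(* the algebra map phi is unique, since V and H generate S(V) x| H *)
Definition PBW : Prop :=
  exists phi : {lrmorphism sym_smash act -> gr hecke_fil},
    [/\ forall v, phi (sym_smashV act v) = symbol hecke_fil 1 (heckeV v),
        forall h, phi (sym_smashH act h) = symbol hecke_fil 0 (heckeH h)
      & bijective phi].

(* A = (T(V) x| H) / I_kappa, with quotient map qA *)
Definition hopf_hecke : Prop := is_quotient qA (ideal kappa_rel) /\ PBW.
End HopfHecke.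

Section Clifford.
Variables (F : fieldType) (V : vectType F) (form : {symmetric V}).
Variables (C : algType F) (qC : {lrmorphism talg V -> C}).

Definition clifford_rel (r : talg V) : Prop := exists v w,
  r = talg_in v * talg_in w + talg_in w * talg_in v - (2%:R * form v w) *: 1.

Definition is_clifford : Prop := is_quotient qC (ideal clifford_rel).

Definition cliffV (v : V) : C := qC (talg_in v).

Definition cliff_parity (b : bool) : C -> Prop :=
  span (fun c => exists vs : seq V,
    odd (size vs) = b /\ c = \prod_(v <- vs) cliffV v).

(* the reflection in the hyperplane orthogonal to a unit vector v *)
Definition reflection (v u : V) : V := u - (2%:R * form u v) *: v.

(* p lies in Pin(V) and is mapped to f by Pin(V) -> O(V); unit vectors are    *)
(* their own inverses in C, so their products form the group they generate.   *)
Definition pin_over (p : C) (f : V -> V) : Prop := exists vs : seq V,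
  [/\ forall v, v \in vs -> form v v = 1, p = \prod_(v <- vs) cliffV v
    & forall u, f u = foldr reflection u vs].
End Clifford.

Section PinCover.
Variables (F : fieldType) (H : hopfAlg F) (V : vectType F).
Variables (form : {symmetric V}) (act : H -> V -> V).
Variables (C : algType F) (qC : {lrmorphism talg V -> C}).
Variables (Ht : hopfAlg F).
Variables (pi : {lrmorphism Ht -> H}) (gamma : {lrmorphism Ht -> C}).

Let actt (h : Ht) : V -> V := act (pi h).

Definition double_cover : Prop := exists i1 i2 : {linear H -> Ht},
  [/\ coalgebra_map i1, coalgebra_map i2,
      bijective (fun hk : H * H => i1 hk.1 + i2 hk.2),
      bijective (pi \o i1) & bijective (pi \o i2)].

Record is_pin_cover : Prop := {
  pin_cocommutative : cocommutative Ht;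
  pin_pointed : pointed Ht;
  pin_hopf_morphism : hopf_morphism pi;
  pin_surjective : forall h, exists ht, pi ht = h;
  pin_double_cover : double_cover;
  pin_parity : forall b h, parity actt b h -> cliff_parity qC b (gamma h);
  pin_equivariant : forall b h v, parity actt b h ->
    cliffV qC ((-1) ^+ b *: actt h v)
    = tlift (fun h1 h2 => gamma h1 * cliffV qC v * gamma (antipode Ht h2))
        (comul Ht h);
  (* G(Ht) is the pullback of G(H) -> O(V) <- Pin(V) *)
  pin_pullback_inj : forall x y : Ht, grouplike x -> grouplike y ->
    pi x = pi y -> gamma x = gamma y -> x = y;
  pin_pullback_im : forall (g : H) (p : C),
    (exists x : Ht, [/\ grouplike x, pi x = g & gamma x = p])
    <-> grouplike g /\ pin_over form qC p (act g);
  (* pi identifies P(Ht) with P(H) *)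
  pin_prim_inj : forall x y : Ht,
    primitive x -> primitive y -> pi x = pi y -> x = y;
  pin_prim_surj : forall x : H, primitive x ->
    exists2 y : Ht, primitive y & pi y = x;
  pin_prim_span : forall x : Ht, primitive x ->
    span (fun c => exists v w,
            c = cliffV qC v * cliffV qC w - cliffV qC w * cliffV qC v) (gamma x);
  pin_prim_comm : forall (x : Ht) (u : V), primitive x ->
    gamma x * cliffV qC u - cliffV qC u * gamma x = cliffV qC (actt x u)
}.
End PinCover.

Section Dirac.
Variables (F : fieldType) (H Ht : hopfAlg F) (A C : algType F).
Variables (jH : {lrmorphism H -> A}).
Variables (pi : {lrmorphism Ht -> H}) (gamma : {lrmorphism Ht -> C}).

Definition diag_map : {lrmorphism Ht -> tensor A C} :=
  tmap (jH \o pi) gamma \o comul Ht.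

Variables (V : vectType F) (act : H -> V -> V) (D : tensor A C).

Definition parthasarathy : Prop := exists z h,
  [/\ z \in @central F (tensor A C), parity (fun h => act (pi h)) false h
    & D * D = z + diag_map h].
End Dirac.

Definition dual_bases (F : fieldType) (V : vectType F) (form : {symmetric V})
    (n : nat) (e e' : n.-tuple V) : Prop :=
  [/\ basis_of {:V} e, basis_of {:V} e'
    & forall i j : 'I_n, form (tnth e i) (tnth e' j) = (i == j)%:R].

Definition dirac (F : fieldType) (V : vectType F) (A C : algType F)
    (jV : V -> A) (cV : V -> C) (n : nat) (e e' : n.-tuple V) : tensor A C :=
  \sum_(i < n) jV (tnth e i) ⊗ cV (tnth e' i).

(* Main.v *)
(* Write d x = D x - alpha(x) D for the twisted commutator with D, where alpha *)
(* is the parity automorphism of C, and call x in A ⊗ C invariant if it       *)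
(* supercommutes with Delta_C(H~). By the Parthasarathy condition D^2 commutes *)
(* with invariants, so d^2 = 0 on them. The point is that an invariant x with *)
(* d x = 0 is Delta_C(k) + d y for some invariant y, with Delta_C(k) unique:   *)
(* applied to x = z ⊗ 1 this defines zeta(z) as the class of k, and uniqueness *)
(* makes zeta an algebra map.                                                 *)
(* By PBW and induction on the filtration degree, it suffices to treat the    *)
(* symbol of d on (S(V) x| H) ⊗ C. That is a Koszul differential: with s the   *)
(* companion operator built from contractions on S(V) x| H, d s + s d is four *)
(* times the degree plus a sum of commuting idempotents, hence invertible in  *)
(* positive degree; in degree 0 the kernel of d is Delta(H~). Invariance is   *)
(* checked on generators of H~: pointed cocommutative Hopf algebras in        *)
(* characteristic 0 are generated by grouplike and primitive elements.        *)

Require Import Defs.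
From HB Require Import structures.
From mathcomp Require Import all_boot all_algebra.
From mathcomp Require Import boolp.
(* imported again because vector.v also defines a [span] *)
Import Defs.

Set Implicit Arguments.
Unset Strict Implicit.
Unset Printing Implicit Defensive.

Import GRing.Theory.
Local Open Scope ring_scope.

(** * Linear algebra and tensor products *)

(** Let d x = D x - alpha(x) D on A ⊗ C. Then d(d x) is the commutator of D^2 with x ([dirac_d2]).
    Call x invariant if it supercommutes with Delta(H~). The Parthasarathy condition writes D^2 as a
    central element plus Delta of an even element, and such a Delta commutes with every invariant
    ([parity_even_comm]); hence d squares to zero on invariants. Both Delta(k) and z ⊗ 1 are killed
    by d. The heart is [dirac_exact]: an invariant x with d x = 0 equals Delta(k) + d y with y
    invariant. For x = z ⊗ 1 this produces k, and [dirac_unique] shows that Delta(k) depends on z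
    alone. That the class of k is linear, multiplicative and central in z is then formal, and
    replacing y by its odd part b turns d y into D b + b D.

    [dirac_exact] is a descent on the filtration of A. By PBW ([hecke_pbw]) the leading part of d is
    the analogous operator on (S(V) x| H) ⊗ C. There, left Clifford multiplications and right ones,
    suitably twisted by the coaction of H, anticommute with each other and have opposite squares, so
    their sums and differences are fermionic creation and annihilation operators ([twistXC]). This
    makes the leading part a Koszul differential ([graded_dE]). With the Koszul homotopy s, d s + s
    d is 4 times the degree plus a sum of commuting idempotents, which is invertible in positive
    degree in characteristic 0; so invariant cocycles of positive degree are exact ([graded_exact]).
    In degree 0 the cocycles are the vectors killed by all annihilators, and these are exactly
    Delta(H~) ([graded_kernel0], with [vacuum_clifford]). A solution for symbols is lifted to A ⊗ C
    by symmetrization, which is linear over H on both sides ([theta_mull], [theta_mulr]) and so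
    keeps invariance; subtracting d of the lift lowers the degree.

    All equivariance is checked on group-like and primitive elements, which is enough by
    [pointed_cocommutative_generated]. For that theorem, a finite-dimensional subcoalgebra is split
    by generalized kernels until the forms vanishing on one group-like g act nilpotently. The
    coaction matrix, divided by g, is then unipotent; its logarithm has primitive entries and its
    exponential recovers the subcoalgebra. *)

Section LinearClosure.
Variables (F : fieldType) (M : lmodType F).

Definition lin_closed (P : M -> Prop) : Prop :=
  P 0 /\ forall a x y, P x -> P y -> P (a *: x + y).

Lemma lin_closedZ P a x : lin_closed P -> P x -> P (a *: x).
Proof. by move=> [P0 Pl] Px; rewrite -[_ *: _]addr0; exact: Pl. Qed.
Lemma lin_closedD P x y : lin_closed P -> P x -> P y -> P (x + y).
Proof. by move=> [P0 Pl] Px Py; rewrite -[x]scale1r; exact: Pl. Qed.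
Lemma lin_closedB P x y : lin_closed P -> P x -> P y -> P (x - y).
Proof. by move=> [P0 Pl] Px Py; rewrite addrC -scaleN1r; exact: Pl. Qed.
Lemma lin_closed_sum P (I : Type) (s : seq I) (Q : pred I) (f : I -> M) :
  lin_closed P -> (forall i, Q i -> P (f i)) -> P (\sum_(i <- s | Q i) f i).
Proof.
move=> Plin Pf; apply: big_ind => //; first exact: Plin.1.
by move=> x y; exact: lin_closedD.
Qed.

Lemma lin_closed_span (X : M -> Prop) : lin_closed (span X).
Proof. by split; [exact: span0 | move=> *; exact: span_lin]. Qed.

Lemma span_sub (P X : M -> Prop) :
  lin_closed P -> (forall x, X x -> P x) -> forall x, span X x -> P x.
Proof. by move=> [P0 Pl] XP; apply: span_ind_in. Qed.

Lemma span_mono (X Y : M -> Prop) :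
  (forall x, X x -> Y x) -> forall x, span X x -> span Y x.
Proof. by move=> XY; apply: span_sub (lin_closed_span Y) _ => x /XY; exact: span_gen. Qed.
End LinearClosure.

Lemma lin_closed_preim (F : fieldType) (M N : lmodType F) (f : {linear M -> N})
    (P : N -> Prop) : lin_closed P -> lin_closed (fun x => P (f x)).
Proof. by move=> [P0 Pl]; split=> [|a x y]; rewrite ?raddf0 // linearP; exact: Pl. Qed.

Section Multiplication.
Variables (F : fieldType) (A : algType F) (a : A).
Definition lmul (x : A) : A := a * x.
Fact lmul_linear : linear lmul.
Proof. by move=> c x y; rewrite /lmul mulrDr scalerAr. Qed.
HB.instance Definition _ := GRing.isLinear.Build F A A *:%R lmul lmul_linear.
Definition rmul (x : A) : A := x * a.
Fact rmul_linear : linear rmul.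
Proof. by move=> c x y; rewrite /rmul mulrDl scalerAl. Qed.
HB.instance Definition _ := GRing.isLinear.Build F A A *:%R rmul rmul_linear.
End Multiplication.

Lemma lin_closed_eq (F : fieldType) (M N : lmodType F) (f g : {linear M -> N}) :
  lin_closed (fun x => f x = g x).
Proof. by split=> [|a x y fg fg']; rewrite ?raddf0 // !linearP fg fg'. Qed.

Definition free_family (F : fieldType) (M : lmodType F) r (w : 'I_r -> M) : Prop :=
  forall c : 'I_r -> F, \sum_i c i *: w i = 0 -> forall i, c i = 0.

Section DualFamily.
Variables (F : fieldType) (M : lmodType F).

(** Each [w i] stays nonzero modulo the span of the other members, so a linear form on that quotient
    can take the value 1 on it. [M] may be infinite-dimensional. *)
Lemma free_dual r (w : 'I_r -> M) : free_family w ->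
  exists f : 'I_r -> {linear M -> F^o}, forall i j, f i (w j) = (i == j)%:R.
Proof.
move=> wfree.
suff dual i : exists f : {linear M -> F^o}, forall j, f (w j) = (i == j)%:R.
  by have [f fP] := choice dual; exists f.
pose X x := exists2 j, j != i & x = w j.
have Xi : ~ span X (w i).
  suff Xc x : span X x -> exists2 c : 'I_r -> F, c i = 0 & x = \sum_j c j *: w j.
    move=> /Xc[c ci wi].
    have /wfree/(_ i) : \sum_j (c j - (j == i)%:R) *: w j = 0.
      under eq_bigr do rewrite scalerBl.
      rewrite sumrB -wi (bigD1 i) //= eqxx scale1r big1 ?addr0 ?subrr //.
      by move=> j /negPf->; rewrite scale0r.
    by rewrite ci eqxx sub0r => /eqP; rewrite oppr_eq0 oner_eq0.
  elim=> [|_ [j ji ->]|a {}x y _ [c ci ->] _ [d di ->]].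
  - by exists (fun=> 0) => //; rewrite big1 // => j _; rewrite scale0r.
  - exists (fun k => (k == j)%:R); first by rewrite eq_sym (negPf ji).
    rewrite (bigD1 j) //= eqxx scale1r big1 ?addr0 // => k /negPf->.
    by rewrite scale0r.
  - exists (fun k => a * c k + d k); first by rewrite ci di mulr0 addr0.
    rewrite scaler_sumr -big_split /=; apply: eq_bigr => k _.
    by rewrite scalerDl scalerA.
have [|f f_lin fwi] := @linear_form_exists F (qmod X) (qmap X (w i)).
  by apply/eqP => /((qmapP X).2 _).1.
pose f' : {linear qmod X -> F^o} :=
  HB.pack f (GRing.isLinear.Build _ _ _ _ f f_lin).
exists (f' \o qmap X) => j /=; case: eqVneq => [<-|ij]; first exact: fwi.
have -> : qmap X (w j) = 0.
  by apply/((qmapP X).2 _).2/span_gen; exists j => //; rewrite eq_sym.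
exact: (raddf0 f').
Qed.

Lemma nonzero_dual (x : M) : x != 0 -> exists f : {linear M -> F^o}, f x = 1.
Proof.
move=> /linear_form_exists[f f_lin fx].
pose f' : {linear M -> F^o} :=
  HB.pack f (GRing.isLinear.Build _ _ _ _ f f_lin).
by exists f'.
Qed.
End DualFamily.

Section TensorLinear.
Variables (F : fieldType) (U W Z : lmodType F).

Section Lin.
Variables (f : U -> W -> Z) (hf : is_bilinear f).
Definition tlin : tensor U W -> Z := let _ := hf in tlift f.
Fact tlin_linear : linear tlin. Proof. exact: tlift_linear. Qed.
HB.instance Definition _ := GRing.isLinear.Build F _ _ *:%R tlin tlin_linear.
Lemma tlinE u w : tlin (u ⊗ w) = f u w. Proof. exact: tlift_tens. Qed.
Lemma tliftE : tlift f = tlin. Proof. by []. Qed.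
End Lin.

Lemma tensor_eq (f g : {linear tensor U W -> Z}) :
  (forall u w, f (u ⊗ w) = g (u ⊗ w)) -> f =1 g.
Proof.
move=> fg t; elim/tensor_ind: t => [//|a x y fgx fgy].
by rewrite !linearP fgx fgy.
Qed.
End TensorLinear.

Section TensorSlice.
Variables (F : fieldType) (U W : lmodType F).
Implicit Types t : tensor U W.

Lemma tensDl (u u' : U) (w : W) : (u + u') ⊗ w = u ⊗ w + u' ⊗ w.
Proof. by have := (tens_bilinear U W).1 w 1 u u'; rewrite /= !scale1r. Qed.
Lemma tensDr (u : U) (w w' : W) : u ⊗ (w + w') = u ⊗ w + u ⊗ w'.
Proof. by have := (tens_bilinear U W).2 u 1 w w'; rewrite /= !scale1r. Qed.
Lemma tens0l (w : W) : (0 : U) ⊗ w = 0.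
Proof. by apply: (addrI (0 ⊗ w)); rewrite -tensDl !addr0. Qed.
Lemma tens0r (u : U) : u ⊗ (0 : W) = 0.
Proof. by apply: (addrI (u ⊗ 0)); rewrite -tensDr !addr0. Qed.
Lemma tensZl a (u : U) (w : W) : (a *: u) ⊗ w = a *: (u ⊗ w).
Proof. by have := (tens_bilinear U W).1 w a u 0; rewrite /= !addr0 tens0l addr0. Qed.
Lemma tensZr a (u : U) (w : W) : u ⊗ (a *: w) = a *: (u ⊗ w).
Proof. by have := (tens_bilinear U W).2 u a w 0; rewrite /= !addr0 tens0r addr0. Qed.
Lemma tensNl (u : U) (w : W) : (- u) ⊗ w = - (u ⊗ w).
Proof. by rewrite -scaleN1r tensZl scaleN1r. Qed.
Lemma tensNr (u : U) (w : W) : u ⊗ (- w) = - (u ⊗ w).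
Proof. by rewrite -scaleN1r tensZr scaleN1r. Qed.
Lemma tensBl (u u' : U) (w : W) : (u - u') ⊗ w = u ⊗ w - u' ⊗ w.
Proof. by rewrite tensDl tensNl. Qed.
Lemma tensBr (u : U) (w w' : W) : u ⊗ (w - w') = u ⊗ w - u ⊗ w'.
Proof. by rewrite tensDr tensNr. Qed.
Lemma tens_suml (I : Type) (s : seq I) (P : pred I) (u : I -> U) (w : W) :
  (\sum_(i <- s | P i) u i) ⊗ w = \sum_(i <- s | P i) u i ⊗ w.
Proof. by elim/big_rec2: _ => [|i x y _ <-]; rewrite ?tens0l ?tensDl. Qed.
Lemma tens_sumr (I : Type) (s : seq I) (P : pred I) (u : U) (w : I -> W) :
  u ⊗ (\sum_(i <- s | P i) w i) = \sum_(i <- s | P i) u ⊗ w i.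
Proof. by elim/big_rec2: _ => [|i x y _ <-]; rewrite ?tens0r ?tensDr. Qed.

Fact slicel_bilinear (f : {linear U -> F^o}) :
  is_bilinear (fun (u : U) (w : W) => (f u : F) *: w).
Proof.
split=> [w a u u'|u a w w'] /=; first by rewrite linearP scalerDl scalerA.
by rewrite scalerDr !scalerA mulrC.
Qed.
Definition slicel f : tensor U W -> W := tlin (slicel_bilinear f).
HB.instance Definition _ f := GRing.Linear.on (slicel f).
Lemma slicelE f u w : slicel f (u ⊗ w) = (f u : F) *: w.
Proof. exact: tlinE. Qed.

Fact slicer_bilinear (f : {linear W -> F^o}) :
  is_bilinear (fun (u : U) (w : W) => (f w : F) *: u).
Proof.
split=> [w a u u'|u a w w'] /=; first by rewrite scalerDr !scalerA mulrC.
by rewrite linearP scalerDl scalerA.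
Qed.
Definition slicer f : tensor U W -> U := tlin (slicer_bilinear f).
HB.instance Definition _ f := GRing.Linear.on (slicer f).
Lemma slicerE f u w : slicer f (u ⊗ w) = (f w : F) *: u.
Proof. exact: tlinE. Qed.

Lemma tensor_sum t :
  exists r (u : 'I_r -> U) (w : 'I_r -> W), t = \sum_i u i ⊗ w i.
Proof.
suff [s ->] : exists s : seq (U * W), t = \sum_(p <- s) p.1 ⊗ p.2.
  by exists (size s), (fun i => (tnth (in_tuple s) i).1),
    (fun i => (tnth (in_tuple s) i).2); rewrite big_tnth.
elim/tensor_ind: t => [u w|a x y [s ->] [s' ->]].
  by exists [:: (u, w)]; rewrite big_seq1.
exists ([seq (a *: p.1, p.2) | p <- s] ++ s'); rewrite big_cat big_map /=.
by congr (_ + _); rewrite scaler_sumr; apply: eq_bigr => p _; rewrite tensZl.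
Qed.

(** A decomposition with the fewest terms works: a relation within either family would let one term
    be absorbed into the others. *)
Lemma tensor_sum_free t :
  exists r (u : 'I_r -> U) (w : 'I_r -> W),
    [/\ t = \sum_i u i ⊗ w i, free_family u & free_family w].
Proof.
pose P r := `[< exists (u : 'I_r -> U) (w : 'I_r -> W), t = \sum_i u i ⊗ w i >].
have exP : exists r, P r.
  by have [r [u [w tE]]] := tensor_sum t; exists r; apply/asboolP; exists u, w.
case: (ex_minnP exP) => r /asboolP[u [w tE]] rmin; exists r, u, w; split=> //.
  move=> c c0; apply: contrapT => /existsNP[i /eqP ci].
  case: r => [|r] in u w tE rmin c c0 i ci *; first by case: i ci.
  suff /rmin : P r by rewrite ltnn.
  apply/asboolP; exists (fun j => u (lift i j)).
  exists (fun j => w (lift i j) - ((c i)^-1 * c (lift i j)) *: w i).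
  have ui : u i = - \sum_j ((c i)^-1 * c (lift i j)) *: u (lift i j).
    move: c0; rewrite (bigD1_ord i) //= => /(congr1 ( *:%R (c i)^-1)).
    rewrite scaler0 scalerDr scalerA mulVf // scale1r => /eqP.
    rewrite addr_eq0 => /eqP->; rewrite scaler_sumr.
    by congr (- _); apply: eq_bigr => j _; rewrite scalerA.
  rewrite tE (bigD1_ord i) //= {1}ui tensNl tens_suml addrC -sumrB.
  by apply: eq_bigr => j _; rewrite tensZl tensBr tensZr.
move=> c c0; apply: contrapT => /existsNP[i /eqP ci].
case: r => [|r] in u w tE rmin c c0 i ci *; first by case: i ci.
suff /rmin : P r by rewrite ltnn.
apply/asboolP; exists (fun j => u (lift i j) - ((c i)^-1 * c (lift i j)) *: u i).
exists (fun j => w (lift i j)).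
have wi : w i = - \sum_j ((c i)^-1 * c (lift i j)) *: w (lift i j).
  move: c0; rewrite (bigD1_ord i) //= => /(congr1 ( *:%R (c i)^-1)).
  rewrite scaler0 scalerDr scalerA mulVf // scale1r => /eqP.
  rewrite addr_eq0 => /eqP->; rewrite scaler_sumr.
  by congr (- _); apply: eq_bigr => j _; rewrite scalerA.
rewrite tE (bigD1_ord i) //= {1}wi tensNr tens_sumr addrC -sumrB.
by apply: eq_bigr => j _; rewrite tensBl tensZl tensZr.
Qed.

Lemma slicer_sum f r (u : 'I_r -> U) (w : 'I_r -> W) :
  slicer f (\sum_i u i ⊗ w i) = \sum_i (f (w i) : F) *: u i.
Proof. by rewrite raddf_sum /=; apply: eq_bigr => i _; rewrite slicerE. Qed.

Lemma slicel_sum f r (u : 'I_r -> U) (w : 'I_r -> W) :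
  slicel f (\sum_i u i ⊗ w i) = \sum_i (f (u i) : F) *: w i.
Proof. by rewrite raddf_sum /=; apply: eq_bigr => i _; rewrite slicelE. Qed.

(** Once the right factors are free, the forms dual to them extract the left factors, so membership
    can be tested slice by slice. *)
Lemma slicer_span (P : U -> Prop) t : lin_closed P ->
  (forall f : {linear W -> F^o}, P (slicer f t)) ->
  span (fun x => exists2 u, P u & exists w, x = u ⊗ w) t.
Proof.
move=> Plin; have [r [u [w [-> _ /free_dual[f fw]]]]] := tensor_sum_free t.
move=> Pt; apply: lin_closed_sum (lin_closed_span _) _ => i _.
apply: span_gen; exists (u i); last by exists (w i).
have := Pt (f i); rewrite slicer_sum (bigD1 i) //= fw eqxx scale1r big1 ?addr0 //.
by move=> j ji; rewrite fw eq_sym (negPf ji) scale0r.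
Qed.

Lemma slicer_eq0 t : (forall f : {linear W -> F^o}, slicer f t = 0) -> t = 0.
Proof.
move=> t0; have P0 : lin_closed (fun u : U => u = 0).
  by split=> // a x y -> ->; rewrite scaler0 addr0.
have := slicer_span P0 t0; elim=> [//|_ [u -> [w ->]]|a x y _ -> _ ->].
  by rewrite tens0l.
by rewrite scaler0 addr0.
Qed.

End TensorSlice.

(** A form detecting a nonzero difference of coefficients would give a nonzero scalar polynomial
    vanishing at all natural numbers, which are pairwise distinct in characteristic 0. *)
Lemma poly_coef_unique (F : fieldType) (F_char0 : [pchar F] =i pred0)
    (M : lmodType F) K (a b : nat -> M) :
  (forall m : nat, \sum_(j < K) (m%:R ^+ j : F) *: a j
                 = \sum_(j < K) (m%:R ^+ j : F) *: b j) ->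
  forall j, (j < K)%N -> a j = b j.
Proof.
move=> ab j jK; apply/eqP; rewrite -subr_eq0; apply: contrapT => /negP.
move=> /nonzero_dual[f]; pose p : {poly F} := \poly_(i < K) (f (a i - b i) : F).
have p0 m : p.[m%:R] = 0.
  have <- : f (\sum_(j < K) (m%:R ^+ j : F) *: (a j - b j)) = 0.
    under eq_bigr do rewrite scalerBr.
    by rewrite sumrB ab subrr raddf0.
  rewrite horner_poly raddf_sum /=; apply: eq_bigr => i _.
  by rewrite linearZ /= mulrC.
have : p = 0.
  apply: (@roots_geq_poly_eq0 _ _ [seq i%:R | i <- iota 0 (size p).+1]).
  - by apply/allP => _ /mapP[i _ ->]; rewrite rootE p0.
  - rewrite map_inj_uniq ?iota_uniq // => m m'.
    wlog le : m m' / (m <= m')%N => [wl|].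
      by have [|/ltnW] := leqP m m'; [exact: wl | move=> ? /esym/wl->].
    move=> /eqP; rewrite eq_sym -subr_eq0 -natrB // => /eqP e; apply/eqP.
    rewrite eqn_leq le /= -subn_eq0; apply: contrapT => /negP d0.
    by move/eqP: e; rewrite ((pcharf0P F).1 F_char0) (negPf d0).
  - by rewrite size_map size_iota.
move=> /(congr1 (fun q : {poly F} => q`_j)); rewrite coef_poly jK coef0 => ->.
by move/eqP; rewrite eq_sym oner_eq0.
Qed.

Section TensorInclusions.
Variables (F : fieldType) (A B : algType F).

Definition tensl (a : A) : tensor A B := a ⊗ 1.
Fact tensl_linear : linear tensl.
Proof. by move=> c x y; rewrite /tensl tensDl tensZl. Qed.
HB.instance Definition _ := GRing.isLinear.Build F _ _ *:%R tensl tensl_linear.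
Fact tensl_monoid : monoid_morphism tensl.
Proof. by split=> // x y; rewrite /tensl tensM mulr1. Qed.
HB.instance Definition _ := GRing.isMonoidMorphism.Build _ _ tensl tensl_monoid.

Definition tensr (b : B) : tensor A B := 1 ⊗ b.
Fact tensr_linear : linear tensr.
Proof. by move=> c x y; rewrite /tensr tensDr tensZr. Qed.
HB.instance Definition _ := GRing.isLinear.Build F _ _ *:%R tensr tensr_linear.
Fact tensr_monoid : monoid_morphism tensr.
Proof. by split=> // x y; rewrite /tensr tensM mulr1. Qed.
HB.instance Definition _ := GRing.isMonoidMorphism.Build _ _ tensr tensr_monoid.
End TensorInclusions.

(** Induction on the alphabet: collect one letter in front; either it occurs often enough to vanish,
    or the word in the remaining letters is still long. *)
Lemma commuting_nilpotent_words (R : nzRingType) r (n : 'I_r -> R) :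
  (forall p q, GRing.comm (n p) (n q)) -> (forall q, exists k, n q ^+ k = 0) ->
  exists K, forall w : seq 'I_r, (K <= size w)%N -> \prod_(q <- w) n q = 0.
Proof.
move=> nC nil.
suff [K KP] : exists K, forall w : seq 'I_r, all (mem (enum 'I_r)) w ->
    (K <= size w)%N -> \prod_(q <- w) n q = 0.
  by exists K => w; apply: KP; apply/allP => q _ /=; rewrite mem_enum.
elim: (enum 'I_r) => [|q s [K KP]].
  by exists 1 => -[].
have [k nk] := nil q; exists (k + K)%N => w ws.
have -> : \prod_(p <- w) n p
    = n q ^+ count_mem q w * \prod_(p <- [seq p <- w | p != q]) n p.
  elim: w {ws} => [|p w IHw]; first by rewrite !big_nil mul1r.
  rewrite big_cons IHw /=; case: eqVneq => [->|_] /=.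
    by rewrite mulrA -exprS.
  by rewrite add0n big_cons !mulrA (commrX _ (nC p q)).
move=> le; have [kc|ck] := leqP k (count_mem q w).
  by rewrite -(subnK kc) exprD nk mulr0 mul0r.
rewrite KP ?mulr0 //.
  apply/allP => p; rewrite mem_filter => /andP[pq /(allP ws)].
  by rewrite /= inE (negPf pq).
rewrite size_filter -(leq_add2l (count_mem q w)) -[X in (_ <= X + _)%N]/(count (pred1 q) w).
rewrite (count_predC (pred1 q) w); apply: leq_trans le.
by rewrite leq_add2r ltnW.
Qed.

(** Only the left factors commute. Every term of the expanded power still carries a long word in
    them, whatever the order of the right factors. *)
Lemma tensor_nilpotent (F : fieldType) (R S : algType F) r
    (n : 'I_r -> R) (b : 'I_r -> S) :
  (forall p q, GRing.comm (n p) (n q)) -> (forall q, exists k, n q ^+ k = 0) ->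
  exists K, (\sum_q n q ⊗ b q) ^+ K = 0 :> tensor R S.
Proof.
move=> nC nil; have [K KP] := commuting_nilpotent_words nC nil; exists K.
suff : span (fun x => exists w : seq 'I_r, size w = K /\
    x = (\prod_(q <- w) n q) ⊗ (\prod_(q <- w) b q)) ((\sum_q n q ⊗ b q) ^+ K).
  elim=> [//|_ [w [sw ->]]|a x y _ -> _ ->]; last by rewrite scaler0 addr0.
  by rewrite KP ?sw // tens0l.
elim: K {KP} => [|K IHK].
  by apply: span_gen; exists [::]; rewrite expr0 !big_nil.
rewrite exprS mulr_suml; apply: lin_closed_sum (lin_closed_span _) _ => q _.
elim: IHK => [|_ [w [sw ->]]|a x y _ hx _ hy].
- by rewrite mulr0; exact: span0.
- by apply: span_gen; exists (q :: w); rewrite /= sw tensM !big_cons.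
- by rewrite mulrDr -scalerAr; exact: span_lin.
Qed.

(** * Powers of a unipotent element as a polynomial in the exponent *)

Section PolyPowers.
Variables (F : fieldType) (F_char0 : [pchar F] =i pred0) (R : algType F).

Lemma natrS_neq0 m : m.+1%:R != 0 :> F.
Proof. by rewrite ((pcharf0P F).1 F_char0). Qed.

Lemma poly_eq_nat (p q : {poly R}) :
  (forall m : nat, p.[m%:R] = q.[m%:R]) -> p = q.
Proof.
move=> pq; apply/polyP => j; pose K := maxn (maxn (size p) (size q)) j.+1.
have E (s : {poly R}) m : (size s <= K)%N ->
    s.[m%:R] = \sum_(j < K) (m%:R ^+ j : F) *: s`_j.
  move=> sK; rewrite (horner_coef_wide _ sK); apply: eq_bigr => i _.
  by rewrite -!natrX scaler_nat mulr_natr.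
apply: (poly_coef_unique F_char0 (a := fun j => p`_j) (b := fun j => q`_j) (K := K)).
  by move=> m; rewrite -!E ?leq_max ?leqnn ?orbT.
by rewrite leq_max leqnn orbT.
Qed.

Lemma binomial_poly k : exists b : {poly F}, forall m : nat, b.[m%:R] = 'C(m, k)%:R.
Proof.
have fact_neq0 : k`!%:R != 0 :> F by rewrite ((pcharf0P F).1 F_char0) -lt0n fact_gt0.
exists ((k`!%:R)^-1 *: \prod_(i < k) ('X - i%:R%:P)) => m.
rewrite hornerZ; apply: (mulfI fact_neq0).
rewrite mulrA mulfV // mul1r -natrM mulnC bin_ffact horner_prod.
elim: k {fact_neq0} => [|k IHk]; first by rewrite big_ord0 ffactn0.
rewrite big_ord_recr /= IHk ffactnSr natrM; rewrite !hornerE.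
have [km|mk] := leqP k m; first by rewrite natrB.
by rewrite ffact_small // mul0r mul0r.
Qed.

(** The binomial expansion stops before [N ^+ K], and each binomial coefficient is a polynomial in
    m. So [p] plays the role of exp(t log(1 + N)). *)
Lemma unipotent_power_poly (N : R) K : N ^+ K = 0 ->
  exists p : {poly R}, forall m : nat, p.[m%:R] = (1 + N) ^+ m.
Proof.
move=> NK; have [b bP] := choice binomial_poly.
exists (\sum_(k < K) map_poly (in_alg R) (b k) * (N ^+ k)%:P) => m.
rewrite horner_sum exprDn_comm; last exact: commr_sym (commr1 N).
have E (k : nat) : (map_poly (in_alg R) (b k) * (N ^+ k)%:P).[m%:R]
    = N ^+ k *+ 'C(m, k).
  rewrite hornerM_comm; last by rewrite /comm_poly hornerC; exact/commr_sym/commr_nat.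
  rewrite hornerC -(rmorph_nat (in_alg R)) horner_map /= bP.
  by rewrite -scalerAl mul1r scaler_nat.
under eq_bigr => k _ do rewrite E.
under [RHS]eq_bigr => k _ do rewrite expr1n mul1r.
have extend n (lo hi : nat) : (lo <= hi)%N ->
    (forall k, (lo <= k < hi)%N -> N ^+ k *+ 'C(n, k) = 0) ->
    \sum_(k < hi) N ^+ k *+ 'C(n, k) = \sum_(k < lo) N ^+ k *+ 'C(n, k).
  move=> le0 z; rewrite -!(big_mkord xpredT (fun k => N ^+ k *+ 'C(n, k))).
  rewrite (big_cat_nat (n := lo)) //= [X in _ + X](_ : _ = 0) ?addr0 //.
  by rewrite big_nat_cond big1 // => k; rewrite andbT => /z.
have [le1|/ltnW le1] := leqP K m.+1.
  symmetry; apply: extend => // k /andP[Kk _].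
  by rewrite -(subnK Kk) exprD NK mulr0 mul0rn.
by apply: extend => // k /andP[mk _]; rewrite bin_small.
Qed.

(** Comparing the terms of first order in m in p(m' + m) = p(m') p(m) yields the differential
    equation of the exponential. The linear coefficient thus serves as log u, without any power
    series. *)
Lemma one_parameter_coef (p : {poly R}) (u : R) :
  (forall m : nat, p.[m%:R] = u ^+ m) ->
  p`_0 = 1 /\ forall k, p`_k.+1 *+ k.+1 = p`_k * p`_1.
Proof.
move=> pu; have p0 : p`_0 = 1 by rewrite -horner_coef0 -[0]/(0%:R) pu.
split=> // k; pose K := maxn (size p) 2.
have Taylor (m' : nat) : p^`N(1).[m'%:R] = p.[m'%:R] * p`_1.
  have E (s : nat -> R) (m : nat) : (forall i, (size p <= i)%N -> s i = 0) ->
      \sum_(i < size p) s i * m%:R ^+ i = \sum_(j < K) (m%:R ^+ j : F) *: s j.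
    move=> s0.
    rewrite (eq_bigr (fun i : 'I_(size p) => (m%:R ^+ i : F) *: s i)); last first.
      by move=> i _; rewrite -!natrX mulr_natr scaler_nat.
    rewrite -!(big_mkord xpredT (fun i => (m%:R ^+ i : F) *: s i)).
    rewrite [RHS](big_cat_nat (n := size p)) ?leq_maxl //=.
    rewrite [X in _ = _ + X](_ : _ = 0) ?addr0 // big_nat_cond big1 // => i.
    by rewrite andbT => /andP[/s0 -> _]; rewrite scaler0.
  pose a i := p^`N(i).[m'%:R]; pose b i := p.[m'%:R] * p`_i.
  apply: (@poly_coef_unique F F_char0 R K a b) => [m|]; last by rewrite leq_max orbT.
  rewrite -!E; last 2 first.
  - by move=> i /(nth_default 0); rewrite /b => ->; rewrite mulr0.
  - by move=> i hi; rewrite /a nderivn_poly0 // horner0.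
  rewrite -nderiv_taylor; last exact: commr_nat.
  rewrite -natrD pu exprD -!pu [p.[m%:R]]horner_coef mulr_sumr.
  by apply: eq_bigr => i _; rewrite mulrA.
have /polyP/(_ k) : p^`N(1) = p * (p`_1)%:P; last first.
  by rewrite coef_nderivn coefMC add1n bin1.
apply: poly_eq_nat => m; rewrite Taylor hornerM_comm ?hornerC //.
by rewrite /comm_poly hornerC; exact/commr_sym/commr_nat.
Qed.
End PolyPowers.

(** * Pointed cocommutative Hopf algebras *)

Section Hit.
Variables (F : fieldType) (H : hopfAlg F).
Implicit Types f : {linear H -> F^o}.

(* the action of a functional f on H: h |-> f(h_(2)) h_(1)                    *)
Definition hit f : H -> H := slicer f \o comul H.
HB.instance Definition _ f := GRing.Linear.on (hit f).

Fact conv_bilinear f f' :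
  is_bilinear (fun a b : H => (f a : F) * f' b : F^o).
Proof.
split=> [b c x y|a c x y] /=; rewrite linearP.
  by rewrite mulrDl; congr (_ + _); exact/esym/mulrA.
by rewrite mulrDr; congr (_ + _); exact: mulrCA.
Qed.
Definition conv f f' : H -> F^o := tlin (conv_bilinear f f') \o comul H.
HB.instance Definition _ f f' := GRing.Linear.on (conv f f').

Fact assoc_bilinear (b : H) : is_bilinear (fun a1 a2 : H => a1 ⊗ (a2 ⊗ b)).
Proof.
split=> [a2 c x y|a1 c x y] /=; first by rewrite tensDl tensZl.
by rewrite tensDl tensZl tensDr tensZr.
Qed.
Fact assoc_comul_bilinear :
  is_bilinear (fun a b : H => tlift (fun a1 a2 => a1 ⊗ (a2 ⊗ b)) (comul H a)).
Proof.
split=> [b c x y|a c x y] /=.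
  by rewrite !(tliftE (assoc_bilinear _)) !linearP.
elim/tensor_ind: (comul H a) => [a1 a2|d t t' IH IH'].
  by rewrite !(tliftE (assoc_bilinear _)) !tlinE !(tensDr, tensZr).
rewrite !(tliftE (assoc_bilinear _)) in IH IH' *.
rewrite !tlin_linear IH IH' !scalerDr !scalerA [d * c]mulrC; exact: addrACA.
Qed.
Fact comulr_bilinear : is_bilinear (fun a b : H => a ⊗ comul H b).
Proof.
split=> [b c x y|a c x y] /=; first by rewrite tensDl tensZl.
by rewrite linearP tensDr tensZr.
Qed.

(** This is coassociativity contracted in two factors; it makes H a module over the convolution
    algebra of its linear forms. *)
Lemma hit_hit f f' h : hit f (hit f' h) = hit (conv f f') h.
Proof.
pose G : tensor H (tensor H H) -> H := slicer (tlin (conv_bilinear f f')).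
have /(congr1 G) := comulA h.
rewrite (tliftE assoc_comul_bilinear) (tliftE comulr_bilinear) => GE.
transitivity (G (tlin assoc_comul_bilinear (comul H h))); last first.
  rewrite GE /hit /=; move: (comul H h) => t.
  apply: (tensor_eq (f := slicer (tlin (conv_bilinear f f')) \o tlin comulr_bilinear)
    (g := slicer (conv f f'))) => a b /=.
  by rewrite tlinE !slicerE.
rewrite {2}/hit /=; move: (comul H h) => t.
apply: (tensor_eq (f := hit f \o slicer f')
  (g := slicer (tlin (conv_bilinear f f')) \o tlin assoc_comul_bilinear)) => a b /=.
rewrite slicerE linearZ /= tlinE /hit /= (tliftE (assoc_bilinear b)).
elim/tensor_ind: (comul H a) => [a1 a2|c x y IHx IHy].
  by rewrite tlinE !slicerE /= tlinE scalerA mulrC.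
by rewrite !linearP /= IHx IHy.
Qed.

Lemma eq_hit f f' : f =1 f' -> hit f =1 hit f'.
Proof.
move=> ff' h; rewrite /hit /=; move: (comul H h).
by apply: tensor_eq => a b /=; rewrite !slicerE ff'.
Qed.

Lemma hit_counit h : hit (counit H) h = h.
Proof.
rewrite -[RHS]counitr /hit /= [in RHS](tliftE (slicer_bilinear H (counit H))).
by [].
Qed.

Lemma counit_hit f h : counit H (hit f h) = f h.
Proof.
rewrite -[in RHS](counitl h) (tliftE (slicel_bilinear H (counit H))) /hit /=.
move: (comul H h).
apply: (tensor_eq (f := counit H \o slicer f)
   (g := f \o tlin (slicel_bilinear H (counit H)))) => a b /=.
by rewrite slicerE tlinE !linearZ /=; exact: mulrC.
Qed.

Lemma conv_hit f f' h : conv f f' h = f (hit f' h).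
Proof. by rewrite -(counit_hit f (hit f' h)) hit_hit counit_hit. Qed.

Hypothesis H_cocomm : cocommutative H.

Fact swap_bilinear : is_bilinear (fun a b : H => b ⊗ a).
Proof.
by split=> [b c x y|a c x y] /=; rewrite ?(tensDl, tensZl, tensDr, tensZr).
Qed.

Lemma comul_swap h r (u w : 'I_r -> H) :
  comul H h = \sum_i u i ⊗ w i -> comul H h = \sum_i w i ⊗ u i.
Proof.
move=> hE; rewrite -H_cocomm hE (tliftE swap_bilinear) raddf_sum /=.
by apply: eq_bigr => i _; rewrite tlinE.
Qed.

Lemma hitC f f' h : hit f (hit f' h) = hit f' (hit f h).
Proof.
rewrite !hit_hit; apply: eq_hit => {}h /=; rewrite /conv /=.
rewrite -[in RHS]H_cocomm (tliftE swap_bilinear); move: (comul H h).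
apply: (tensor_eq (f := tlin (conv_bilinear f f'))
  (g := tlin (conv_bilinear f' f) \o tlin swap_bilinear)) => a b /=.
by rewrite !tlinE mulrC.
Qed.

Lemma hit_sum f h r (u w : 'I_r -> H) : comul H h = \sum_i u i ⊗ w i ->
  hit f h = \sum_i (f (w i) : F) *: u i.
Proof. by move=> hE; rewrite /hit /= hE slicer_sum. Qed.

Lemma subcoalgebra_hit (E : H -> Prop) f x : subcoalgebra E -> E x -> E (hit f x).
Proof.
move=> [E0 El Ec] /Ec; rewrite /hit /=.
elim=> [|_ [a [b [Ea Eb ->]]]|c t t' _ Et _ Et']; first by rewrite raddf0.
  by rewrite slicerE; apply: lin_closedZ.
by rewrite linearP; apply: El.
Qed.

(** In a decomposition of [comul H x] with both families free, dual forms exhibit the left factors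
    as values of [hit]; cocommutativity does the same for the right factors. *)
Lemma hit_subcoalgebra (E : H -> Prop) : lin_closed E ->
  (forall f x, E x -> E (hit f x)) -> subcoalgebra E.
Proof.
move=> Elin Ehit; split; [exact: Elin.1|exact: Elin.2|] => x Ex.
have [r [u [w [xE /free_dual[f fu] /free_dual[f' fw]]]]] := tensor_sum_free (comul H x).
rewrite xE; apply: lin_closed_sum (lin_closed_span _) _ => i _.
apply: span_gen; exists (u i), (w i); split=> //.
  have := Ehit (f' i) x Ex; rewrite (hit_sum _ xE) (bigD1 i) //= fw eqxx scale1r.
  by rewrite big1 ?addr0 // => j ji; rewrite fw eq_sym (negPf ji) scale0r.
have := Ehit (f i) x Ex; rewrite (hit_sum _ (comul_swap xE)) (bigD1 i) //= fu eqxx.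
by rewrite scale1r big1 ?addr0 // => j ji; rewrite fu eq_sym (negPf ji) scale0r.
Qed.

Lemma grouplike1 : grouplike (1 : H).
Proof. by split; rewrite rmorph1. Qed.

Lemma grouplike_antipode (g : H) : grouplike g ->
  antipode H g * g = 1 /\ g * antipode H g = 1.
Proof.
have bl : is_bilinear (fun a b : H => antipode H a * b).
  split=> [b c x y|a c x y] /=; first by rewrite linearP mulrDl -scalerAl.
  by rewrite mulrDr -scalerAr.
have br : is_bilinear (fun a b : H => a * antipode H b).
  split=> [b c x y|a c x y] /=; first by rewrite mulrDl -scalerAl.
  by rewrite linearP mulrDr -scalerAr.
move=> [gg g1]; have := antipodel g; have := antipoder g.
by rewrite gg g1 scale1r (tlift_tens bl) (tlift_tens br) => -> ->.
Qed.

Lemma grouplike_inv (g : H) : grouplike g -> grouplike (antipode H g).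
Proof.
move=> gl; have [sg gs] := grouplike_antipode gl; move: (gl) => [gg g1].
split; last first.
  by rewrite -[counit H _]mulr1 -[X in _ * X]g1 -rmorphM sg rmorph1.
rewrite -[LHS]mulr1 -[X in _ * X](_ : (g ⊗ g) * (antipode H g ⊗ antipode H g) = 1).
  by rewrite mulrA -gg -rmorphM sg rmorph1 mul1r.
by rewrite tensM gs.
Qed.

Lemma comul_eq_square (d : H) c : d != 0 -> comul H d = c *: (d ⊗ d) ->
  grouplike (c *: d).
Proof.
move=> d0 dE; have c1 : c * counit H d = 1 :> F.
  have := counitl d; rewrite dE (tliftE (slicel_bilinear H (counit H))).
  rewrite linearZ /= tlinE scalerA => /eqP.
  rewrite -[X in _ == X]scale1r -subr_eq0 -scalerBl scaler_eq0 (negPf d0) orbF.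
  by rewrite subr_eq0 => /eqP.
split; first by rewrite linearZ /= dE tensZl tensZr.
by rewrite linearZ /= -c1.
Qed.
End Hit.

(** A basis of a finite-dimensional subcoalgebra, seen as a submodule for the action of linear forms
    so that matrix algebra applies. *)
Definition stable_family (F : fieldType) (H : hopfAlg F) r (a : 'I_r -> H) : Prop :=
  free_family a /\
  forall (f : {linear H -> F^o}) i, exists c : 'I_r -> F, hit f (a i) = \sum_j c j *: a j.

Section StableFamily.
Variables (F : fieldType) (H : hopfAlg F) (H_cocomm : cocommutative H).
Variables (r : nat) (a : 'I_r.+1 -> H) (a_stable : stable_family a).
Variables (phi : 'I_r.+1 -> {linear H -> F^o}).
Hypothesis phi_a : forall i j, phi i (a j) = (i == j)%:R.
Implicit Types (f : {linear H -> F^o}) (u : 'rV[F]_r.+1).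

Definition comb u : H := \sum_j u 0 j *: a j.
Fact comb_linear : linear comb.
Proof.
move=> c u v; rewrite /comb scaler_sumr -big_split; apply: eq_bigr => j _ /=.
by rewrite !mxE scalerDl scalerA.
Qed.
HB.instance Definition _ := GRing.isLinear.Build F _ _ *:%R comb comb_linear.

Lemma phi_sum (c : 'I_r.+1 -> F) j : phi j (\sum_i c i *: a i) = c j.
Proof.
rewrite raddf_sum (bigD1 j) //= linearZ /= phi_a eqxx big1 ?addr0.
  exact: mulr1.
by move=> i ij; rewrite linearZ /= phi_a eq_sym (negPf ij); exact: mulr0.
Qed.

Lemma comb_inj : injective comb.
Proof.
move=> u v uv; apply/rowP => j.
by rewrite -(phi_sum (u 0) j) -(phi_sum (v 0) j) -/(comb u) uv.
Qed.

Lemma comb_delta i : comb (delta_mx 0 i) = a i.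
Proof.
rewrite /comb (bigD1 i) //= mxE !eqxx scale1r big1 ?addr0 // => j ji.
by rewrite mxE eqxx /= (negPf ji) scale0r.
Qed.

Definition hit_mx f : 'M[F]_r.+1 := \matrix_(i, j) (phi j (hit f (a i)) : F).

Lemma hit_family f i : hit f (a i) = \sum_j hit_mx f i j *: a j.
Proof.
have [c cE] := a_stable.2 f i; rewrite [LHS]cE; apply: eq_bigr => j _.
by rewrite mxE cE phi_sum.
Qed.

Lemma hit_comb f u : hit f (comb u) = comb (u *m hit_mx f).
Proof.
rewrite /comb raddf_sum /=.
under eq_bigr => i _ do rewrite linearZ /= hit_family scaler_sumr.
rewrite exchange_big; apply: eq_bigr => j _ /=; rewrite mxE scaler_suml.
by apply: eq_bigr => i _; rewrite scalerA.
Qed.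

Lemma hit_mx_eq f (M : 'M[F]_r.+1) :
  (forall u, hit f (comb u) = comb (u *m M)) -> hit_mx f = M.
Proof.
move=> fM; apply/row_matrixP => i; rewrite !rowE; apply: comb_inj.
by rewrite -hit_comb fM.
Qed.

Lemma hit_mx_counit : hit_mx (counit H) = 1.
Proof. by apply: hit_mx_eq => u; rewrite hit_counit mulmx1. Qed.

Lemma hit_mxM f f' : hit_mx (conv f f') = hit_mx f' *m hit_mx f.
Proof. by apply: hit_mx_eq => u; rewrite -hit_hit !hit_comb mulmxA. Qed.

Lemma hit_mxC f f' : GRing.comm (hit_mx f) (hit_mx f').
Proof.
by apply/row_matrixP => i; rewrite !rowE !mulmxA; apply: comb_inj;
   rewrite -!hit_comb hitC.
Qed.

(** Both factors of the coproduct of an element of the family's span stay in that span, so [f] acts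
    only through its values on the family. *)
Lemma hit_dual f x : hit f (comb x) = \sum_q (f (a q) : F) *: hit (phi q) (comb x).
Proof.
have [n [u [w [xE _ /free_dual[g gw]]]]] := tensor_sum_free (comul H (comb x)).
rewrite (hit_sum _ (comul_swap H_cocomm xE)).
under [RHS]eq_bigr => q _.
  rewrite (hit_sum _ (comul_swap H_cocomm xE)) scaler_sumr.
  under eq_bigr => k _ do rewrite scalerA.
  over.
rewrite exchange_big; apply: eq_bigr => k _; rewrite -scaler_suml; congr (_ *: _).
suff [v ->] : exists v, u k = comb v.
  rewrite {1}/comb raddf_sum; apply: eq_bigr => q _ /=.
  by rewrite linearZ /= phi_sum; exact: mulrC.
exists (x *m hit_mx (g k)); rewrite -hit_comb (hit_sum _ xE) (bigD1 k) //= gw eqxx.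
by rewrite scale1r big1 ?addr0 // => j jk; rewrite gw eq_sym (negPf jk) scale0r.
Qed.

Lemma hit_mx_dual f : hit_mx f = \sum_q (f (a q) : F) *: hit_mx (phi q).
Proof.
apply: hit_mx_eq => u; rewrite hit_dual mulmx_sumr raddf_sum /=.
by apply: eq_bigr => q _; rewrite -scalemxAr linearZ /= hit_comb.
Qed.

(* the matrix whose row space is the cyclic submodule generated by e          *)
Definition orbit_mx u : 'M[F]_r.+1 := \matrix_q (u *m hit_mx (phi q)).

Lemma orbit_hit u f : (u *m hit_mx f <= orbit_mx u)%MS.
Proof.
rewrite hit_mx_dual mulmx_sumr summx_sub // => q _; rewrite -scalemxAr scalemx_sub //.
by rewrite (_ : u *m _ = row q (orbit_mx u)) ?row_sub // rowK.
Qed.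

Lemma orbit_stable u (v : 'rV[F]_r.+1) f : (v <= orbit_mx u)%MS -> (v *m hit_mx f <= orbit_mx u)%MS.
Proof.
move=> vu; apply: submx_trans (submxMr _ vu) _; apply/row_subP => q.
by rewrite row_mul rowK -mulmxA -hit_mxM orbit_hit.
Qed.

Lemma orbit_refl u : (u <= orbit_mx u)%MS.
Proof. by have := orbit_hit u (counit H); rewrite hit_mx_counit mulmx1. Qed.

Lemma orbit_sub u (v : 'rV[F]_r.+1) : (v <= orbit_mx u)%MS -> (orbit_mx v <= orbit_mx u)%MS.
Proof. by move=> vu; apply/row_subP => q; rewrite rowK orbit_stable. Qed.

(** A nonzero cyclic submodule of least rank is a simple subcoalgebra. Pointedness makes it a line,
    and a multiple of its generator is then group-like. *)
Lemma family_grouplike : pointed H -> exists g u, grouplike g /\ g = comb u.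
Proof.
move=> H_pointed.
pose P k := `[< exists2 u, u != 0 & \rank (orbit_mx u) = k >].
have exP : exists k, P k.
  exists (\rank (orbit_mx (delta_mx 0 0))); apply/asboolP; eexists; last by [].
  by apply/eqP => /rowP/(_ 0)/eqP; rewrite !mxE oner_eq0.
case: (ex_minnP exP) => k /asboolP[u u0 uk] kmin.
pose E x := exists2 v : 'rV[F]_r.+1, (v <= orbit_mx u)%MS & x = comb v.
have Elin : lin_closed E.
  split; first by exists 0; rewrite ?sub0mx ?raddf0.
  move=> c _ _ [v vu ->] [v' v'u ->]; exists (c *: v + v'); last by rewrite linearP.
  by rewrite addmx_sub // scalemx_sub.
have Ecoalg : subcoalgebra E.
  apply: hit_subcoalgebra => // f _ [v vu ->].
  by exists (v *m hit_mx f); [exact: orbit_stable | exact: hit_comb].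
have Eu : E (comb u) by exists u => //; exact: orbit_refl.
have [|d d0 Ed] := H_pointed E.
  split=> //.
    exists (comb u) => //; apply: contra_neq u0 => u0; apply: comb_inj.
    by rewrite u0 raddf0.
  move=> E' E'coalg E'E; have [E'0|/existsNP[x /not_implyP[E'x /eqP x0]]] :=
    EM (forall x, E' x -> x = 0); [by left | right=> _ [v vu ->]].
  have [v' v'u xE] := E'E x E'x; rewrite xE in x0 E'x.
  have vv' : (v <= orbit_mx v')%MS.
    suff : (orbit_mx u <= orbit_mx v')%MS by exact: submx_trans.
    rewrite -(geq_leqif (mxrank_leqif_sup (orbit_sub v'u))) uk.
    apply: kmin; apply/asboolP; exists v' => //.
    by apply: contra_neq x0 => ->; rewrite raddf0.
  have E'lin : lin_closed E' by case: E'coalg.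
  rewrite -(mulmxKpV vv') mulmx_sum_row raddf_sum /=.
  apply: lin_closed_sum => // q _; rewrite linearZ; apply: lin_closedZ => //=.
  by rewrite rowK -hit_comb; exact: subcoalgebra_hit.
have /Ed := Eu => -[c0 uE].
have Edd : E d by apply/Ed; exists 1; rewrite scale1r.
have [c dE] : exists c, comul H d = c *: (d ⊗ d).
  have [_ _ /(_ d Edd)] := Ecoalg.
  elim=> [|_ [x [y [/Ed[b ->] /Ed[b' ->] ->]]]|b x y _ [c ->] _ [c' ->]].
  - by exists 0; rewrite scale0r.
  - by exists (b * b'); rewrite tensZl tensZr scalerA.
  - by exists (b * c + c'); rewrite scalerDl scalerA.
have [v _ dv] := Edd; exists (c *: d), (c *: v); split; first exact: comul_eq_square.
by rewrite dv linearZ.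
Qed.
End StableFamily.

Section Generation.
Variables (F : fieldType) (F_char0 : [pchar F] =i pred0).
Variables (H : hopfAlg F) (H_cocomm : cocommutative H) (H_pointed : pointed H).
Variable B : H -> Prop.
Hypothesis B_lin : lin_closed B.
Hypothesis B_mul : forall x y, B x -> B y -> B (x * y).
Hypothesis B_grouplike : forall g, grouplike g -> B g.
Hypothesis B_primitive : forall x, primitive x -> B x.

Section Family.
Variables (r : nat) (a : 'I_r.+1 -> H) (a_stable : stable_family a).
Variables (phi : 'I_r.+1 -> {linear H -> F^o}).
Hypothesis phi_a : forall i j, phi i (a j) = (i == j)%:R.
Hypothesis IH : forall k (b : 'I_k -> H),
  (k < r.+1)%N -> stable_family b -> forall i, B (b i).

Local Notation M := (hit_mx a phi).

Lemma substable_generated (K : 'M[F]_r.+1) : (forall f, stablemx K (M f)) ->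
  (\rank K < r.+1)%N -> forall u : 'rV[F]_r.+1, (u <= K)%MS -> B (comb a u).
Proof.
move=> Kst Kr; pose R := row_base K.
have E (v : 'rV[F]_(\rank K)) :
    comb a (v *m R) = \sum_i v 0 i *: comb a (row i R).
  by rewrite mulmx_sum_row raddf_sum /=; apply: eq_bigr => i _; rewrite linearZ.
have Bb : forall i, B (comb a (row i R)).
  apply: IH Kr _; split=> [c|f i].
    have := E (\row_i c i); under eq_bigr do rewrite mxE.
    move=> <- /(_ =P 0); rewrite -(raddf0 (comb a)) => /eqP/(comb_inj phi_a).
    move/eqP; rewrite mulmx_free_eq0 ?row_base_free // => /eqP/rowP c0 i.
    by have := c0 i; rewrite !mxE.
  have /submxP[v vE] : (row i R *m M f <= R)%MS.
    rewrite eq_row_base (submx_trans _ (Kst f)) // submxMr // -(eq_row_base K).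
    exact: row_sub.
  by exists (v 0); rewrite (hit_comb a_stable phi_a) vE E.
move=> u; rewrite -(eq_row_base K) => /submxP[v ->]; rewrite E.
by apply: lin_closed_sum => // i _; apply: lin_closedZ.
Qed.

(** Fitting decomposition. Write the characteristic polynomial as q X^k with q(0) nonzero. Since [u]
    is killed by the matrix, q of the matrix scales [u] by q(0) and is nonzero, so the kernel of q
    is proper. If the k-th power is nonzero too, both kernels are proper stable subspaces; together
    they span everything, and the induction hypothesis covers each. *)
Lemma hit_mx_nilpotent g u (f : {linear H -> F^o}) : 
  grouplike g -> g = comb a u -> f g = 0 ->
  (exists k, M f ^+ k = 0) \/ forall i, B (a i).
Proof.
move=> [gg g1] gu fg; have u0 : u != 0.
  apply/eqP => u0; move: g1; rewrite gu u0 !raddf0 => /eqP.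
  by rewrite eq_sym oner_eq0.
have uM : u *m M f = 0.
  apply: (comb_inj phi_a); rewrite -(hit_comb a_stable phi_a) -gu raddf0.
  by rewrite /hit /= gg slicerE fg scale0r.
have [k [q q0 pE]] := multiplicity_XsubC (char_poly (M f)) 0.
rewrite (monic_neq0 (char_poly_monic _)) /= in q0.
rewrite subr0 in pE.
have [Mk0|Mk0] := eqVneq (M f ^+ k) 0; first by left; exists k.
right => i.
have qM : horner_mx (M f) q != 0.
  apply: contra_neq u0 => qM0.
  have : u *m horner_mx (M f) q = q.[0] *: u.
    elim/poly_ind: q {pE q0 qM0} => [|q c IHq].
      by rewrite horner0 raddf0 mulmx0 scale0r.
    rewrite !hornerE rmorphD rmorphM /= horner_mx_X horner_mx_C mulmxDr.
    have -> : horner_mx (M f) q * M f = M f * horner_mx (M f) q.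
      exact: (comm_horner_mx q (erefl (M f *m M f))).
    by rewrite mulmxA uM mul0mx add0r ?mulr0 ?add0r mul_mx_scalar.
  rewrite qM0 mulmx0 => /esym/eqP; rewrite scaler_eq0 => /orP[|/eqP//].
  by rewrite -/(root q 0) (negPf q0).
have stab p f' : stablemx (kermxpoly (M f) p) (M f').
  by apply: comm_mx_stable_kermxpoly; exact: (hit_mxC H_cocomm a_stable phi_a).
have small p : horner_mx (M f) p != 0 -> (\rank (kermxpoly (M f) p) < r.+1)%N.
  by move=> pM; rewrite mxrank_ker ltn_subrL lt0n mxrank_eq0 pM.
have : ((delta_mx 0 i : 'rV[F]_r.+1) <= kermxpoly (M f) q + kermxpoly (M f) 'X^k)%MS.
  have co : coprimep q 'X^k by rewrite coprimep_expr // coprimepX.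
  have : ((delta_mx 0 i : 'rV[F]_r.+1) <= kermxpoly (M f) (q * 'X^k))%MS.
    by rewrite -pE /kermxpoly Cayley_Hamilton kermx0 submx1.
  by rewrite kermxpolyM.
move=> /sub_addsmxP[[v w] /= vw]; rewrite -(comb_delta a) vw raddfD /=.
apply: lin_closedD => //.
  by apply: (substable_generated (stab q)); [exact: small | exact: submxMl].
apply: (substable_generated (stab 'X^k)); last exact: submxMl.
by apply: small; rewrite rmorphXn /= horner_mx_X.
Qed.

Section Unipotent.
Variables (g : H) (ug : 'rV[F]_r.+1).
Hypotheses (g_grouplike : grouplike g) (gE : g = comb a ug).
Hypothesis g_nil : forall f : {linear H -> F^o}, f g = 0 -> exists k, M f ^+ k = 0.

Let R : algType F := 'M[F]_r.+1.
(** Below, [u] is the coaction matrix of the family divided by g, so that g is moved to 1 and [u]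
    becomes 1 plus the nilpotent [N]. *)
Let b (q : 'I_r.+1) : H := a q * antipode H g.
Let u : tensor R H := \sum_q (M (phi q) : R) ⊗ b q.
Let N : tensor R H := \sum_q (M (phi q) - (phi q g : F) *: 1 : R) ⊗ b q.

Let uN : u = 1 + N.
Proof.
rewrite /N; under eq_bigr do rewrite tensBl.
rewrite sumrB addrCA -[LHS]addr0; congr (_ + _); apply/esym/eqP.
rewrite subr_eq0; apply/eqP.
under eq_bigr do rewrite tensZl -tensZr.
rewrite -tens_sumr -[LHS]/(1 ⊗ 1); congr (_ ⊗ _).
have [_ gSg] := grouplike_antipode g_grouplike.
rewrite -[LHS]gSg {1}gE /comb mulr_suml.
by apply: eq_bigr => q _; rewrite [in RHS]gE (phi_sum phi_a) -scalerAl.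
Qed.

Let N_nilpotent : exists K, N ^+ K = 0.
Proof.
pose f q x : F^o := phi q x - phi q g * counit H x.
have f_lin q : linear (f q).
  move=> c x y; rewrite /f !linearP /= mulrDr opprD addrACA scalerBr.
  by congr (_ - _ + _); exact: mulrCA.
pose f' q : {linear H -> F^o} :=
  HB.pack (f q) (GRing.isLinear.Build _ _ _ _ (f q) (f_lin q)).
have fM q : M (f' q) = M (phi q) - (phi q g : F) *: 1.
  apply: (hit_mx_eq a_stable phi_a) => v; rewrite mulmxBr -scalemxAr mulmx1.
  rewrite (raddfB (comb a)) /= linearZ /= -(hit_comb a_stable phi_a).
  rewrite -[in X in _ *: X](hit_counit (comb a v)).
  have [n [x [w xE]]] := tensor_sum (comul H (comb a v)).
  rewrite !(hit_sum _ xE) scaler_sumr -sumrB; apply: eq_bigr => i _.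
  by rewrite -[f' q _]/(f q _) /f scalerA scalerBl.
apply: tensor_nilpotent => [p q|q]; rewrite -!fM.
  exact: (hit_mxC H_cocomm a_stable phi_a).
by apply: g_nil; rewrite /= /f g_grouplike.2 mulr1 subrr.
Qed.

Let D := tmap (@idfun R) (comul H).
Let i1 := tmap (@idfun R) (@tensl F H H).
Let i2 := tmap (@idfun R) (@tensr F H H).

(** A coaction matrix behaves like a group-like element over the matrix ring, because products of
    the matrices [hit_mx] correspond to convolution. The two copies commute since these matrices
    do. *)
Let u_multiplicative : D u = i1 u * i2 u /\ GRing.comm (i1 u) (i2 u).
Proof.
have i1u : i1 u = \sum_q (M (phi q) : R) ⊗ (b q ⊗ 1).
  by rewrite /i1 raddf_sum /=; apply: eq_bigr => q _; rewrite tmapE.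
have i2u : i2 u = \sum_q (M (phi q) : R) ⊗ (1 ⊗ b q).
  by rewrite /i2 raddf_sum /=; apply: eq_bigr => q _; rewrite tmapE.
split; last first.
  rewrite /GRing.comm i1u i2u mulr_suml [RHS]mulr_sumr; apply: eq_bigr => p _.
  rewrite mulr_sumr mulr_suml; apply: eq_bigr => q _; rewrite !tensM !mulr1 !mul1r.
  by rewrite (hit_mxC H_cocomm a_stable phi_a).
have gl := (grouplike_inv g_grouplike).1.
have Da q : comul H (a q) = \sum_p \sum_s M (phi p) q s *: (a s ⊗ a p).
  have [n [x [y [xE /free_dual[h hx] _]]]] := tensor_sum_free (comul H (a q)).
  have y_in k : y k = \sum_s (phi s (y k) : F) *: a s.
    have := a_stable.2 (h k) q; rewrite (hit_sum _ (comul_swap H_cocomm xE)).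
    rewrite (bigD1 k) //= hx eqxx scale1r big1 ?addr0 => [[c cE]|j jk]; last first.
      by rewrite hx eq_sym (negPf jk) scale0r.
    by rewrite {1}cE; apply: eq_bigr => s _; rewrite cE (phi_sum phi_a).
  rewrite xE; under eq_bigr => k _ do rewrite y_in tens_sumr.
  rewrite exchange_big; apply: eq_bigr => p _ /=.
  under [RHS]eq_bigr do rewrite -tensZl.
  rewrite -tens_suml -(hit_family a_stable phi_a) (hit_sum _ xE) tens_suml.
  by apply: eq_bigr => k _; rewrite tensZr tensZl.
rewrite i1u i2u mulr_suml.
under [RHS]eq_bigr => s _.
  rewrite mulr_sumr.
  under eq_bigr => p _ do rewrite !tensM mulr1 mul1r.
  over.
rewrite /D raddf_sum /=.
under eq_bigr => q _.
  rewrite tmapE /b rmorphM /= Da gl mulr_suml tens_sumr.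
  under eq_bigr => p _.
    rewrite mulr_suml tens_sumr.
    under eq_bigr => s _ do rewrite -scalerAl tensM tensZr -tensZl.
    over.
  over.
rewrite [RHS]exchange_big [LHS]exchange_big /=; apply: eq_bigr => p _.
rewrite [LHS]exchange_big /=.
apply: eq_bigr => s _; rewrite -tens_suml; congr (_ ⊗ _).
have <- : M (conv (phi s) (phi p)) = M (phi s) * M (phi p).
  rewrite (hit_mxM a_stable phi_a); exact: (hit_mxC H_cocomm a_stable phi_a).
rewrite [RHS](hit_mx_dual H_cocomm a_stable phi_a); apply: eq_bigr => q _.
by congr (_ *: _); rewrite /= conv_hit mxE.
Qed.

Let BM (x : tensor R H) : Prop :=
  span (fun x => exists2 h, B h & exists m, x = m ⊗ h) x.

Let BM_lin : lin_closed BM. Proof. exact: lin_closed_span. Qed.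

Let BM_mul x y : BM x -> BM y -> BM (x * y).
Proof.
elim=> [|_ [h Bh [m ->]]|c {}x z _ IHx _ IHz] By.
- by rewrite mul0r; exact: BM_lin.1.
- elim: By => [|_ [k Bk [l ->]]|c {}y z _ IHy _ IHz].
  + by rewrite mulr0; exact: BM_lin.1.
  + by apply: span_gen; exists (h * k); [exact: B_mul | exists (m * l); rewrite tensM].
  + by rewrite mulrDr -scalerAr; apply: BM_lin.2.
- by rewrite mulrDl -scalerAl; apply: BM_lin.2; [exact: IHx | exact: IHz].
Qed.

(** The powers of [u] form a polynomial whose linear coefficient is log u. Multiplicativity of [u]
    makes that coefficient primitive in the H factor, and the other coefficients are its divided
    powers. Hence [u], the value at 1, has entries in [B], and slicing it gives each [a i] divided
    by g. *)
Lemma unipotent_generated i : B (a i).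
Proof.
have [K NK] := N_nilpotent.
have [P Pu] := unipotent_power_poly F_char0 NK; rewrite -uN in Pu.
have [P0 P1] := one_parameter_coef F_char0 Pu.
have [Du uC] := u_multiplicative.
have natr (f : {lrmorphism tensor R H -> tensor R (tensor H H)}) m :
    (map_poly f P).[m%:R] = f u ^+ m.
  by rewrite -(rmorph_nat f) horner_map Pu rmorphXn.
have DP : map_poly D P = map_poly i1 P * map_poly i2 P.
  apply: (poly_eq_nat F_char0) => m; rewrite hornerM_comm; last first.
    exact/commr_sym/commr_nat.
  by rewrite !natr /= -/D -/i1 -/i2 Du exprMn_comm.
have prim : D P`_1 = i1 P`_1 + i2 P`_1.
  have /polyP/(_ 1) := DP; rewrite coef_map coefM !big_ord_recl big_ord0 /=.
  by rewrite !coef_map /= P0 !rmorph1 mul1r mulr1 addr0 addrC.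
have BP1 : BM P`_1.
  have [n [m [x [PE /free_dual[h hm] _]]]] := tensor_sum_free (P`_1 : tensor R H).
  rewrite PE; apply: lin_closed_sum => // k _; apply: span_gen.
  exists (x k); last by exists (m k).
  apply: B_primitive; move: prim; rewrite PE /D /i1 /i2 !raddf_sum /= -big_split /=.
  under eq_bigr do rewrite tmapE.
  under [RHS]eq_bigr do rewrite !tmapE /= /tensl /tensr -tensDr.
  move/(congr1 (slicel (h k))); rewrite !slicel_sum.
  rewrite (bigD1 k) //= hm eqxx scale1r big1 ?addr0; last first.
    by move=> j jk; rewrite hm eq_sym (negPf jk) scale0r.
  rewrite (bigD1 k) //= hm eqxx scale1r big1 ?addr0 //.
  by move=> j jk; rewrite hm eq_sym (negPf jk) scale0r.
have BP k : BM P`_k.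
  elim: k => [|k IHk].
    rewrite P0; apply: span_gen; exists 1; last by exists 1.
    exact/B_grouplike/grouplike1.
  have -> : P`_k.+1 = k.+1%:R^-1 *: (P`_k * P`_1).
    by rewrite -P1 -scaler_nat scalerA mulVf ?scale1r ?natrS_neq0.
  by apply: lin_closedZ => //; apply: BM_mul.
have Bu : BM u.
  rewrite -[u]expr1 -Pu horner_coef; apply: lin_closed_sum => // k _.
  by rewrite expr1n mulr1.
(* Pairing row i with the counit is dual to the matrices of the forms [phi q], so this slice of [u]
   is exactly [b i]. *)
pose lam (m : R) : F^o := \sum_j m i j * counit H (a j).
have lam_lin : linear lam.
  move=> c x y; rewrite /lam scaler_sumr -big_split; apply: eq_bigr => j _ /=.
  by rewrite !mxE mulrDl; congr (_ + _); exact/esym/mulrA.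
pose lam' : {linear R -> F^o} :=
  HB.pack lam (GRing.isLinear.Build _ _ _ _ lam lam_lin).
have lamM q : lam (M (phi q)) = (q == i)%:R.
  rewrite -phi_a -[RHS]counit_hit (hit_family a_stable phi_a) raddf_sum /=.
  by apply: eq_bigr => j _; rewrite linearZ.
have bE : slicel lam' u = b i.
  rewrite slicel_sum (bigD1 i) //= lamM eqxx scale1r big1 ?addr0 // => q qi.
  by rewrite /= lamM (negPf qi) scale0r.
have [Sg _] := grouplike_antipode g_grouplike.
rewrite -[a i]mulr1 -Sg mulrA; apply: B_mul; last exact: B_grouplike.
rewrite -/(b i) -bE; elim: Bu => [|_ [h Bh [m ->]]|c x y _ Bx _ By].
- by rewrite raddf0; exact: B_lin.1.
- by rewrite slicelE; exact: lin_closedZ.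
- by rewrite linearP; apply: B_lin.2.
Qed.
End Unipotent.
End Family.

Lemma stable_family_generated r (a : 'I_r -> H) : stable_family a -> forall i, B (a i).
Proof.
have [n] := ubnP r; elim: n => // n IHn in r a *.
case: r a => [|r] a rn a_stable; first by case.
have [phi phi_a] := free_dual a_stable.1.
have IH k (b : 'I_k -> H) : (k < r.+1)%N -> stable_family b -> forall i, B (b i).
  by move=> kr; apply: IHn; exact: leq_trans kr rn.
have [g [u [gl gE]]] := family_grouplike H_cocomm a_stable phi_a H_pointed.
have [//|nB] := EM (forall i, B (a i)).
apply: (unipotent_generated a_stable phi_a gl gE) => f fg.
by have [|/nB] := hit_mx_nilpotent a_stable phi_a IH gl gE fg.
Qed.

(** The left factors of a free decomposition of [comul H h] form a stable family, and the counit
    recovers [h] from them. *)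
Theorem pointed_cocommutative_generated h : B h.
Proof.
have [r [u [w [hE ufree /free_dual[f fw]]]]] := tensor_sum_free (comul H h).
have uE i : u i = hit (f i) h.
  rewrite (hit_sum _ hE) (bigD1 i) //= fw eqxx scale1r big1 ?addr0 // => j ji.
  by rewrite fw eq_sym (negPf ji) scale0r.
have Bu : forall i, B (u i).
  apply: stable_family_generated; split=> // f' i.
  by exists (fun j => conv f' (f i) (w j)); rewrite uE hit_hit (hit_sum _ hE).
rewrite -(hit_counit h) (hit_sum _ hE); apply: lin_closed_sum => // i _.
exact: lin_closedZ.
Qed.
End Generation.

Lemma quotient_lift (F : fieldType) (R Q B : algType F) (q : {lrmorphism R -> Q})
    (N : R -> Prop) (f : {lrmorphism R -> B}) :
  is_quotient q N -> (forall x, N x -> f x = 0) ->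
  exists g : {lrmorphism Q -> B}, forall x, g (q x) = f x.
Proof.
move=> [q_surj q0] fN; pose s y := projT1 (cid (q_surj y)).
have sK y : q (s y) = y by rewrite /s; case: cid.
have fq x y : q x = q y -> f x = f y.
  move/eqP; rewrite -subr_eq0 -raddfB => /eqP/q0/fN/eqP.
  by rewrite raddfB subr_eq0 => /eqP.
have fs x : f (s (q x)) = f x by apply: fq; rewrite sK.
pose g y := f (s y).
have g_lin : linear g.
  by move=> a x y; rewrite /g -linearP; apply: fq; rewrite sK linearP /= !sK.
have g_mon : monoid_morphism g.
  split; first by rewrite /g -(rmorph1 q) fs rmorph1.
  by move=> x y; rewrite /g -rmorphM; apply: fq; rewrite sK rmorphM /= !sK.
pose g' : {lrmorphism Q -> B} := HB.pack g
  (GRing.isLinear.Build _ _ _ _ g g_lin) (GRing.isMonoidMorphism.Build _ _ g g_mon).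
by exists g'; exact: fs.
Qed.

Lemma free_alg_ind (F : fieldType) (X : choiceType) (P : free_alg F X -> Prop) :
  lin_closed P -> P 1 -> (forall x p, P p -> P (free_var F x * p)) -> forall p, P p.
Proof.
move=> Plin P1 PM p; elim/free_ind: p => [w|a x y Px Py]; last exact: Plin.2.
by elim: w => [|x w IHw]; rewrite ?big_nil ?big_cons //; exact: PM.
Qed.

(** * Universal properties *)

Section TensorAlgebraTheory.
Variables (F : fieldType) (V : lmodType F).

Fact talg_in_linear : linear (@talg_in F V).
Proof.
move=> a u v; apply/eqP; rewrite -subr_eq0 /talg_in -linearP -raddfB; apply/eqP.
by apply/((qprojP (@talg_proper F V)).2 _).2/ideal_gen.
Qed.
HB.instance Definition _ :=
  GRing.isLinear.Build F V (talg V) *:%R (@talg_in F V) talg_in_linear.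

Lemma talg_univ (B : algType F) (f : {linear V -> B}) :
  exists g : {lrmorphism talg V -> B}, forall v, g (talg_in v) = f v.
Proof.
have [|g gP] := @quotient_lift F _ (talg V) B (qproj (@talg_proper F V)) _
    (free_eval f) (qprojP (@talg_proper F V)).
  apply: ideal_ker => _ [a u v].
  by rewrite raddfB /= linearP /= !free_eval_var linearP subrr.
by exists g => v; rewrite /talg_in gP /= free_eval_var.
Qed.

Lemma talg_ind (P : talg V -> Prop) : lin_closed P -> P 1 ->
  (forall v p, P p -> P (talg_in v * p)) -> forall p, P p.
Proof.
move=> Plin P1 PM p; have [x <-] := (qprojP (@talg_proper F V)).1 p.
elim/free_alg_ind: x => [||v x].
- exact: (lin_closed_preim (qproj (@talg_proper F V)) Plin).
- by rewrite rmorph1.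
- by rewrite rmorphM; exact: PM.
Qed.
End TensorAlgebraTheory.

(** * The Clifford algebra and its parity automorphism *)

Section CliffordTheory.
Variables (F : fieldType) (V : vectType F) (form : {symmetric V}).
Variables (C : algType F) (qC : {lrmorphism talg V -> C}).
Hypothesis C_cliff : is_clifford form qC.

Local Notation cV := (cliffV qC).
HB.instance Definition _ := GRing.Linear.copy (cliffV qC) (qC \o @talg_in F V).

Lemma cliffM v w : cV v * cV w + cV w * cV v = (2%:R * form v w) *: 1.
Proof.
apply/eqP; rewrite -subr_eq0 /cliffV -!rmorphM -raddfD /= -(rmorph1 qC) -linearZ.
rewrite -raddfB; apply/eqP/(C_cliff.2 _).2/ideal_gen.
by exists v, w; rewrite /talg_in !rmorphM.
Qed.

Lemma clifford_ind (P : C -> Prop) : lin_closed P -> P 1 ->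
  (forall v c, P c -> P (cV v * c)) -> forall c, P c.
Proof.
move=> Plin P1 PM c; have [x <-] := C_cliff.1 c.
elim/talg_ind: x => [||v x]; first exact: (lin_closed_preim (qC) Plin).
  by rewrite rmorph1.
by rewrite rmorphM; exact: PM.
Qed.

Lemma clifford_univ (B : algType F) (f : {linear V -> B}) :
  (forall v w, f v * f w + f w * f v = (2%:R * form v w) *: 1) ->
  exists g : {lrmorphism C -> B}, forall v, g (cV v) = f v.
Proof.
move=> fM; have [h hP] := talg_univ f.
have [|g gP] := quotient_lift (f := h) C_cliff.
  apply: ideal_ker => _ [v [w ->]].
  by rewrite raddfB raddfD /= !rmorphM linearZ /= rmorph1 !hP fM subrr.
by exists g => v; rewrite gP hP.
Qed.

Fact parity_exists :
  exists alpha : {lrmorphism C -> C}, forall v, alpha (cV v) = - cV v.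
Proof.
have f_lin : linear (fun v => - cV v) by move=> a u v; rewrite linearP opprD scalerN.
pose f : {linear V -> C} := HB.pack (fun v => - cV v)
  (GRing.isLinear.Build _ _ _ _ _ f_lin).
by have [|g gP] := clifford_univ (f := f); [move=> v w; rewrite !mulrNN cliffM | exists g].
Qed.

Definition cliff_involution : {lrmorphism C -> C} := projT1 (cid parity_exists).
Local Notation alpha := cliff_involution.

Lemma involutionV v : alpha (cV v) = - cV v.
Proof. by rewrite /cliff_involution; case: cid. Qed.

Lemma involutionK c : alpha (alpha c) = c.
Proof.
elim/clifford_ind: c => [||v c IHc].
- exact: (lin_closed_eq (alpha \o alpha) idfun).
- by rewrite !rmorph1.
- rewrite rmorphM /= involutionV mulNr raddfN /= rmorphM /= involutionV.
  by rewrite mulNr opprK IHc.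
Qed.

Lemma cliff_parity_involution b c : cliff_parity qC b c -> alpha c = (-1) ^+ b *: c.
Proof.
elim=> [|_ [vs [<- ->]]|a {}x y _ IHx _ IHy]; first by rewrite raddf0 scaler0.
  elim: vs => [|v vs IHvs]; first by rewrite big_nil rmorph1 scale1r.
  rewrite big_cons rmorphM /= involutionV IHvs.
  by case: (odd _); rewrite ?expr1 ?expr0 ?scale1r ?scaleN1r ?mulrNN ?mulNr.
by rewrite linearP /= IHx IHy scalerDr !scalerA mulrC.
Qed.
End CliffordTheory.

(* The relations h v = (h_(1) v) h_(2), stated on generators of H only.         *)
Definition smash_compat (F : fieldType) (H : hopfAlg F) (V : lmodType F)
    (act : H -> V -> V) (B : algType F) (jV : V -> B) (jH : H -> B) : Prop :=
  (forall g v, grouplike g -> jH g * jV v = jV (act g v) * jH g) /\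
  (forall x v, primitive x -> jH x * jV v = jV (act x v) + jV v * jH x).

(** * Smash products presented through group-like and primitive elements *)

Section SmashTheory.
Variables (F : fieldType) (F_char0 : [pchar F] =i pred0).
Variables (H : hopfAlg F) (H_cocomm : cocommutative H) (H_pointed : pointed H).
Variables (V : lmodType F) (act : H -> V -> V) (act_module : is_module act).

Lemma hopf_ind (P : H -> Prop) : lin_closed P ->
  (forall x y, P x -> P y -> P (x * y)) ->
  (forall g, grouplike g -> P g) -> (forall x, primitive x -> P x) -> forall h, P h.
Proof. by move=> *; exact: (pointed_cocommutative_generated F_char0 H_cocomm H_pointed). Qed.

Fact act_linearr h : linear (act h).
Proof. exact: (act_bilinear act_module).2. Qed.
Definition act_lin h : {linear V -> V} :=
  HB.pack (act h) (GRing.isLinear.Build _ _ _ _ (act h) (act_linearr h)).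
Fact act_linearl v : linear (act^~ v).
Proof. exact: (act_bilinear act_module).1. Qed.

(** The commutation rule for [x] and [y] implies it for [x * y], because [comul] is multiplicative;
    so generators suffice. *)
Lemma smash_compat_comul (B : algType F) (jV : {linear V -> B}) (jH : {lrmorphism H -> B}) :
  smash_compat act jV jH -> forall h v (s : seq (H * H)),
  comul H h = \sum_(p <- s) p.1 ⊗ p.2 ->
  jH h * jV v = \sum_(p <- s) jV (act p.1 v) * jH p.2.
Proof.
move=> [relg relx].
have m_bil v : is_bilinear (fun a b : H => jV (act a v) * jH b).
  split=> [b c x y|a c x y] /=; rewrite ?act_linearl linearP ?mulrDl ?mulrDr.
    by rewrite scalerAl.
  by rewrite scalerAr.
suff rel : forall h v, jH h * jV v = tlin (m_bil v) (comul H h).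
  move=> h v s hE; rewrite rel hE raddf_sum /=.
  by apply: eq_bigr => p _; rewrite tlinE.
have mulP t (a b : H) v :
    tlin (m_bil (act a v)) t * jH b = tlin (m_bil v) (t * (a ⊗ b)).
  elim/tensor_ind: t => [x y|c x y IHx IHy].
    by rewrite tensM !tlinE (actM act_module) rmorphM mulrA.
  by rewrite linearP mulrDl -scalerAl IHx IHy mulrDl -scalerAl linearP.
apply: hopf_ind => [|x y relx' rely w|g gl w|x px w].
- split=> [w|c x y hx hy w]; first by rewrite !raddf0 mul0r.
  by rewrite !linearP /= mulrDl -scalerAl hx hy.
- rewrite !rmorphM /= -mulrA rely; elim/tensor_ind: (comul H y) => [a b|c s t IHs IHt].
    by rewrite tlinE mulrA relx' mulP.
  by rewrite tlin_linear mulrDr -scalerAr IHs IHt -tlin_linear scalerAr -mulrDr.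
- by rewrite gl.1 tlinE; exact: relg.
- by rewrite px raddfD /= !tlinE rmorph1 mulr1 (act1 act_module) relx.
Qed.

Local Notation SV := (sym_smashV act).
Local Notation SH := (sym_smashH act).
Let proper := @sym_smash_proper F H V act.

Fact sym_smash_eq x y : sym_smash_rel act (x - y) -> qproj proper x = qproj proper y.
Proof.
move=> r; apply/eqP; rewrite -subr_eq0 -raddfB; apply/eqP.
by apply/((qprojP proper).2 _).2; exact: ideal_gen.
Qed.
Fact sym_smashV_linear : linear SV.
Proof.
move=> a u v; rewrite /sym_smashV (sym_smash_eq (y := a *: free_var F (inl u) + free_var F (inl v))).
  by rewrite linearP.
by left; exact: smash_rel_linV.
Qed.
HB.instance Definition _ := GRing.isLinear.Build F V (sym_smash act) *:%R SV sym_smashV_linear.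
Fact sym_smashH_linear : linear SH.
Proof.
move=> a u v; rewrite /sym_smashH (sym_smash_eq (y := a *: free_var F (inr u) + free_var F (inr v))).
  by rewrite linearP.
by left; exact: smash_rel_linH.
Qed.
HB.instance Definition _ := GRing.isLinear.Build F H (sym_smash act) *:%R SH sym_smashH_linear.
Fact sym_smashH_monoid : monoid_morphism SH.
Proof.
split; first by rewrite /sym_smashH (sym_smash_eq (y := 1)) ?rmorph1 //; left; exact: smash_rel_1.
move=> g h; rewrite /sym_smashH (sym_smash_eq (y := free_var F (inr g) * free_var F (inr h))).
  by rewrite rmorphM.
by left; exact: smash_rel_M.
Qed.
HB.instance Definition _ :=
  GRing.isMonoidMorphism.Build H (sym_smash act) SH sym_smashH_monoid.

Lemma sym_smashVC v w : SV v * SV w = SV w * SV v.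
Proof.
rewrite /sym_smashV -!rmorphM; apply: sym_smash_eq; right; by exists v, w.
Qed.

Lemma sym_smash_compat : smash_compat act SV SH.
Proof.
split=> [g v gl|x v px].
  rewrite /sym_smashV /sym_smashH -!rmorphM; apply: sym_smash_eq; left.
  have := @smash_rel_act F H V act g v [:: (g, g)].
  by rewrite !big_seq1; apply; exact: gl.1.
transitivity (SV (act x v) * SH 1 + SV (act 1 v) * SH x); last first.
  by rewrite rmorph1 mulr1 (act1 act_module).
rewrite /sym_smashV /sym_smashH -!rmorphM -rmorphD; apply: sym_smash_eq; left.
have := @smash_rel_act F H V act x v [:: (x, 1); (1, x)].
by rewrite !big_cons !big_nil !addr0; apply.
Qed.

Lemma smash_compat_smash : smash_compat act (smashV act) (smashH act).
Proof.
split=> [g v gl|x v px].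
  rewrite /smashV /smashH -!rmorphM; apply: smash_eq.
  have := @smash_rel_act F H V act g v [:: (g, g)].
  by rewrite !big_seq1; apply; exact: gl.1.
transitivity (smashV act (act x v) * smashH act 1 + smashV act (act 1 v) * smashH act x);
  last by rewrite rmorph1 mulr1 (act1 act_module).
rewrite /smashV /smashH -!rmorphM -rmorphD; apply: smash_eq.
have := @smash_rel_act F H V act x v [:: (x, 1); (1, x)].
by rewrite !big_cons !big_nil !addr0; apply.
Qed.

Lemma sym_smash_univ (B : algType F) (jV : {linear V -> B}) (jH : {lrmorphism H -> B}) :
  smash_compat act jV jH -> (forall v w, jV v * jV w = jV w * jV v) ->
  exists f : {lrmorphism sym_smash act -> B},
    (forall v, f (SV v) = jV v) /\ (forall h, f (SH h) = jH h).
Proof.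
move=> rel jVC.
pose ev := free_eval (fun x : V + H => match x with inl v => jV v | inr h => jH h end).
have evV v : ev (free_var F (inl v)) = jV v by exact: free_eval_var.
have evH h : ev (free_var F (inr h)) = jH h by exact: free_eval_var.
have [|f fP] := @quotient_lift F _ (sym_smash act) B (qproj proper) _ ev (qprojP proper).
  apply: ideal_ker => r [[a u v|a g h||g h|h v s hE]|[v [w ->]]]; rewrite raddfB /=.
  - by rewrite linearP /= -/ev !evV linearP subrr.
  - by rewrite linearP /= -/ev !evH linearP subrr.
  - by rewrite rmorph1 -/ev evH rmorph1 subrr.
  - by rewrite rmorphM /= -/ev !evH rmorphM subrr.
  - rewrite rmorphM raddf_sum /= -/ev evH evV (smash_compat_comul rel _ hE).
    by rewrite -sumrB big1 // => p _; rewrite /ev rmorphM /= -/ev evV evH subrr.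
  - by rewrite !rmorphM /= -/ev !evV jVC subrr.
by exists f; split=> [v|h]; rewrite /sym_smashV /sym_smashH fP.
Qed.

Lemma sym_smash_ind (P : sym_smash act -> Prop) : lin_closed P -> P 1 ->
  (forall v p, P p -> P (SV v * p)) ->
  (forall g p, grouplike g -> P p -> P (SH g * p)) ->
  (forall x p, primitive x -> P p -> P (SH x * p)) -> forall p, P p.
Proof.
move=> Plin P1 PV Pg Px p; have [y <-] := (qprojP proper).1 p.
have PH h : forall q, P q -> P (SH h * q).
  apply: (hopf_ind (P := fun h => forall q, P q -> P (SH h * q))) => [|x z Px' Pz q|g gl q|x px q].
  - split=> [q|c x z Px' Pz q Pq]; first by rewrite raddf0 mul0r => _; exact: Plin.1.
    rewrite linearP mulrDl -scalerAl; apply: Plin.2; [exact: Px' | exact: Pz].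
  - by rewrite rmorphM -mulrA => /Pz/Px'.
  - exact: Pg.
  - exact: Px.
elim/free_alg_ind: y => [||[v|h] y].
- exact: (lin_closed_preim (qproj proper) Plin).
- by rewrite rmorph1.
- by rewrite rmorphM; exact: PV.
- by rewrite rmorphM; exact: PH.
Qed.
End SmashTheory.

(** * Orthogonal modules, dual bases and Casimir tensors *)

Lemma primitive_counit (F : fieldType) (H : hopfAlg F) (x : H) :
  primitive x -> counit H x = 0.
Proof.
move=> px; have := counitl x.
rewrite px (tliftE (slicel_bilinear H (counit H))) raddfD /= !tlinE rmorph1.
rewrite scale1r -[RHS]add0r => /addIr/(congr1 (counit H)).
by rewrite linearZ /= rmorph1 raddf0 => h; rewrite -[LHS]mulr1; exact: h.
Qed.

(** The operator calculus uses the form through these identities about dual families; the last two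
    are its invariance evaluated on group-like and on primitive elements. *)
Record orthogonal_frame (F : fieldType) (H : hopfAlg F) (V : lmodType F)
    (act : H -> V -> V) (B : V -> V -> F) n (e e' : 'I_n -> V) : Prop := {
  frame_module : is_module act;
  frame_linear : forall a u v w, B (a *: u + v) w = a * B u w + B v w;
  frame_sym : forall v w, B v w = B w v;
  frame_dual : forall i j, B (e i) (e' j) = (i == j)%:R;
  frame_expand : forall v, v = \sum_i B v (e' i) *: e i;
  frame_expand' : forall v, v = \sum_i B v (e i) *: e' i;
  frame_grouplike : forall g v w, grouplike g -> B (act g v) (act g w) = B v w;
  frame_primitive : forall x v w, primitive x -> B (act x v) w = - B v (act x w)
}.

Section Frame.
Variables (F : fieldType) (H : hopfAlg F) (V : lmodType F) (act : H -> V -> V).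
Variables (B : V -> V -> F) (n : nat) (e e' : 'I_n -> V).
Hypothesis fr : orthogonal_frame act B e e'.

Fact form_linearl w : linear (fun v => B v w : F^o).
Proof. by move=> a u v; rewrite (frame_linear fr). Qed.
Definition form_left w : {linear V -> F^o} :=
  HB.pack (fun v => B v w : F^o) (GRing.isLinear.Build _ _ _ _ _ (form_linearl w)).

Lemma form_suml w (I : Type) (s : seq I) (a : I -> F) (v : I -> V) :
  B (\sum_(i <- s) a i *: v i) w = \sum_(i <- s) a i * B (v i) w.
Proof.
rewrite -[LHS]/(form_left w _) linear_sum; apply: eq_bigr => i _.
exact: (linearZ_LR (form_left w)).
Qed.
Lemma frame_contract (Z : lmodType F) (f : {linear V -> Z}) v :
  \sum_i B v (e i) *: f (e' i) = f v.
Proof.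
rewrite [in RHS](frame_expand' fr v) linear_sum.
by apply: eq_bigr => i _; rewrite linearZ.
Qed.
Lemma frame_contract' (Z : lmodType F) (f : {linear V -> Z}) v :
  \sum_i B v (e' i) *: f (e i) = f v.
Proof.
rewrite [in RHS](frame_expand fr v) linear_sum.
by apply: eq_bigr => i _; rewrite linearZ.
Qed.

Section Casimir.
Variables (Z : lmodType F) (b : V -> V -> Z) (b_bil : is_bilinear b).

Fact bil_l_linear w : linear (b^~ w). Proof. exact: b_bil.1. Qed.
Fact bil_r_linear v : linear (b v). Proof. exact: b_bil.2. Qed.
Let bl w : {linear V -> Z} := HB.pack (b^~ w) (GRing.isLinear.Build _ _ _ _ _ (bil_l_linear w)).
Let br v : {linear V -> Z} := HB.pack (b v) (GRing.isLinear.Build _ _ _ _ _ (bil_r_linear v)).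

(** The sum of [e i] ⊗ [e' i] is the canonical tensor of the form, so an operator on one leg moves
    to the other as its adjoint. The two Casimir lemmas below are the cases of [act g] and
    [act x]. *)
Lemma frame_adjoint (T T' : V -> V) : (forall v w, B (T v) w = B v (T' w)) ->
  \sum_i b (T (e i)) (e' i) = \sum_i b (e i) (T' (e' i)).
Proof.
move=> TT'; under eq_bigr => i _.
  rewrite (frame_expand fr (T (e i))) -[b _ _]/(bl (e' i) _) linear_sum.
  under eq_bigr => j _ do rewrite linearZ /= TT' (frame_sym fr).
  over.
rewrite exchange_big; apply: eq_bigr => j _ /=.
by rewrite -[RHS]/(br (e j) _) -frame_contract.
Qed.

End Casimir.

Lemma act_lin_bilinear (Z : lmodType F) (b : V -> V -> Z) h :
  is_bilinear b -> is_bilinear (fun v w => b v (act h w)).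
Proof.
move=> b_bil; split=> [w a u v|u a v w] /=; first by rewrite b_bil.1.
by rewrite (act_linearr (frame_module fr)) b_bil.2.
Qed.

Lemma frame_casimir_grouplike (Z : lmodType F) (b : V -> V -> Z) g :
  is_bilinear b -> grouplike g ->
  \sum_i b (act g (e i)) (act g (e' i)) = \sum_i b (e i) (e' i).
Proof.
move=> b_bil gl; have md := frame_module fr; have [Sg gS] := grouplike_antipode gl.
rewrite (frame_adjoint (act_lin_bilinear g b_bil) (T := act g) (T' := act (antipode H g))).
  by apply: eq_bigr => i _; rewrite -(actM md) gS (act1 md).
move=> v w; rewrite -(frame_grouplike fr v _ gl).
by rewrite -(actM md) gS (act1 md).
Qed.

Lemma frame_casimir_primitive (Z : lmodType F) (b : V -> V -> Z) x :
  is_bilinear b -> primitive x ->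
  \sum_i b (act x (e i)) (e' i) = - \sum_i b (e i) (act x (e' i)).
Proof.
move=> b_bil px; rewrite (frame_adjoint b_bil (T' := fun v => - act x v)).
  rewrite -sumrN; apply: eq_bigr => i _.
  pose f : {linear V -> Z} := HB.pack (b (e i))
    (GRing.isLinear.Build _ _ _ _ _ (bil_r_linear b_bil (e i))).
  exact: (raddfN f).
move=> v w; rewrite (frame_primitive fr) // (frame_sym fr) (frame_sym fr v).
by rewrite -(raddfN (form_left v)).
Qed.
End Frame.

(** * Contractions on S(V) x| H *)

(* Characterizes S(V) x| H up to isomorphism.                                  *)
Record is_sym_smash (F : fieldType) (H : hopfAlg F) (V : lmodType F)
    (act : H -> V -> V) (S : algType F) (SV : {linear V -> S})
    (SH : {lrmorphism H -> S}) : Prop := {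
  ss_compat : smash_compat act SV SH;
  ss_comm : forall v w, SV v * SV w = SV w * SV v;
  ss_univ : forall (B : algType F) (jV : {linear V -> B}) (jH : {lrmorphism H -> B}),
    smash_compat act jV jH -> (forall v w, jV v * jV w = jV w * jV v) ->
    exists f : {lrmorphism S -> B},
      (forall v, f (SV v) = jV v) /\ (forall h, f (SH h) = jH h);
  ss_ind : forall P : S -> Prop, lin_closed P -> P 1 ->
    (forall v p, P p -> P (SV v * p)) ->
    (forall g p, grouplike g -> P p -> P (SH g * p)) ->
    (forall x p, primitive x -> P p -> P (SH x * p)) -> forall p, P p
}.

Lemma sym_smash_is_sym_smash (F : fieldType) (F_char0 : [pchar F] =i pred0)
    (H : hopfAlg F) (H_cocomm : cocommutative H) (H_pointed : pointed H)
    (V : lmodType F) (act : H -> V -> V) (act_module : is_module act) :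
  @is_sym_smash F H V act (sym_smash act) (sym_smashV act) (sym_smashH act).
Proof.
split.
- exact: sym_smash_compat.
- exact: sym_smashVC.
- exact: sym_smash_univ.
- exact: sym_smash_ind.
Qed.

Section SmashRepresentation.
Variables (F : fieldType) (F_char0 : [pchar F] =i pred0).
Variables (H : hopfAlg F) (H_cocomm : cocommutative H) (H_pointed : pointed H).
Variables (V : lmodType F) (act : H -> V -> V).
Variables (B : V -> V -> F) (n : nat) (e e' : 'I_n -> V).
Hypothesis fr : orthogonal_frame act B e e'.

Let md : is_module act := frame_module fr.
Variables (S : algType F) (SV : {linear V -> S}) (SH : {lrmorphism H -> S}).
Hypothesis S_smash : is_sym_smash act SV SH.
Local Notation M := 'M[F]_(1 + n).

(* the representation of H on F ⊕ V, where F is the trivial module            *)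
Definition rep (h : H) : M :=
  block_mx (counit H h : F)%:M 0 0 (\matrix_(i, j) B (act h (e j)) (e' i)).

Fact rep_linear : linear rep.
Proof.
move=> a g h; rewrite /rep scale_block_mx add_block_mx !scaler0 !addr0.
rewrite linearP /= raddfD /= -mul_scalar_mx -scalar_mxM; congr block_mx.
by apply/matrixP => i j; rewrite !mxE (act_linearl md) (frame_linear fr).
Qed.
HB.instance Definition _ := GRing.isLinear.Build F H M *:%R rep rep_linear.

Fact rep_monoid : monoid_morphism rep.
Proof.
split.
  rewrite /rep rmorph1 -[RHS]/(1%:M) (scalar_mx_block 1 n 1); congr block_mx.
  by apply/matrixP => i j; rewrite !mxE (act1 md) (frame_dual fr) eq_sym.
move=> g h; rewrite -[RHS]/(_ *m _) /rep mulmx_block rmorphM !mul0mx !mulmx0.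
rewrite !addr0 !add0r -scalar_mxM; congr block_mx.
apply/matrixP => i j; rewrite !mxE (actM md).
have := frame_contract' fr (act_lin md g) (act h (e j)) => /= <-.
rewrite (form_suml fr); apply: eq_bigr => k _.
by rewrite !mxE mulrC.
Qed.
HB.instance Definition _ := GRing.isMonoidMorphism.Build H M rep rep_monoid.

Definition nil_mx (v : V) : M := block_mx 0 0 (\col_i B v (e' i)) 0.

Fact nil_mx_linear : linear nil_mx.
Proof.
move=> a u v; rewrite /nil_mx scale_block_mx add_block_mx !scaler0 !addr0.
by congr block_mx; apply/matrixP => i j; rewrite !mxE (frame_linear fr).
Qed.
HB.instance Definition _ := GRing.isLinear.Build F V M *:%R nil_mx nil_mx_linear.

Lemma nil_mxM v w : nil_mx v * nil_mx w = 0.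
Proof.
rewrite -[LHS]/(_ *m _) /nil_mx mulmx_block !mul0mx !mulmx0 !addr0.
exact: block_mx0.
Qed.

Lemma rep_nil h v : rep h * nil_mx v = nil_mx (act h v).
Proof.
rewrite -[LHS]/(_ *m _) /rep /nil_mx mulmx_block !mul0mx !mulmx0 !addr0 !add0r.
congr block_mx; apply/matrixP => i j; rewrite !mxE.
have := frame_contract' fr (act_lin md h) v => /= <-.
by rewrite (form_suml fr); apply: eq_bigr => k _; rewrite !mxE mulrC.
Qed.

Lemma nil_rep v h : nil_mx v * rep h = (counit H h : F) *: nil_mx v.
Proof.
rewrite -[LHS]/(_ *m _) /rep /nil_mx mulmx_block !mul0mx !mulmx0 ?addr0 ?add0r.
by rewrite scale_block_mx !scaler0 mul_mx_scalar.
Qed.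

(** S(V) x| H is itself a Hopf algebra with V primitive, and it acts on F ⊕ V with v sending 1 to v
    and killing V. The map [Psi] is its coproduct followed by this representation on the left
    factor; its matrix entries supply all contractions. *)
Definition Psi_V (v : V) : tensor M S := nil_mx v ⊗ 1 + 1 ⊗ SV v.
Fact Psi_V_linear : linear Psi_V.
Proof.
move=> a u v; rewrite /Psi_V !linearP !(tensDl, tensDr, tensZl, tensZr).
by rewrite scalerDr addrACA.
Qed.
HB.instance Definition _ := GRing.isLinear.Build F V _ *:%R Psi_V Psi_V_linear.
Let Psi_H : {lrmorphism H -> tensor M S} := tmap rep SH \o comul H.

Fact Psi_exists : exists Psi : {lrmorphism S -> tensor M S},
  (forall v, Psi (SV v) = Psi_V v) /\ (forall h, Psi (SH h) = Psi_H h).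
Proof.
have [relg relx] := ss_compat S_smash.
apply: (ss_univ S_smash) => [|v w]; last first.
  rewrite /= /Psi_V !mulrDr !mulrDl !tensM !nil_mxM !mulr1 !mul1r tens0l !add0r.
  by rewrite (ss_comm S_smash) [in LHS]addrA [in LHS](addrC (nil_mx w ⊗ _)) -addrA.
split=> [g v gl|x v px] /=.
  rewrite /Psi_H /= gl.1 tmapE /Psi_V mulrDr mulrDl !tensM !mulr1 !mul1r relg //.
  by rewrite rep_nil nil_rep gl.2 scale1r.
rewrite /Psi_H /= px raddfD /= !tmapE !rmorph1 /Psi_V !mulrDr !mulrDl !tensM.
rewrite !mulr1 !mul1r relx // rep_nil nil_rep (primitive_counit px) scale0r tens0l.
rewrite add0r tensDr -!addrA; congr (_ + _).
rewrite [LHS]addrCA [RHS]addrC -!addrA; congr (_ + (_ + _)).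
by rewrite addrC.
Qed.
Definition Psi : {lrmorphism S -> tensor M S} := projT1 (cid Psi_exists).
Lemma PsiV v : Psi (SV v) = nil_mx v ⊗ 1 + 1 ⊗ SV v.
Proof. by rewrite /Psi; case: cid => f [fV fH] /=; rewrite fV. Qed.
Lemma Psi_grouplike g : grouplike g -> Psi (SH g) = rep g ⊗ SH g.
Proof.
by move=> gl; rewrite /Psi; case: cid => f [fV fH] /=; rewrite fH /Psi_H /= gl.1 tmapE.
Qed.
Lemma Psi_primitive x : primitive x -> Psi (SH x) = rep x ⊗ 1 + 1 ⊗ SH x.
Proof.
move=> px; rewrite /Psi; case: cid => f [fV fH] /=.
by rewrite fH /Psi_H /= px raddfD /= !tmapE !rmorph1.
Qed.

Implicit Types (R : 'rV[F]_(1 + n)) (C : 'cV[F]_(1 + n)).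

Fact entry_bilinear R C :
  is_bilinear (fun (m : M) (p : S) => (R *m m *m C) 0 0 *: p).
Proof.
split=> [p a m m'|m a p p'] /=.
  by rewrite mulmxDr mulmxDl -scalemxAr -scalemxAl !mxE scalerDl scalerA.
by rewrite scalerDr !scalerA mulrC.
Qed.
Definition entry R C : S -> S := tlin (entry_bilinear R C) \o Psi.
HB.instance Definition _ R C := GRing.Linear.on (entry R C).

Lemma entry1 R C : entry R C 1 = (R *m C) 0 0 *: 1.
Proof. by rewrite /entry /= rmorph1 tlinE mulmx1. Qed.

Let entry_mull R C (m : M) (q : S) t :
  tlin (entry_bilinear R C) ((m ⊗ q) * t) = q * tlin (entry_bilinear (R *m m) C) t.
Proof.
elim/tensor_ind: t => [m' q'|a t t' IH IH'].
  by rewrite tensM !tlinE mulmxA -scalerAr.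
by rewrite mulrDr -scalerAr !tlin_linear IH IH' mulrDr -scalerAr.
Qed.

Let entry_mulr R C (m : M) (q : S) t :
  tlin (entry_bilinear R C) (t * (m ⊗ q)) = tlin (entry_bilinear R (m *m C)) t * q.
Proof.
elim/tensor_ind: t => [m' q'|a t t' IH IH'].
  by rewrite tensM !tlinE !mulmxA -scalerAl.
by rewrite mulrDl -scalerAl !tlin_linear IH IH' mulrDl -scalerAl.
Qed.

Lemma entryV R C v p :
  entry R C (SV v * p) = entry (R *m nil_mx v) C p + SV v * entry R C p.
Proof.
by rewrite /entry /= rmorphM /= PsiV mulrDl raddfD /= !entry_mull mulmx1 mul1r.
Qed.
Lemma entry_grouplike R C g p : grouplike g ->
  entry R C (SH g * p) = SH g * entry (R *m rep g) C p.
Proof. by move=> gl; rewrite /entry /= rmorphM /= Psi_grouplike // entry_mull. Qed.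
Lemma entry_primitive R C x p : primitive x ->
  entry R C (SH x * p) = entry (R *m rep x) C p + SH x * entry R C p.
Proof.
move=> px; rewrite /entry /= rmorphM /= Psi_primitive // mulrDl raddfD /= !entry_mull.
by rewrite mulmx1 mul1r.
Qed.
Lemma entry_grouplike_r R C g p : grouplike g ->
  entry R C (p * SH g) = entry R (rep g *m C) p * SH g.
Proof. by move=> gl; rewrite /entry /= rmorphM /= Psi_grouplike // entry_mulr. Qed.
Lemma entry_primitive_r R C x p : primitive x ->
  entry R C (p * SH x) = entry R (rep x *m C) p + entry R C p * SH x.
Proof.
move=> px; rewrite /entry /= rmorphM /= Psi_primitive // mulrDr raddfD /= !entry_mulr.
by rewrite mul1mx mulr1.
Qed.

Lemma entry_bil p : is_bilinear (fun R C => entry R C p).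
Proof.
rewrite /entry /=; have [r [m [q ->]]] := tensor_sum (Psi p).
split=> [C a R R'|R a C C'] /=; rewrite !raddf_sum /= ?scaler_sumr -big_split /=;
  apply: eq_bigr => i _; rewrite !tlinE.
  by rewrite !(mulmxDl, =^~ scalemxAl) !mxE scalerDl scalerA.
by rewrite mulmxDr -scalemxAr !mxE scalerDl scalerA.
Qed.

Definition row0 : 'rV[F]_(1 + n) := row_mx 1 0.
Definition rowV (w : V) : 'rV[F]_(1 + n) := row_mx 0 (\row_i B w (e i)).
Definition col0 : 'cV[F]_(1 + n) := col_mx 1 0.
Definition colV (u : V) : 'cV[F]_(1 + n) := col_mx 0 (\col_i B u (e' i)).

Lemma row0_nil v : row0 *m nil_mx v = 0.
Proof. by rewrite /row0 /nil_mx mul_row_block !mulmx0 !mul0mx !addr0 row_mx0. Qed.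
Lemma rowV_nil w v : rowV w *m nil_mx v = B w v *: row0.
Proof.
rewrite /rowV /row0 /nil_mx mul_row_block !mulmx0 !addr0 add0r scale_row_mx scaler0.
congr row_mx; apply/matrixP => i j; rewrite !mxE !ord1 eqxx mulr1.
rewrite [in RHS](frame_sym fr) -[RHS]/(form_left fr w v).
rewrite -(frame_contract' fr (form_left fr w) v).
by apply: eq_bigr => k _; rewrite !mxE /= (frame_sym fr w) mulrC.
Qed.
Lemma row0_rep h : row0 *m rep h = (counit H h : F) *: row0.
Proof.
rewrite /row0 /rep mul_row_block !mulmx0 !mul0mx !addr0 scale_row_mx scaler0.
by rewrite mul1mx scalemx1.
Qed.
Lemma rowV_rep w h : rowV w *m rep h = row_mx 0 (\row_j B w (act h (e j))).
Proof.
rewrite /rowV /rep mul_row_block !mulmx0 !mul0mx !add0r; congr row_mx.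
apply/rowP => j; rewrite !mxE [in RHS](frame_sym fr).
rewrite -[RHS]/(form_left fr w _) -(frame_contract' fr (form_left fr w)).
by apply: eq_bigr => k _; rewrite !mxE /= (frame_sym fr w) mulrC.
Qed.
Lemma rowV_grouplike w g : grouplike g -> rowV (act g w) *m rep g = rowV w.
Proof.
move=> gl; rewrite rowV_rep; congr row_mx; apply/rowP => j.
by rewrite !mxE (frame_grouplike fr).
Qed.
Lemma rowV_primitive w x : primitive x -> rowV w *m rep x = - rowV (act x w).
Proof.
move=> px; rewrite rowV_rep /rowV opp_row_mx oppr0; congr row_mx; apply/rowP => j.
by rewrite !mxE (frame_primitive fr) ?opprK.
Qed.
Lemma rep_colV h u : rep h *m colV u = colV (act h u).
Proof.
rewrite /colV /rep mul_block_col !mulmx0 !mul0mx !add0r; congr col_mx.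
apply/colP => i; rewrite !mxE.
have := frame_contract' fr (act_lin md h) u => /= <-.
by rewrite (form_suml fr); apply: eq_bigr => k _; rewrite !mxE mulrC.
Qed.
Lemma rowV_col0 w : rowV w *m col0 = 0.
Proof. by rewrite /rowV /col0 mul_row_col mulmx0 mul0mx addr0. Qed.
Lemma row0_colV u : row0 *m colV u = 0.
Proof. by rewrite /row0 /colV mul_row_col mulmx0 mul0mx addr0. Qed.
Lemma row0_col0 : row0 *m col0 = 1.
Proof. by rewrite /row0 /col0 mul_row_col mul1mx mul0mx addr0. Qed.
Lemma rowV_colV w u : (rowV w *m colV u) 0 0 = B w u.
Proof.
rewrite /rowV /colV mul_row_col mul0mx add0r !mxE.
rewrite [in RHS](frame_sym fr) -[RHS]/(form_left fr w u).
rewrite -(frame_contract' fr (form_left fr w) u).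
by apply: eq_bigr => k _; rewrite !mxE /= (frame_sym fr w) mulrC.
Qed.

Lemma rep_col0 h : rep h *m col0 = (counit H h : F) *: col0.
Proof.
rewrite /col0 /rep mul_block_col !mulmx0 !mul0mx !addr0 scale_col_mx scaler0.
by rewrite mulmx1 scalemx1.
Qed.

Fact rowV_linear : linear rowV.
Proof.
move=> a u v; rewrite /rowV scale_row_mx scaler0 add_row_mx addr0.
by congr row_mx; apply/rowP => i; rewrite !mxE (frame_linear fr).
Qed.
Fact colV_linear : linear colV.
Proof.
move=> a u v; rewrite /colV scale_col_mx scaler0 add_col_mx addr0.
by congr col_mx; apply/colP => i; rewrite !mxE (frame_linear fr).
Qed.

Let entry0l C p : entry 0 C p = 0.
Proof. by have /= := (entry_bil p).1 C (-1) 0 0; rewrite scaler0 add0r scaleN1r addNr. Qed.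
Let entry0r R p : entry R 0 p = 0.
Proof. by have /= := (entry_bil p).2 R (-1) 0 0; rewrite scaler0 add0r scaleN1r addNr. Qed.
Let entryZl a R C p : entry (a *: R) C p = a *: entry R C p.
Proof. by have /= := (entry_bil p).1 C a R 0; rewrite entry0l !addr0. Qed.
Let entryNl R C p : entry (- R) C p = - entry R C p.
Proof. by rewrite -scaleN1r entryZl scaleN1r. Qed.

Let S_ind := ss_ind S_smash.

Lemma entry00 p : entry row0 col0 p = p.
Proof.
apply: (S_ind (P := fun p => entry row0 col0 p = p)) => [||v {}p IHp|g {}p gl IHp|x {}p px IHp].
- exact: (lin_closed_eq (entry row0 col0) idfun).
- by rewrite entry1 row0_col0 mxE eqxx scale1r.
- by rewrite entryV row0_nil entry0l add0r IHp.
- by rewrite entry_grouplike // row0_rep gl.2 scale1r IHp.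
- by rewrite entry_primitive // row0_rep primitive_counit // scale0r entry0l add0r IHp.
Qed.

Lemma entry0V u p : entry row0 (colV u) p = 0.
Proof.
apply: (S_ind (P := fun p => entry row0 (colV u) p = 0)) => [||v {}p IHp|g {}p gl IHp|x {}p px IHp].
- by split=> [|a x y hx hy]; rewrite ?raddf0 // linearP /= hx hy scaler0 addr0.
- by rewrite entry1 row0_colV mxE scale0r.
- by rewrite entryV row0_nil entry0l add0r IHp mulr0.
- by rewrite entry_grouplike // row0_rep gl.2 scale1r IHp mulr0.
- by rewrite entry_primitive // row0_rep primitive_counit // scale0r entry0l add0r IHp mulr0.
Qed.

(* [rho w u] is p |-> <w, p_(-1) u> p_(0), for the coaction of H on S, and    *)
(* [der w] is the contraction with w on the factor S(V) of S                  *)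
Definition rho (w u : V) : S -> S := entry (rowV w) (colV u).
HB.instance Definition _ w u := GRing.Linear.on (rho w u).
Definition der (w : V) : S -> S := entry (rowV w) col0.
HB.instance Definition _ w := GRing.Linear.on (der w).

Lemma rho_bil p : is_bilinear (fun w u => rho w u p).
Proof.
split=> [u a w w'|w a u u'] /=; rewrite /rho ?rowV_linear ?colV_linear.
  exact: (entry_bil p).1.
exact: (entry_bil p).2.
Qed.
Lemma der_linear p : linear (der^~ p).
Proof. by move=> a w w'; rewrite /der rowV_linear; exact: (entry_bil p).1. Qed.

Lemma rho1 w u : rho w u 1 = B w u *: 1.
Proof. by rewrite /rho entry1 rowV_colV. Qed.
Lemma rhoV w u v p : rho w u (SV v * p) = SV v * rho w u p.
Proof. by rewrite /rho entryV rowV_nil entryZl entry0V scaler0 add0r. Qed.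
Lemma rho_grouplike w u g p : grouplike g ->
  rho (act g w) u (SH g * p) = SH g * rho w u p.
Proof. by move=> gl; rewrite /rho entry_grouplike // rowV_grouplike. Qed.
Lemma rho_primitive w u x p : primitive x ->
  rho w u (SH x * p) = SH x * rho w u p - rho (act x w) u p.
Proof. by move=> px; rewrite /rho entry_primitive // rowV_primitive // entryNl addrC. Qed.
Lemma rho_grouplike_r w u g p : grouplike g ->
  rho w u (p * SH g) = rho w (act g u) p * SH g.
Proof. by move=> gl; rewrite /rho entry_grouplike_r // rep_colV. Qed.
Lemma rho_primitive_r w u x p : primitive x ->
  rho w u (p * SH x) = rho w (act x u) p + rho w u p * SH x.
Proof. by move=> px; rewrite /rho entry_primitive_r // rep_colV. Qed.

Lemma der1 w : der w 1 = 0.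
Proof. by rewrite /der entry1 rowV_col0 mxE scale0r. Qed.
Lemma derV w v p : der w (SV v * p) = B w v *: p + SV v * der w p.
Proof. by rewrite /der entryV rowV_nil entryZl entry00. Qed.
Lemma der_grouplike w g p : grouplike g -> der (act g w) (SH g * p) = SH g * der w p.
Proof. by move=> gl; rewrite /der entry_grouplike // rowV_grouplike. Qed.
Lemma der_primitive w x p : primitive x ->
  der w (SH x * p) = SH x * der w p - der (act x w) p.
Proof. by move=> px; rewrite /der entry_primitive // rowV_primitive // entryNl addrC. Qed.
Lemma der_mulH w p h : der w (p * SH h) = der w p * SH h.
Proof.
move: p; apply: (hopf_ind F_char0 H_cocomm H_pointed (P := fun h =>
  forall p, der w (p * SH h) = der w p * SH h)) => [|x y IHx IHy p|g gl p|x px p].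
- split=> [p|a x y IHx IHy p]; first by rewrite raddf0 !mulr0 raddf0.
  by rewrite linearP /= !mulrDr -!scalerAr linearP /= IHx IHy.
- by rewrite rmorphM /= !mulrA IHy IHx.
- by rewrite /der entry_grouplike_r // rep_col0 gl.2 scale1r.
- by rewrite /der entry_primitive_r // rep_col0 primitive_counit // scale0r entry0r add0r.
Qed.

Lemma act_grouplike_surj g v : grouplike g -> exists w, v = act g w.
Proof.
move=> /grouplike_antipode[_ gS]; exists (act (antipode H g) v).
by rewrite -(actM md) gS (act1 md).
Qed.

Lemma rhoC v u w t p : rho v u (rho w t p) = rho w t (rho v u p).
Proof.
move: v w; apply: (S_ind (P := fun p => forall v w, rho v u (rho w t p) = rho w t (rho v u p)))
  => [||v' {}p IHp v w|g {}p gl IHp v w|x {}p px IHp v w].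
- split=> [v w|a x y hx hy v w]; first by rewrite !raddf0.
  by rewrite !linearP /= hx hy.
- by move=> v w; rewrite !rho1 !linearZ /= !rho1 !scalerA mulrC.
- by rewrite !rhoV IHp.
- have [v' ->] := act_grouplike_surj v gl; have [w' ->] := act_grouplike_surj w gl.
  by rewrite !rho_grouplike // IHp.
- rewrite !rho_primitive // !raddfB /= !rho_primitive //.
  by rewrite (IHp v w) (IHp (act x v) w) (IHp v (act x w)) addrAC.
Qed.

(** Orthogonality of the H-module V, seen through the coaction. It is what later evaluates the
    anticommutator of twisted right Clifford multiplications. *)
Lemma rho_contract v w p : \sum_i rho v (e i) (rho w (e' i) p) = B v w *: p.
Proof.
move: v w; apply: (S_ind (P := fun p => forall v w,
    \sum_i rho v (e i) (rho w (e' i) p) = B v w *: p))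
  => [||v' {}p IHp v w|g {}p gl IHp v w|x {}p px IHp v w].
- split=> [v w|a x y hx hy v w].
    by rewrite big1 ?scaler0 // => i _; rewrite !raddf0.
  rewrite scalerDr scalerA mulrC -scalerA -hx -hy scaler_sumr -big_split /=.
  by apply: eq_bigr => i _; rewrite !linearP.
- move=> v w; under eq_bigr do rewrite rho1 linearZ /= rho1 scalerA.
  rewrite -scaler_suml; congr (_ *: _).
  rewrite -[RHS]/(form_left fr w v) -(frame_contract fr (form_left fr w)).
  by apply: eq_bigr => i _ /=; rewrite mulrC (frame_sym fr w).
- under eq_bigr do rewrite !rhoV; by rewrite -mulr_sumr IHp -scalerAr.
- have [v' ->] := act_grouplike_surj v gl; have [w' ->] := act_grouplike_surj w gl.
  under eq_bigr do rewrite !rho_grouplike //.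
  by rewrite -mulr_sumr IHp (frame_grouplike fr) // -scalerAr.
- under eq_bigr do rewrite !rho_primitive // !raddfB /= !rho_primitive //.
  rewrite !sumrB -mulr_sumr !IHp -scalerAr (frame_primitive fr) // scaleNr opprK.
  by rewrite addrK.
Qed.

Lemma der_rho w v u p : der w (rho v u p) = rho v u (der w p).
Proof.
move: v w; apply: (S_ind (P := fun p => forall v w, der w (rho v u p) = rho v u (der w p)))
  => [||v' {}p IHp v w|g {}p gl IHp v w|x {}p px IHp v w].
- split=> [v w|a x y hx hy v w]; first by rewrite !raddf0.
  by rewrite !linearP /= hx hy.
- by move=> v w; rewrite der1 raddf0 rho1 linearZ /= der1 scaler0.
- by rewrite rhoV !derV linearP /= rhoV IHp.
- have [v' ->] := act_grouplike_surj v gl; have [w' ->] := act_grouplike_surj w gl.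
  by rewrite rho_grouplike // !der_grouplike // rho_grouplike // IHp.
- rewrite rho_primitive // der_primitive // !raddfB /= rho_primitive // der_primitive // !IHp.
  by rewrite addrAC.
Qed.

(** In Sweedler form, p u = (p_(-1) u) p_(0). This rewrites right multiplication by the Dirac
    element through left multiplications by V. *)
Lemma mulr_symV p u : p * SV u = \sum_i SV (e i) * rho (e' i) u p.
Proof.
have bil q : is_bilinear (fun v w => SV v * rho w u q).
  split=> [w a x y|v a x y] /=; first by rewrite linearP mulrDl scalerAl.
  by rewrite (rho_bil q).1 mulrDr scalerAr.
apply: (S_ind (P := fun p => p * SV u = \sum_i SV (e i) * rho (e' i) u p))
  => [||v' {}p IHp|g {}p gl IHp|x {}p px IHp].
- split=> [|a x y hx hy]; first by rewrite mul0r big1 // => i _; rewrite raddf0 mulr0.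
  rewrite mulrDl -scalerAl hx hy scaler_sumr -big_split; apply: eq_bigr => i _ /=.
  by rewrite linearP mulrDr -scalerAr.
- rewrite mul1r -(frame_contract' fr (SV : {linear V -> S}) u); apply: eq_bigr => i _.
  by rewrite rho1 -scalerAr mulr1 (frame_sym fr).
- rewrite -mulrA IHp mulr_sumr; apply: eq_bigr => i _.
  by rewrite rhoV !mulrA (ss_comm S_smash _ (e i)).
- rewrite -mulrA IHp mulr_sumr -(frame_casimir_grouplike fr (bil _) gl).
  apply: eq_bigr => i _.
  by rewrite rho_grouplike // !mulrA (ss_compat S_smash).1.
- rewrite -mulrA IHp mulr_sumr.
  under [RHS]eq_bigr => i _ do rewrite rho_primitive // mulrBr.
  rewrite sumrB -[X in _ - X]opprK -(frame_casimir_primitive fr (bil _) px) opprK.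
  rewrite addrC -big_split; apply: eq_bigr => i _ /=.
  by rewrite !mulrA (ss_compat S_smash).2 // mulrDl.
Qed.

Lemma rho_SH w u h : exists h', rho w u (SH h) = SH h'.
Proof.
pose Q p := forall w u, exists h', rho w u p = SH h'.
suff QM k p : Q p -> Q (SH k * p).
  rewrite -[SH h]mulr1; apply: QM => {}w {}u; exists (B w u *: 1).
  by rewrite rho1 linearZ /= rmorph1.
move: p; apply: (hopf_ind F_char0 H_cocomm H_pointed (P := fun k =>
  forall p, Q p -> Q (SH k * p))) => [|x y Qx Qy p Qp|g gl p Qp {}w {}u|x px p Qp {}w {}u].
- split=> [p _ {}w {}u|a x y Qx Qy p Qp {}w {}u].
    by exists 0; rewrite raddf0 mul0r raddf0.
  have [x' xE] := Qx p Qp w u; have [y' yE] := Qy p Qp w u; exists (a *: x' + y').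
  by rewrite linearP /= mulrDl -scalerAl !linearP /= xE yE.
- by rewrite rmorphM -mulrA; apply/Qx/Qy.
- have [w' ->] := act_grouplike_surj w gl; have [h' hE] := Qp w' u.
  by exists (g * h'); rewrite rho_grouplike // hE rmorphM.
- have [h' hE] := Qp w u; have [h'' hE'] := Qp (act x w) u; exists (x * h' - h'').
  by rewrite rho_primitive // hE hE' raddfB /= rmorphM.
Qed.

Fixpoint sym_degree k : S -> Prop :=
  if k is k'.+1 then span (fun p => exists v q, sym_degree k' q /\ p = SV v * q)
  else fun p => exists h, p = SH h.

Lemma sym_degree_lin k : lin_closed (sym_degree k).
Proof.
case: k => [|k]; last exact: lin_closed_span.
split; first by exists 0; rewrite raddf0.
by move=> a _ _ [h ->] [h' ->]; exists (a *: h + h'); rewrite linearP.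
Qed.

Lemma sym_degreeV k v p : sym_degree k p -> sym_degree k.+1 (SV v * p).
Proof. by move=> kp; apply: span_gen; exists v, p. Qed.

Lemma sym_degree_ind k (Q : S -> Prop) : lin_closed Q ->
  (forall v p, sym_degree k p -> Q (SV v * p)) -> forall p, sym_degree k.+1 p -> Q p.
Proof. by move=> Qlin QV; apply: span_sub => // _ [v [q [kq ->]]]; exact: QV. Qed.

Lemma sym_degreeH k h p : sym_degree k p -> sym_degree k (SH h * p).
Proof.
elim: k p h => [_ h [h' ->]|k IHk p h].
  by exists (h * h'); rewrite rmorphM.
move: p; apply: (hopf_ind F_char0 H_cocomm H_pointed (P := fun h =>
  forall p, sym_degree k.+1 p -> sym_degree k.+1 (SH h * p)))
  => [|x y Qx Qy p kp|g gl p|x px p].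
- split=> [p _|a x y Qx Qy p kp].
    by rewrite raddf0 mul0r; exact: (sym_degree_lin k.+1).1.
  rewrite linearP mulrDl -scalerAl; apply: (sym_degree_lin k.+1).2.
    exact: Qx.
  exact: Qy.
- by rewrite rmorphM -mulrA; apply/Qx/Qy.
- move: p; apply: sym_degree_ind => [|v p kp].
    exact: (lin_closed_preim (lmul (SH g)) (sym_degree_lin k.+1)).
  by rewrite mulrA (ss_compat S_smash).1 // -mulrA; apply/sym_degreeV/IHk.
- move: p; apply: sym_degree_ind => [|v p kp].
    exact: (lin_closed_preim (lmul (SH x)) (sym_degree_lin k.+1)).
  rewrite mulrA (ss_compat S_smash).2 // mulrDl -mulrA.
  by apply: lin_closedD (sym_degree_lin k.+1) _ _; apply/sym_degreeV => //; exact: IHk.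
Qed.

Lemma der_SH w h : der w (SH h) = 0.
Proof. by rewrite -[SH h]mul1r der_mulH der1 mul0r. Qed.

Lemma sym_degree_der k w p : sym_degree k.+1 p -> sym_degree k (der w p).
Proof.
elim: k p => [|k IHk]; apply: sym_degree_ind => [|v p kp].
- exact: (lin_closed_preim (der w) (sym_degree_lin 0)).
- have [h ->] := kp; rewrite derV der_SH mulr0 addr0; exists (B w v *: h).
  by rewrite linearZ.
- exact: (lin_closed_preim (der w) (sym_degree_lin k.+1)).
- rewrite derV; apply: (sym_degree_lin k.+1).2 => //; apply/sym_degreeV/IHk.
  exact: kp.
Qed.

Lemma sym_degree_rho k w u p : sym_degree k p -> sym_degree k (rho w u p).
Proof.
elim: k p => [_ [h ->]|k IHk]; first exact: rho_SH.
apply: sym_degree_ind => [|v p kp].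
  exact: (lin_closed_preim (rho w u) (sym_degree_lin k.+1)).
by rewrite rhoV; apply/sym_degreeV/IHk.
Qed.

Lemma euler k p : sym_degree k p -> \sum_i SV (e i) * der (e' i) p = k%:R *: p.
Proof.
elim: k p => [_ [h ->]|k IHk].
  by rewrite scale0r big1 // => i _; rewrite der_SH mulr0.
apply: sym_degree_ind => [|v p kp].
  split=> [|a x y hx hy].
    by rewrite scaler0 big1 // => i _; rewrite raddf0 mulr0.
  rewrite scalerDr scalerA mulrC -scalerA -hx -hy scaler_sumr -big_split.
  by apply: eq_bigr => i _ /=; rewrite linearP mulrDr -scalerAr.
under eq_bigr => i _.
  rewrite derV mulrDr -scalerAr scalerAl (frame_sym fr) mulrA (ss_comm S_smash (e i)) -mulrA.
  over.
rewrite big_split -mulr_suml -mulr_sumr IHk //=.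
have -> : \sum_i B v (e' i) *: SV (e i) = SV v.
  exact: (frame_contract' fr (SV : {linear V -> S}) v).
by rewrite -scalerAr -[X in X + _]scale1r -scalerDl nat1r.
Qed.

End SmashRepresentation.

(** * Koszul operators *)

Section CommutingIdempotents.
Variables (F : fieldType) (F_char0 : [pchar F] =i pred0) (X : lmodType F).
Variables (I : eqType) (p : I -> {linear X -> X}).
Hypothesis p_idem : forall i x, p i (p i x) = p i x.
Hypothesis p_comm : forall i j x, p i (p j x) = p j (p i x).

Let T c (s : seq I) x := (c%:R : F) *: x + \sum_(i <- s) p i x.
Let T_lin c s : linear (T c s).
Proof.
move=> a x y; rewrite /T !scalerDr addrACA scalerA mulrC -scalerA; congr (_ + _).
rewrite scaler_sumr -big_split; apply: eq_bigr => i _ /=.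
by rewrite linearP.
Qed.
Let T_p c s i x : T c s (p i x) = p i (T c s x).
Proof.
rewrite /T [RHS]raddfD /= [X in _ = X + _]linearZ [X in _ = _ + X]raddf_sum /=.
congr (_ + _).
by apply: eq_bigr => j _; rewrite p_comm.
Qed.
Let T_cons c s i x : T c (i :: s) x = T c s x + p i x.
Proof. by rewrite /T big_cons [p i x + _]addrC addrA. Qed.
Let T_S c s x : T c.+1 s x = T c s x + x.
Proof. by rewrite /T -natr1 scalerDl scale1r addrAC. Qed.
Let T_linear c s : {linear X -> X} :=
  HB.pack (T c s) (GRing.isLinear.Build _ _ _ _ (T c s) (T_lin c s)).
Let T_B c s x y : T c s (x - y) = T c s x - T c s y.
Proof. exact: (raddfB (T_linear c s)). Qed.
Let T_D c s x y : T c s (x + y) = T c s x + T c s y.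
Proof. exact: (raddfD (T_linear c s)). Qed.

(** Commuting idempotents are simultaneously diagonalizable with eigenvalues 0 and 1, so the
    operator has eigenvalues c, c + 1, and so on, all nonzero. In the induction, [p i x] satisfies
    the shorter equation with c + 1 and therefore vanishes. *)
Lemma idempotents_shift_inj c (s : seq I) x :
  (0 < c)%N -> c%:R *: x + \sum_(i <- s) p i x = 0 -> x = 0.
Proof.
rewrite -/(T c s x); elim: s c x => [|i s IHs] c x c0.
  rewrite /T big_nil addr0 => /eqP; rewrite scaler_eq0 ((pcharf0P F).1 F_char0).
  by case/orP => [/eqP cE|/eqP//]; rewrite cE in c0.
rewrite T_cons => Tx.
have px : p i x = 0.
  apply: (IHs c.+1) => //; rewrite T_S T_p -[p i x]p_idem -raddfD Tx.
  exact: raddf0.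
by apply: (IHs c) => //; rewrite px addr0 in Tx.
Qed.

(** The equation is solved separately on the image of [p i], where c becomes c + 1, and on its
    kernel. The subspace [Y] will be a homogeneous component. *)
Lemma idempotents_shift_surj (Y : X -> Prop) c (s : seq I) y :
  lin_closed Y -> (forall i x, Y x -> Y (p i x)) -> (0 < c)%N -> Y y ->
  exists2 x, Y x & c%:R *: x + \sum_(i <- s) p i x = y.
Proof.
move=> Ylin Yp; elim: s c y => [|i s IHs] c y c0 Yy.
  exists (c%:R^-1 *: y); first exact: lin_closedZ.
  rewrite big_nil addr0 scalerA mulfV ?scale1r //.
  by rewrite ((pcharf0P F).1 F_char0) -lt0n.
have [x1 Yx1 x1E] := IHs c.+1 (p i y) isT (Yp i y Yy).
have [|x0 Yx0 x0E] := IHs c (y - p i y) c0; first by apply: lin_closedB => //; exact: Yp.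
have x1E' : T c s (p i x1) + p i x1 = p i y.
  by rewrite -T_S T_p /T x1E p_idem.
have x0E' : T c s (x0 - p i x0) = y - p i y.
  rewrite T_B T_p /T x0E raddfB /= p_idem subrr.
  exact: subr0.
exists (p i x1 + (x0 - p i x0)).
  by apply: lin_closedD => //; [exact: Yp | apply: lin_closedB => //; exact: Yp].
rewrite -/(T c (i :: s) _) T_cons T_D x0E' raddfD raddfB /=.
by rewrite !p_idem subrr addr0 addrAC x1E' addrC subrK.
Qed.
End CommutingIdempotents.

Section Koszul.
Variables (F : fieldType) (F_char0 : [pchar F] =i pred0) (X : lmodType F).
Variables (H : hopfAlg F) (V : lmodType F) (act : H -> V -> V).
Variables (B : V -> V -> F) (n : nat) (e e' : 'I_n -> V).
Hypothesis fr : orthogonal_frame act B e e'.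
(* creation and annihilation operators, bosonic [mul], [der] and fermionic    *)
(* [eps], [iota] *)
Variables mul der eps iota : V -> {linear X -> X}.
Hypothesis mul_lin : forall x, linear (mul^~ x).
Hypothesis der_lin : forall x, linear (der^~ x).
Hypothesis eps_lin : forall x, linear (eps^~ x).
Hypothesis iota_lin : forall x, linear (iota^~ x).
Hypothesis mulC : forall v w x, mul v (mul w x) = mul w (mul v x).
Hypothesis der_mul : forall v w x, der v (mul w x) = B v w *: x + mul w (der v x).
Hypothesis mul_eps : forall v w x, mul v (eps w x) = eps w (mul v x).
Hypothesis mul_iota : forall v w x, mul v (iota w x) = iota w (mul v x).
Hypothesis der_iota : forall v w x, der v (iota w x) = iota w (der v x).
Hypothesis epsC : forall v w x, eps v (eps w x) = - eps w (eps v x).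
Hypothesis iotaC : forall v w x, iota v (iota w x) = - iota w (iota v x).
Hypothesis iota_eps : forall v w x,
  iota v (eps w x) = (4%:R * B v w) *: x - eps w (iota v x).

Definition koszul_d x := \sum_i mul (e i) (iota (e' i) x).
Definition koszul_s x := \sum_i eps (e i) (der (e' i) x).
Definition koszul_num x := \sum_i eps (e i) (iota (e' i) x).

Lemma koszul_d2 x : koszul_d (koszul_d x) = 0.
Proof.
have two_neq0 : 2%:R != 0 :> F by rewrite ((pcharf0P F).1 F_char0).
rewrite /koszul_d; set y := (LHS); suff /eqP : y = - y.
  rewrite -addr_eq0 -mulr2n -scaler_nat scaler_eq0 (negPf two_neq0).
  by move/eqP.
rewrite /y; under [LHS]eq_bigr do rewrite !raddf_sum /=.
rewrite [LHS]exchange_big /= -sumrN; apply: eq_bigr => i _; do 2!rewrite raddf_sum /=; rewrite -sumrN.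
apply: eq_bigr => j _; rewrite -!mul_iota mulC iotaC !raddfN /=.
by rewrite !mul_iota.
Qed.

(** Moving [iota] past [eps] contracts to the bosonic degree with factor 4, and moving [der] past
    [mul] contracts to the fermionic number operator; the remaining double sums cancel. *)
Lemma koszul_homotopy x : koszul_d (koszul_s x) + koszul_s (koszul_d x)
  = 4%:R *: \sum_i mul (e i) (der (e' i) x) + koszul_num x.
Proof.
have ->: koszul_d (koszul_s x) = 4%:R *: \sum_j mul (e j) (der (e' j) x)
    - \sum_i \sum_j eps (e j) (mul (e i) (der (e' j) (iota (e' i) x))).
  rewrite /koszul_d /koszul_s.
  under eq_bigr => i _.
    rewrite !raddf_sum /=.
    under eq_bigr => j _.
      rewrite iota_eps raddfB /= linearZ /= -der_iota mul_eps -scalerA.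
      over.
    rewrite sumrB -scaler_sumr; over.
  rewrite sumrB -scaler_sumr; congr (_ *: _ - _).
  rewrite exchange_big; apply: eq_bigr => j _ /=.
  pose f : {linear V -> X} := HB.pack (mul^~ (der (e' j) x))
    (GRing.isLinear.Build _ _ _ _ _ (mul_lin (der (e' j) x))).
  have /= <- := frame_contract' fr f (e j).
  by apply: eq_bigr => i _; rewrite (frame_sym fr).
have ->: koszul_s (koszul_d x) = koszul_num x
    + \sum_i \sum_j eps (e j) (mul (e i) (der (e' j) (iota (e' i) x))).
  rewrite /koszul_d /koszul_s.
  under eq_bigr => j _.
    rewrite !raddf_sum /=.
    under eq_bigr => i _ do rewrite der_mul raddfD /= linearZ /=.
    rewrite big_split /=; over.
  rewrite big_split /=; congr (_ + _); last by rewrite exchange_big.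
  rewrite exchange_big; apply: eq_bigr => i _ /=.
  pose f : {linear V -> X} := HB.pack (eps^~ (iota (e' i) x))
    (GRing.isLinear.Build _ _ _ _ _ (eps_lin (iota (e' i) x))).
  have /= <- := frame_contract' fr f (e i).
  by apply: eq_bigr => j _; rewrite (frame_sym fr).
by rewrite -addrA [- _ + _]addrC addrK.
Qed.

(** The occupation number of the i-th fermionic mode; the factor 1/4 normalizes the relation
    [iota_eps]. *)
Definition koszul_idem (i : 'I_n) x := 4%:R^-1 *: eps (e i) (iota (e' i) x).
Fact koszul_idem_linear i : linear (koszul_idem i).
Proof.
move=> a x y; rewrite /koszul_idem (linearP (iota _)) (linearP (eps _)) scalerDr !scalerA.
by rewrite [a * _]mulrC.
Qed.
HB.instance Definition _ i := GRing.isLinear.Build F X X *:%R _ (koszul_idem_linear i).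

Let four_neq0 : 4%:R != 0 :> F. Proof. by rewrite ((pcharf0P F).1 F_char0). Qed.
Let two_neq0 : 2%:R != 0 :> F. Proof. by rewrite ((pcharf0P F).1 F_char0). Qed.

Lemma koszul_numE x : koszul_num x = 4%:R *: \sum_i koszul_idem i x.
Proof.
rewrite /koszul_num scaler_sumr; apply: eq_bigr => i _.
by rewrite /koszul_idem scalerA mulfV // scale1r.
Qed.

Let iota2 v x : iota v (iota v x) = 0.
Proof.
have /eqP := iotaC v v x; rewrite -addr_eq0 -mulr2n -scaler_nat scaler_eq0.
by rewrite (negPf two_neq0) => /eqP.
Qed.
Let eps2 v x : eps v (eps v x) = 0.
Proof.
have /eqP := epsC v v x; rewrite -addr_eq0 -mulr2n -scaler_nat scaler_eq0.
by rewrite (negPf two_neq0) => /eqP.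
Qed.
Let iota_eps_ij i j x :
  iota (e' i) (eps (e j) x) = (i == j)%:R *: (4%:R *: x) - eps (e j) (iota (e' i) x).
Proof.
by rewrite iota_eps (frame_sym fr) (frame_dual fr) eq_sym scalerA [4%:R * _]mulrC.
Qed.

Lemma koszul_idemK i x : koszul_idem i (koszul_idem i x) = koszul_idem i x.
Proof.
rewrite /koszul_idem !linearZ /= iota_eps_ij eqxx scale1r iota2 raddf0 subr0.
by rewrite (linearZ_LR (eps _)) /= [4%:R^-1 *: (4%:R *: _)]scalerA mulVf // scale1r.
Qed.

Lemma koszul_idemC i j x : koszul_idem i (koszul_idem j x) = koszul_idem j (koszul_idem i x).
Proof.
have [->//|ij] := eqVneq i j.
rewrite /koszul_idem !linearZ /=; congr (_ *: (_ *: _)).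
rewrite !iota_eps_ij [j == i]eq_sym (negPf ij) !scale0r !sub0r.
rewrite (raddfN (eps (e i))) (raddfN (eps (e j))) /=; congr (- _).
by rewrite iotaC epsC (raddfN (eps (e i))) (raddfN (eps (e j))) opprK.
Qed.

(* the projection onto the joint kernel of the annihilation operators         *)
Definition vacuum x := foldr (fun i y => y - koszul_idem i y) x (enum 'I_n).

Lemma vacuum_id x : (forall v, iota v x = 0) -> vacuum x = x.
Proof.
move=> x0; rewrite /vacuum; elim: (enum 'I_n) => //= i s ->.
by rewrite /koszul_idem x0 raddf0 scaler0 subr0.
Qed.

Fact vacuum_linear : linear vacuum.
Proof.
move=> a x y; rewrite /vacuum; elim: (enum 'I_n) => //= i s ->.
by rewrite linearP opprD addrACA -scalerBr.
Qed.
HB.instance Definition _ := GRing.isLinear.Build F X X *:%R vacuum vacuum_linear.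

Lemma vacuum_eps v x : vacuum (eps v x) = 0.
Proof.
pose f : {linear V -> X} := HB.pack (eps^~ x) (GRing.isLinear.Build _ _ _ _ _ (eps_lin x)).
rewrite -[eps v x]/(f v) -(frame_contract' fr f v) raddf_sum big1 //= => j _.
rewrite linearZ /= -[RHS](scaler0 _ (B v (e' j))); congr (_ *: _); rewrite /vacuum.
have : j \in enum 'I_n by rewrite mem_enum.
(* The induction must also cover lists not containing j, for which every factor passes through
   [eps (e j)]; the factor of index j then gives 0. *)
suff : if j \in enum 'I_n then
    foldr (fun i y => y - koszul_idem i y) (eps (e j) x) (enum 'I_n) = 0
  else foldr (fun i y => y - koszul_idem i y) (eps (e j) x) (enum 'I_n)
    = eps (e j) (foldr (fun i y => y - koszul_idem i y) x (enum 'I_n)).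
  by move=> + jn; rewrite jn.
elim: (enum 'I_n) => //= i s; rewrite inE.
case: ifP => _ ->; first by rewrite orbT raddf0 subr0.
rewrite orbF /koszul_idem iota_eps_ij; case: eqVneq => [<-|ji].
  rewrite scale1r (raddfB (eps _)) /= eps2 subr0 (linearZ_LR (eps _)) /= scalerA mulVf // scale1r.
  by rewrite subrr.
rewrite scale0r sub0r (raddfN (eps _)) /= epsC opprK (raddfB (eps _)).
by rewrite /= (linearZ_LR (eps _)).
Qed.

Lemma vacuum_comm (R : {linear X -> X}) :
  (forall v x, R (eps v x) = eps v (R x)) -> (forall v x, R (iota v x) = iota v (R x)) ->
  forall x, R (vacuum x) = vacuum (R x).
Proof.
move=> Re Ri x; rewrite /vacuum; elim: (enum 'I_n) => //= i s <-.
by rewrite raddfB /= /koszul_idem (linearZ_LR R) /= Re Ri.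
Qed.
End Koszul.

(** * The Dirac operator *)

Record clifford_model (F : fieldType) (V : lmodType F) (B : V -> V -> F)
    (C : algType F) (cV : {linear V -> C}) (alpha : {lrmorphism C -> C}) : Prop := {
  cm_rel : forall v w, cV v * cV w + cV w * cV v = (2%:R * B v w) *: 1;
  cm_parityV : forall v, alpha (cV v) = - cV v;
  cm_parityK : forall c, alpha (alpha c) = c;
  cm_ind : forall P : C -> Prop, lin_closed P -> P 1 ->
    (forall v c, P c -> P (cV v * c)) -> forall c, P c
}.

Section PinGenerators.
Variables (F : fieldType) (H Ht : hopfAlg F) (V : lmodType F) (act : H -> V -> V).
Variables (C : algType F) (cV : {linear V -> C}) (alpha : {lrmorphism C -> C}).
Variables (pi : {lrmorphism Ht -> H}) (gamma : {lrmorphism Ht -> C}).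

Definition signed_grouplike (k : Ht) (c : F) : Prop :=
  [/\ grouplike k, grouplike (pi k), c = 1 \/ c = -1, alpha (gamma k) = c *: gamma k
    & forall v, gamma k * cV v = c *: (cV (act (pi k) v) * gamma k)].

Definition spin_primitive (k : Ht) : Prop :=
  [/\ primitive k, primitive (pi k), alpha (gamma k) = gamma k
    & forall v, gamma k * cV v = cV (act (pi k) v) + cV v * gamma k].

(* the sign c is det(k|V)                                                     *)
Definition signed_gen (k : Ht) (c : F) : Prop :=
  signed_grouplike k c \/ c = 1 /\ spin_primitive k.

Definition pin_model : Prop := forall P : Ht -> Prop, lin_closed P ->
  (forall x y, P x -> P y -> P (x * y)) -> (forall k c, signed_gen k c -> P k) ->
  forall k, P k.
End PinGenerators.

Section DiracOperator.
Variables (F : fieldType) (H Ht : hopfAlg F) (V : lmodType F) (act : H -> V -> V).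
Variables (B : V -> V -> F) (n : nat) (e e' : 'I_n -> V).
Hypothesis fr : orthogonal_frame act B e e'.
Variables (C : algType F) (cV : {linear V -> C}) (alpha : {lrmorphism C -> C}).
Hypothesis C_model : clifford_model B cV alpha.
Variables (pi : {lrmorphism Ht -> H}) (gamma : {lrmorphism Ht -> C}).
Hypothesis pin : pin_model act cV alpha pi gamma.
Variables (A : algType F) (jV : {linear V -> A}) (jH : {lrmorphism H -> A}).
Hypothesis A_compat : smash_compat act jV jH.

Local Notation gen := (signed_gen act cV alpha pi gamma).
Local Notation T := (tensor A C).
Local Notation Delta := (diag_map jH pi gamma).

Definition parity_map : T -> T := tmap (@idfun A) alpha.
HB.instance Definition _ := GRing.LRMorphism.on parity_map.
Local Notation talpha := parity_map.

Lemma parity_mapE a c : talpha (a ⊗ c) = a ⊗ alpha c.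
Proof. exact: tmapE. Qed.

Lemma parity_mapK x : talpha (talpha x) = x.
Proof.
apply: (tensor_eq (f := talpha \o talpha) (g := idfun)) => a c /=.
by rewrite !parity_mapE (cm_parityK C_model).
Qed.

Definition dirac_elt : T := \sum_i jV (e i) ⊗ cV (e' i).
Local Notation D := dirac_elt.

Fact tens_frame_bilinear : is_bilinear (fun v w => jV v ⊗ cV w : T).
Proof. by split=> [w a u v|u a v w] /=; rewrite linearP !(tensDl, tensDr, tensZl, tensZr). Qed.

Lemma parity_dirac : talpha D = - D.
Proof.
rewrite /D raddf_sum -sumrN; apply: eq_bigr => i _ /=.
by rewrite parity_mapE (cm_parityV C_model) tensNr.
Qed.

Lemma diag_grouplike k c : signed_grouplike act cV alpha pi gamma k c ->
  Delta k = jH (pi k) ⊗ gamma k.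
Proof. by case=> gl _ _ _ _; rewrite /diag_map /= gl.1 tmapE. Qed.

Lemma diag_primitive k : spin_primitive act cV alpha pi gamma k ->
  Delta k = jH (pi k) ⊗ 1 + 1 ⊗ gamma k.
Proof. by case=> px _ _ _; rewrite /diag_map /= px raddfD /= !tmapE /= !rmorph1. Qed.

Lemma gen_sqr k c : gen k c -> c * c = 1.
Proof. by case=> [[_ _ [->|->] _ _]|[-> _]]; rewrite ?mulr1 // mulrNN mulr1. Qed.

Lemma parity_diag k c : gen k c -> talpha (Delta k) = c *: Delta k.
Proof.
case=> [kg|[-> kp]].
  by rewrite (diag_grouplike kg) parity_mapE; have [_ _ _ -> _] := kg; rewrite tensZr.
rewrite (diag_primitive kp) raddfD /= !parity_mapE rmorph1 scale1r.
by have [_ _ -> _] := kp.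
Qed.

(** D is the image of the Casimir tensor, which is H-invariant; the sign arises in the Clifford
    factor. *)
Lemma diag_dirac k c : gen k c -> Delta k * D = c *: (D * Delta k).
Proof.
case=> [kg|[-> kp]].
  rewrite (diag_grouplike kg); have [_ pg _ _ gv] := kg.
  rewrite /D -(frame_casimir_grouplike fr tens_frame_bilinear pg).
  rewrite (frame_casimir_grouplike fr tens_frame_bilinear pg) mulr_sumr.
  under eq_bigr => i _ do rewrite tensM A_compat.1 // gv tensZr -tensM.
  rewrite -scaler_sumr -mulr_suml.
  by rewrite (frame_casimir_grouplike fr tens_frame_bilinear pg).
rewrite (diag_primitive kp) scale1r; have [_ px _ gv] := kp.
rewrite /D mulrDl mulrDr !mulr_sumr !mulr_suml.
under eq_bigr => i _ do rewrite tensM mul1r A_compat.2 // tensDl.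
under [X in _ + X]eq_bigr => i _ do rewrite tensM mul1r gv tensDr.
rewrite !big_split /= (frame_casimir_primitive fr tens_frame_bilinear px).
rewrite addrACA [- _ + _]addrC subrr add0r.
by congr (_ + _); apply: eq_bigr => i _; rewrite tensM mulr1.
Qed.

Lemma dirac_diag k : D * Delta k = talpha (Delta k) * D.
Proof.
apply: (pin (P := fun k => D * Delta k = talpha (Delta k) * D)) => [|x y hx hy|{}k c kc].
- split=> [|a x y hx hy]; first by rewrite !raddf0 mul0r mulr0.
  by rewrite !linearP /= mulrDr mulrDl -scalerAr -scalerAl hx hy.
- by rewrite rmorphM mulrA hx -mulrA hy mulrA rmorphM.
- by rewrite (parity_diag kc) -scalerAl (diag_dirac kc) scalerA (gen_sqr kc) scale1r.
Qed.

Definition dirac_d (x : T) : T := D * x - talpha x * D.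
Fact dirac_d_linear : linear dirac_d.
Proof.
move=> a x y; rewrite /dirac_d mulrDr -scalerAr linearP mulrDl -scalerAl.
by rewrite opprD addrACA -scalerBr.
Qed.
HB.instance Definition _ := GRing.isLinear.Build F T T *:%R dirac_d dirac_d_linear.
Local Notation d := dirac_d.

Lemma dirac_d_diag k : d (Delta k) = 0.
Proof. by rewrite /d dirac_diag subrr. Qed.

Lemma dirac_dMr x k : d (x * Delta k) = d x * Delta k.
Proof. by rewrite /d rmorphM -mulrA -dirac_diag mulrBl !mulrA. Qed.

Lemma dirac_d_parity x : d (talpha x) = - talpha (d x).
Proof.
rewrite /d raddfB /= !rmorphM /= parity_dirac parity_mapK mulNr mulrN opprB.
by rewrite opprK addrC.
Qed.

Lemma dirac_d2 x : d (d x) = D * D * x - x * (D * D).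
Proof.
rewrite {1}/d; have -> : talpha (d x) = - d (talpha x) by rewrite dirac_d_parity opprK.
rewrite mulNr opprK /d parity_mapK mulrBr mulrBl !mulrA.
by rewrite addrA subrK.
Qed.

(** The exponent [b] records how signs enter and is independent of the parity of [x] under
    [parity_map], so invariants need not be homogeneous. *)
Definition invariant (b : bool) (x : T) : Prop :=
  forall k c, gen k c -> Delta k * x = c ^+ b *: (x * Delta k).

Lemma invariant_lin b : lin_closed (invariant b).
Proof.
split=> [k c _|a x y ix iy k c kc]; first by rewrite mulr0 mul0r scaler0.
rewrite mulrDr mulrDl -scalerAr -scalerAl (ix k c kc) (iy k c kc).
by rewrite scalerDr !scalerA mulrC.
Qed.

Lemma invariant_d b x : invariant b x -> invariant (~~ b) (d x).
Proof.
move=> ix k c kc; have ax : Delta k * talpha x = c ^+ b *: (talpha x * Delta k).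
  have := congr1 talpha (ix k c kc); rewrite linearZ !rmorphM /= (parity_diag kc).
  rewrite -scalerAl -scalerAr scalerA [_ * c]mulrC -scalerA.
  move/(congr1 ( *:%R c)); rewrite !scalerA mulrA (gen_sqr kc).
  by rewrite !mul1r scale1r.
have cb : c * c ^+ b = c ^+ (~~ b).
  by case: b {ix ax}; rewrite ?expr1 ?expr0 ?mulr1 // (gen_sqr kc).
rewrite /d mulrBr mulrBl !mulrA (diag_dirac kc) ax -!scalerAl -!mulrA (ix k c kc).
by rewrite (diag_dirac kc) -!scalerAr scalerBr !scalerA cb mulrC cb.
Qed.

Lemma invariant_comm x : invariant false x ->
  forall k, Delta k * x = x * Delta k.
Proof.
move=> ix; apply: pin => [|k l kx lx|k c kc]; last by rewrite (ix k c kc) scale1r.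
  split=> [|a k l kx lx]; first by rewrite raddf0 mul0r mulr0.
  by rewrite linearP mulrDl mulrDr -scalerAl -scalerAr kx lx.
by rewrite rmorphM -mulrA lx mulrA kx -mulrA.
Qed.

Lemma invariant_parity b x : invariant b x -> invariant b (talpha x).
Proof.
move=> ix k c kc; have := congr1 talpha (ix k c kc).
rewrite linearZ !rmorphM /= (parity_diag kc) -scalerAl -scalerAr scalerA.
rewrite [_ * c]mulrC -scalerA => /(congr1 ( *:%R c)).
by rewrite !scalerA mulrA (gen_sqr kc) !mul1r scale1r.
Qed.

Lemma parity_diag_range k : exists k', talpha (Delta k) = Delta k'.
Proof.
move: k; apply: pin => [|k l [k' kE] [l' lE]|k c kc].
- split=> [|a k l [k' kE] [l' lE]]; first by exists 0; rewrite !raddf0.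
  by exists (a *: k' + l'); rewrite !linearP /= kE lE.
- by exists (k' * l'); rewrite !rmorphM /= kE lE.
- by exists (c *: k); rewrite (parity_diag kc) linearZ.
Qed.
End DiracOperator.

(** * The Dirac operator on symbols as a Koszul differential *)

Section GradedDirac.
Variables (F : fieldType) (F_char0 : [pchar F] =i pred0).
Variables (H : hopfAlg F) (H_cocomm : cocommutative H) (H_pointed : pointed H).
Variables (Ht : hopfAlg F) (V : lmodType F) (act : H -> V -> V).
Variables (B : V -> V -> F) (n : nat) (e e' : 'I_n -> V).
Hypothesis fr : orthogonal_frame act B e e'.
Variables (C : algType F) (cV : {linear V -> C}) (alpha : {lrmorphism C -> C}).
Hypothesis C_model : clifford_model B cV alpha.
Variables (pi : {lrmorphism Ht -> H}) (gamma : {lrmorphism Ht -> C}).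
Hypothesis pin : pin_model act cV alpha pi gamma.
Hypothesis pi_surj : forall h, exists k, pi k = h.
Variables (S : algType F) (SV : {linear V -> S}) (SH : {lrmorphism H -> S}).
Hypothesis S_smash : is_sym_smash act SV SH.

Local Notation gen := (signed_gen act cV alpha pi gamma).
Local Notation X := (tensor S C).
Local Notation Delta := (diag_map SH pi gamma).
Local Notation rho := (rho fr S_smash).
Local Notation der := (der fr S_smash).
Local Notation degree := (sym_degree SV SH).
Local Notation d := (dirac_d e e' cV alpha SV).
Local Notation invariant := (invariant act cV alpha pi gamma SH).

Definition mulX (v : V) : X -> X := lmul (SV v ⊗ 1).
HB.instance Definition _ v := GRing.Linear.on (mulX v).
Definition derX (w : V) : X -> X := tmap (der w) (@idfun C).
HB.instance Definition _ w := GRing.Linear.on (derX w).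
Definition leftX (v : V) : X -> X := lmul (1 ⊗ cV v).
HB.instance Definition _ v := GRing.Linear.on (leftX v).

(** [rightX] is right Clifford multiplication by v twisted by the coaction. It is arranged so that
    [parity_map x * D] becomes the sum of [mulX (e i) (rightX (e' i) x)], all V-factors of S being
    moved to the left. *)
Fact rightX_bilinear v : is_bilinear (fun (p : S) (c : C) =>
  \sum_i rho v (e i) p ⊗ (alpha c * cV (e' i))).
Proof.
split=> [c a p q|p a c c'] /=; rewrite scaler_sumr -big_split; apply: eq_bigr => i _ /=.
  by rewrite linearP tensDl tensZl.
by rewrite linearP mulrDl -scalerAl tensDr tensZr.
Qed.
Definition rightX (v : V) : X -> X := tlin (rightX_bilinear v).
HB.instance Definition _ v := GRing.Linear.on (rightX v).

Lemma mulXE v p c : mulX v (p ⊗ c) = (SV v * p) ⊗ c.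
Proof. by rewrite /mulX /lmul tensM mul1r. Qed.
Lemma derXE w p c : derX w (p ⊗ c) = der w p ⊗ c.
Proof. exact: tmapE. Qed.
Lemma leftXE v p c : leftX v (p ⊗ c) = p ⊗ (cV v * c).
Proof. by rewrite /leftX /lmul tensM mul1r. Qed.
Lemma rightXE v p c :
  rightX v (p ⊗ c) = \sum_i rho v (e i) p ⊗ (alpha c * cV (e' i)).
Proof. exact: tlinE. Qed.

(** For s = 1 this is creation [eps], for s = -1 annihilation [iota]. Keeping s as a parameter
    yields all their anticommutators at once in [twistXC]. *)
Definition twistX (s : F) (v : V) (x : X) : X := leftX v x + s *: rightX v x.
Fact twistX_linear s v : linear (twistX s v).
Proof.
by move=> a x y; rewrite /twistX !linearP /= scalerDr addrACA.
Qed.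
HB.instance Definition _ s v := GRing.isLinear.Build F X X *:%R (twistX s v) (twistX_linear s v).

Lemma leftX_leftX v w x :
  leftX v (leftX w x) + leftX w (leftX v x) = (2%:R * B v w) *: x.
Proof.
rewrite /leftX /lmul !mulrA -mulrDl !tensM mulr1 -tensDr (cm_rel C_model).
by rewrite tensZr -scalerAl mul1r.
Qed.

Lemma leftX_rightX v w x : leftX v (rightX w x) = - rightX w (leftX v x).
Proof.
elim/tensor_ind: x => [p c|a x y hx hy]; last first.
  by rewrite !linearP /= hx hy.
rewrite leftXE !rightXE raddf_sum -sumrN; apply: eq_bigr => i _ /=.
by rewrite leftXE rmorphM /= (cm_parityV C_model) mulNr mulNr tensNr opprK mulrA.
Qed.

Let rightX2E v w p c : rightX v (rightX w (p ⊗ c))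
  = - \sum_i \sum_j rho v (e j) (rho w (e i) p) ⊗ (c * cV (e' i) * cV (e' j)).
Proof.
rewrite rightXE raddf_sum -sumrN; apply: eq_bigr => i _ /=.
rewrite rightXE -sumrN; apply: eq_bigr => j _.
rewrite rmorphM /= (cm_parityV C_model) (cm_parityK C_model).
by rewrite mulrN mulNr tensNr.
Qed.

(** The Clifford relation contracts the two coaction terms, and [rho_contract] evaluates the
    contraction. The sign, opposite to that of [leftX], comes from [alpha]. *)
Lemma rightX_rightX v w x :
  rightX v (rightX w x) + rightX w (rightX v x) = - ((2%:R * B v w) *: x).
Proof.
elim/tensor_ind: x => [p c|a x y hx hy]; last first.
  by rewrite !linearP /= addrACA -scalerDr hx hy.
rewrite !rightX2E [in X in _ - X]exchange_big -opprD -big_split; congr (- _).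
have coef i j : rho v (e j) (rho w (e i) p) ⊗ (c * cV (e' i) * cV (e' j))
    + rho w (e i) (rho v (e j) p) ⊗ (c * cV (e' j) * cV (e' i))
    = (2%:R *: (B (e' i) (e' j) *: rho v (e j) (rho w (e i) p))) ⊗ c.
  rewrite (rhoC fr S_smash w (e i) v) -tensDr -!mulrA -mulrDr (cm_rel C_model).
  by rewrite -scalerAr mulr1 tensZr -tensZl scalerA.
under eq_bigr => i _.
  rewrite -big_split /=; under eq_bigr => j _ do rewrite coef.
  rewrite -tens_suml -scaler_sumr; over.
rewrite -tens_suml -scaler_sumr tensZl -scalerA; congr (_ *: _).
rewrite (frame_sym fr) -tensZl -(rho_contract fr S_smash); congr (_ ⊗ _).
apply: eq_bigr => i _; rewrite [RHS](rhoC fr S_smash).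
pose f : {linear V -> S} := HB.pack (fun u => rho v u (rho w (e i) p))
  (GRing.isLinear.Build _ _ _ _ _ ((rho_bil fr S_smash _).2 v)).
exact: (frame_contract' fr f (e' i)).
Qed.

Lemma twistXC s t v w x : twistX s v (twistX t w x)
  = (2%:R * (1 - s * t) * B v w) *: x - twistX t w (twistX s v x).
Proof.
have E s' t' v' w' : twistX s' v' (twistX t' w' x)
    = (leftX v' (leftX w' x) + (s' * t') *: rightX v' (rightX w' x))
      + (s' *: rightX v' (leftX w' x) - t' *: rightX w' (leftX v' x)).
  rewrite /twistX (raddfD (leftX v')) (raddfD (rightX v')) /=.
  rewrite (linearZ_LR (leftX v')) (linearZ_LR (rightX v')) /= leftX_rightX.
  rewrite scalerDr scalerA scalerN [LHS]addrACA [RHS]addrACA; congr (_ + _).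
  exact: addrC.
apply/esym/eqP; rewrite subr_eq; apply/eqP; rewrite !E addrACA.
rewrite -[X in _ = _ + (_ + X)]opprB subrr addr0 [t * s]mulrC addrACA -scalerDr.
rewrite leftX_leftX rightX_rightX scalerN scalerA -scalerBl; congr (_ *: _).
by rewrite mulrBr mulr1 mulrBl [s * t * (_ * _)]mulrA [s * t * 2%:R]mulrC.
Qed.

Local Notation eps := (twistX 1).
Local Notation iota := (twistX (-1)).

Lemma epsXC v w x : eps v (eps w x) = - eps w (eps v x).
Proof. by rewrite twistXC mulr1 subrr mulr0 mul0r scale0r sub0r. Qed.
Lemma iotaXC v w x : iota v (iota w x) = - iota w (iota v x).
Proof. by rewrite twistXC mulrNN mulr1 subrr mulr0 mul0r scale0r sub0r. Qed.
Lemma iotaX_epsX v w x : iota v (eps w x) = (4%:R * B v w) *: x - eps w (iota v x).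
Proof. by rewrite twistXC mulr1 opprK -[1 + 1]/2%:R -natrM. Qed.

Lemma mulXC v w x : mulX v (mulX w x) = mulX w (mulX v x).
Proof. by rewrite /mulX /lmul !mulrA !tensM (ss_comm S_smash). Qed.
Lemma derX_mulX v w x : derX v (mulX w x) = B v w *: x + mulX w (derX v x).
Proof.
elim/tensor_ind: x => [p c|a x y hx hy].
  by rewrite mulXE !derXE mulXE derV tensDl tensZl.
by rewrite !linearP /= hx hy scalerDr addrACA.
Qed.
Lemma mulX_twistX s v w x : mulX v (twistX s w x) = twistX s w (mulX v x).
Proof.
rewrite /twistX (raddfD (mulX v)) /= (linearZ_LR (mulX v)) /=; congr (_ + _ *: _).
  by rewrite /mulX /leftX /lmul !mulrA !tensM !mul1r !mulr1.
elim/tensor_ind: x => [p c|a x y hx hy]; last by rewrite !linearP /= hx hy.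
rewrite rightXE mulXE rightXE raddf_sum; apply: eq_bigr => i _ /=.
by rewrite mulXE rhoV.
Qed.
Lemma derX_twistX s v w x : derX v (twistX s w x) = twistX s w (derX v x).
Proof.
rewrite /twistX (raddfD (derX v)) /= (linearZ_LR (derX v)) /=; congr (_ + _ *: _).
  elim/tensor_ind: x => [p c|a x y hx hy]; last by rewrite !linearP /= hx hy.
  by rewrite leftXE !derXE leftXE.
elim/tensor_ind: x => [p c|a x y hx hy]; last by rewrite !linearP /= hx hy.
rewrite rightXE derXE rightXE raddf_sum; apply: eq_bigr => i _ /=.
by rewrite derXE der_rho.
Qed.

Fact mulX_lin x : linear (mulX^~ x).
Proof. by move=> a v w; rewrite /mulX /lmul linearP tensDl tensZl mulrDl scalerAl. Qed.
Fact derX_lin x : linear (derX^~ x).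
Proof.
move=> a v w; elim/tensor_ind: x => [p c|b x y hx hy].
  by rewrite !derXE der_linear tensDl tensZl.
rewrite !linearP /= hx hy !scalerDr !scalerA [b * a]mulrC.
exact: addrACA.
Qed.
Fact twistX_lin s x : linear (fun v => twistX s v x).
Proof.
move=> a v w; elim/tensor_ind: x => [p c|b x y hx hy]; last first.
  rewrite !linearP /= hx hy !scalerDr !scalerA [b * a]mulrC.
  exact: addrACA.
rewrite /twistX !leftXE linearP mulrDl -scalerAl tensDr tensZr scalerDr addrACA.
congr (_ + _); rewrite scalerA mulrC -scalerA -scalerDr; congr (_ *: _).
rewrite !rightXE scaler_sumr -big_split; apply: eq_bigr => i _ /=.
by rewrite (rho_bil fr S_smash _).1 tensDl tensZl.
Qed.

Let mulL v : {linear X -> X} := mulX v.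
Let derL v : {linear X -> X} := derX v.
Let epsL v : {linear X -> X} := eps v.
Let iotaL v : {linear X -> X} := iota v.

Definition graded_s x := \sum_i eps (e i) (derX (e' i) x).
Definition graded_num x := \sum_i eps (e i) (iota (e' i) x).

Lemma graded_dE x : d x = \sum_i mulX (e i) (iota (e' i) x).
Proof.
have mulr_D p c : (p ⊗ c) * dirac_elt e e' cV SV
    = \sum_i mulX (e i) (rightX (e' i) (p ⊗ alpha c)).
  rewrite /dirac_elt mulr_sumr.
  under eq_bigr => i _ do rewrite tensM (mulr_symV fr S_smash) tens_suml.
  rewrite exchange_big; apply: eq_bigr => j _ /=.
  rewrite rightXE raddf_sum; apply: eq_bigr => i _ /=.
  by rewrite mulXE (cm_parityK C_model).
rewrite /dirac_d; elim/tensor_ind: x => [p c|a x y hx hy].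
  rewrite parity_mapE mulr_D /dirac_elt mulr_suml -sumrB; apply: eq_bigr => i _.
  rewrite (cm_parityK C_model) /twistX scaleN1r raddfB /=; congr (_ - _).
  by rewrite leftXE mulXE tensM.
rewrite linearP /= mulrDr mulrDl -scalerAr -scalerAl opprD addrACA -scalerBr hx hy.
rewrite scaler_sumr -big_split; apply: eq_bigr => i _ /=.
by rewrite !linearP.
Qed.

Lemma graded_d2 x : d (d x) = 0.
Proof.
rewrite !graded_dE.
exact: (@koszul_d2 _ F_char0 X V n e e' mulL iotaL mulXC (mulX_twistX (-1)) iotaXC).
Qed.

Lemma graded_homotopy x : d (graded_s x) + graded_s (d x)
  = 4%:R *: \sum_i mulX (e i) (derX (e' i) x) + graded_num x.
Proof.
rewrite !graded_dE.
exact: (@koszul_homotopy _ X H V act B n e e' fr mulL derL epsL iotaL mulX_lin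
  (twistX_lin 1) derX_mulX (mulX_twistX 1) (derX_twistX (-1)) iotaX_epsX).
Qed.

(** The family [O] transforms under Delta like V, up to a power of the determinant sign. Contracting
    two such families over dual bases gives an operator that commutes with Delta up to sign
    ([equivariant_sum]). *)
Definition equivariant (b : bool) (O : V -> X -> X) : Prop :=
  (forall k c v x, signed_grouplike act cV alpha pi gamma k c ->
     Delta k * O v x = c ^+ b *: O (act (pi k) v) (Delta k * x)) /\
  (forall k v x, spin_primitive act cV alpha pi gamma k ->
     Delta k * O v x = O (act (pi k) v) x + O v (Delta k * x)).

Lemma derX_equivariant : equivariant false derX.
Proof.
split=> [k c v x kg|k v x kp].
  have [_ pg _ _ _] := kg; rewrite (diag_grouplike SH kg) scale1r.
  elim/tensor_ind: x => [p c0|a x y hx hy]; last first.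
    by rewrite linearP /= !mulrDr -!scalerAr hx hy linearP.
  by rewrite derXE !tensM derXE der_grouplike.
have [_ px _ _] := kp; rewrite (diag_primitive SH kp).
elim/tensor_ind: x => [p c0|a x y hx hy]; last first.
  rewrite linearP /= !mulrDr -!scalerAr hx hy !linearP /= scalerDr; exact: addrACA.
rewrite derXE !mulrDl !tensM !mul1r raddfD /= !derXE der_primitive // tensBl.
by rewrite [RHS]addrA [X in _ = X + _]addrC subrK.
Qed.

Lemma leftX_equivariant : equivariant true leftX.
Proof.
split=> [k c v x kg|k v x kp].
  have [_ pg _ _ gv] := kg; rewrite (diag_grouplike SH kg) /leftX /lmul !mulrA !tensM.
  by rewrite mulr1 gv tensZr scalerAl mul1r.
have [_ px _ gv] := kp; rewrite (diag_primitive SH kp) /leftX /lmul !mulrA -mulrDl.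
by congr (_ * _); rewrite mulrDl mulrDr !tensM !mulr1 !mul1r gv tensDr addrCA.
Qed.

Lemma rightX_equivariant : equivariant true rightX.
Proof.
split=> [k c v x kg|k v x kp].
  have [_ pg _ ag gv] := kg; rewrite (diag_grouplike SH kg) expr1.
  elim/tensor_ind: x => [p c0|a x y hx hy]; last first.
    rewrite linearP !mulrDr -!scalerAr hx hy linearP /= scalerDr !scalerA.
    by rewrite [c * a]mulrC.
  rewrite rightXE tensM rightXE mulr_sumr scaler_sumr; apply: eq_bigr => i _.
  rewrite rho_grouplike // tensM rmorphM /= ag -!scalerAl tensZr scalerA.
  by rewrite (gen_sqr (or_introl kg)) scale1r mulrA.
have [_ px ag gv] := kp; rewrite (diag_primitive SH kp).
elim/tensor_ind: x => [p c0|a x y hx hy]; last first.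
  rewrite linearP !mulrDr -!scalerAr hx hy !linearP /= scalerDr; exact: addrACA.
rewrite rightXE !mulrDl !tensM !mul1r raddfD /= !rightXE mulr_sumr [in X in _ + X = _]mulr_sumr.
rewrite -!big_split; apply: eq_bigr => i _ /=.
rewrite !tensM !mul1r rho_primitive // tensBl rmorphM /= ag mulrA.
by rewrite [RHS]addrA [X in _ = X + _]addrC subrK.
Qed.

Lemma twistX_equivariant s : equivariant true (twistX s).
Proof.
have [lg lp] := leftX_equivariant; have [rg rp] := rightX_equivariant.
split=> [k c v x kg|k v x kp]; rewrite /twistX mulrDr -scalerAr.
  by rewrite (lg k c) // (rg k c) // scalerDr !scalerA [s * _]mulrC.
by rewrite lp // rp // scalerDr addrACA.
Qed.

Lemma equivariant_sum b1 b2 (O1 O2 : V -> {linear X -> X}) :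
  (forall x, linear (O1^~ x)) -> (forall x, linear (O2^~ x)) ->
  equivariant b1 O1 -> equivariant b2 O2 ->
  forall k c x, gen k c -> Delta k * (\sum_i O1 (e i) (O2 (e' i) x))
    = (c ^+ b1 * c ^+ b2) *: \sum_i O1 (e i) (O2 (e' i) (Delta k * x)).
Proof.
move=> lin1 lin2 [g1 p1] [g2 p2] k c x kc.
have bil y : is_bilinear (fun v w => O1 v (O2 w y)).
  split=> [w a u v|v a u w] /=; first exact: lin1.
  by rewrite lin2 linearP.
rewrite mulr_sumr; case: kc => [kg|[-> kp]].
  have [_ pg _ _ _] := kg; rewrite -(frame_casimir_grouplike fr (bil _) pg) scaler_sumr.
  apply: eq_bigr => i _.
  by rewrite (g1 k c) // (g2 k c) // (linearZ_LR (O1 _)) scalerA.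
have [_ px _ _] := kp; rewrite !expr1n mulr1 scale1r.
under eq_bigr => i _ do rewrite p1 // p2 // (raddfD (O1 _)) /=.
rewrite !big_split /= (frame_casimir_primitive fr (bil _) px).
by rewrite addrA addNr add0r.
Qed.

Lemma graded_s_equivariant k c x : gen k c ->
  Delta k * graded_s x = c *: graded_s (Delta k * x).
Proof.
move=> kc; rewrite (equivariant_sum (O1 := epsL) (O2 := derL) (twistX_lin 1) derX_lin
  (twistX_equivariant 1) derX_equivariant x kc).
by rewrite expr1 mulr1.
Qed.

Lemma graded_num_equivariant k c x : gen k c ->
  Delta k * graded_num x = graded_num (Delta k * x).
Proof.
move=> kc; rewrite (equivariant_sum (O1 := epsL) (O2 := iotaL) (twistX_lin 1)
  (twistX_lin (-1)) (twistX_equivariant 1) (twistX_equivariant (-1)) x kc).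
by rewrite !expr1 (gen_sqr kc) scale1r.
Qed.

Lemma right_linear_ind (O : {linear X -> X}) :
  (forall k c x, gen k c -> O (x * Delta k) = O x * Delta k) ->
  forall k x, O (x * Delta k) = O x * Delta k.
Proof.
move=> Ogen; apply: (pin (P := fun k => forall x, O (x * Delta k) = O x * Delta k))
  => [|k l hk hl x|k c kc x]; last exact: (Ogen k c).
  split=> [x|a k l hk hl x]; first by rewrite raddf0 !mulr0 raddf0.
  by rewrite linearP /= !mulrDr -!scalerAr linearP /= hk hl.
by rewrite rmorphM !mulrA hl hk.
Qed.

Lemma derX_mulr w k x : derX w (x * Delta k) = derX w x * Delta k.
Proof.
have E x' h c0 : derX w (x' * (SH h ⊗ c0)) = derX w x' * (SH h ⊗ c0).
  elim/tensor_ind: x' => [p c'|a y z hy hz].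
    by rewrite derXE !tensM derXE (der_mulH F_char0 H_cocomm H_pointed).
  by rewrite mulrDl -scalerAl !linearP /= hy hz mulrDl -scalerAl.
move: k x; apply: (right_linear_ind (O := derL w)) => k c x kc.
change (derX w (x * Delta k) = derX w x * Delta k); case: kc => [kg|[_ kp]].
  by rewrite (diag_grouplike SH kg) E.
by rewrite (diag_primitive SH kp) -!(rmorph1 SH) !mulrDr raddfD /= !E.
Qed.

(** Multiplying by Delta(k) on the right moves both legs of the Casimir tensor inside [rightX], and
    the invariance of that tensor undoes the change. *)
Lemma rightX_mulr v k x : rightX v (x * Delta k) = rightX v x * Delta k.
Proof.
have bil p c' y : is_bilinear (fun u t => (rho v u p ⊗ (alpha c' * cV t)) * y : X).
  split=> [t a u u'|u a t t'] /=; last first.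
    by rewrite linearP mulrDr -scalerAr tensDr tensZr mulrDl scalerAl.
  by rewrite (rho_bil fr S_smash _).2 tensDl tensZl mulrDl scalerAl.
pose O : {linear X -> X} := rightX v.
move: k x; apply: (right_linear_ind (O := O)) => k c x kc.
change (rightX v (x * Delta k) = rightX v x * Delta k).
elim/tensor_ind: x => [p c'|a x y hx hy]; last first.
  by rewrite mulrDl -scalerAl !linearP /= hx hy mulrDl -scalerAl.
rewrite rightXE mulr_suml; case: kc => [kg|[_ kp]].
  have [_ pg _ ag gv] := kg; rewrite (diag_grouplike SH kg) tensM rightXE.
  rewrite -(frame_casimir_grouplike fr (bil p c' _) pg); apply: eq_bigr => i _.
  rewrite rho_grouplike_r // rmorphM /= ag -mulrA -scalerAl gv scalerA.
  by rewrite (gen_sqr (or_introl kg)) scale1r mulrA tensM.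
have [_ px ag gv] := kp; rewrite (diag_primitive SH kp) mulrDr !tensM !mulr1 raddfD /=.
rewrite !rightXE -big_split /=.
under eq_bigr => i _ do rewrite rho_primitive_r // tensDl rmorphM /= ag -mulrA gv mulrDr
  mulrA tensDr.
rewrite !big_split /= addrACA.
have -> : \sum_i rho v (act (pi k) (e i)) p ⊗ (alpha c' * cV (e' i))
    + \sum_i rho v (e i) p ⊗ (alpha c' * cV (act (pi k) (e' i))) = 0.
  have := frame_casimir_primitive fr (bil p c' 1) px.
  under eq_bigr do rewrite mulr1.
  under [in RHS]eq_bigr do rewrite mulr1.
  by move->; rewrite addNr.
rewrite add0r -big_split; apply: eq_bigr => i _ /=.
by rewrite mulrDr !tensM !mulr1.
Qed.

Lemma twistX_mulr s v k x : twistX s v (x * Delta k) = twistX s v x * Delta k.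
Proof. by rewrite /twistX rightX_mulr mulrDl -scalerAl /leftX /lmul mulrA. Qed.

Lemma graded_s_mulr k x : graded_s (x * Delta k) = graded_s x * Delta k.
Proof.
by rewrite /graded_s mulr_suml; apply: eq_bigr => i _; rewrite derX_mulr twistX_mulr.
Qed.

Lemma graded_num_mulr k x : graded_num (x * Delta k) = graded_num x * Delta k.
Proof. by rewrite /graded_num mulr_suml; apply: eq_bigr => i _; rewrite !twistX_mulr. Qed.

Definition degreeX j : X -> Prop := span (fun x => exists p c, degree j p /\ x = p ⊗ c).

Lemma degreeX_tens j p c : degree j p -> degreeX j (p ⊗ c).
Proof. by move=> jp; apply: span_gen; exists p, c. Qed.

Lemma degreeX_ind j (P : X -> Prop) : lin_closed P ->
  (forall p c, degree j p -> P (p ⊗ c)) -> forall x, degreeX j x -> P x.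
Proof. by move=> Plin Pt; apply: span_sub => // _ [p [c [jp ->]]]; exact: Pt. Qed.

Lemma degreeX_map i j (O : {linear X -> X}) :
  (forall p c, degree i p -> degreeX j (O (p ⊗ c))) ->
  forall x, degreeX i x -> degreeX j (O x).
Proof.
move=> Oj; apply: degreeX_ind => //.
exact: (lin_closed_preim O (lin_closed_span _)).
Qed.

Lemma degreeX_mul j v x : degreeX j x -> degreeX j.+1 (mulX v x).
Proof.
move: x; apply: (degreeX_map (O := mulL v)) => p c jp; rewrite /mulL /= mulXE.
exact/degreeX_tens/sym_degreeV.
Qed.
Lemma degreeX_der j w x : degreeX j.+1 x -> degreeX j (derX w x).
Proof.
move: x; apply: (degreeX_map (O := derL w)) => p c jp; rewrite /derL /= derXE.
exact/degreeX_tens/sym_degree_der.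
Qed.
Lemma degreeX_der0 w x : degreeX 0 x -> derX w x = 0.
Proof.
move: x; apply: degreeX_ind => [|_ c [h ->]].
  by split=> [|a x y hx hy]; rewrite ?raddf0 // linearP /= hx hy scaler0 addr0.
by rewrite derXE der_SH // tens0l.
Qed.
Lemma degreeX_twist j s v x : degreeX j x -> degreeX j (twistX s v x).
Proof.
move: x; apply: (degreeX_map (O := twistX s v)) => p c jp.
rewrite /= /twistX leftXE rightXE.
apply: (lin_closedD (lin_closed_span _)); first exact: degreeX_tens.
apply/(lin_closedZ _ (lin_closed_span _))/(lin_closed_sum _ (lin_closed_span _)) => i _.
exact/degreeX_tens/sym_degree_rho.
Qed.
Lemma degreeX_s j x : degreeX j.+1 x -> degreeX j (graded_s x).
Proof.
move=> jx; apply: (lin_closed_sum _ (lin_closed_span _)) => i _.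
exact/degreeX_twist/degreeX_der.
Qed.
Lemma degreeX_d j x : degreeX j x -> degreeX j.+1 (d x).
Proof.
move=> jx; rewrite graded_dE; apply: (lin_closed_sum _ (lin_closed_span _)) => i _.
exact/degreeX_mul/degreeX_twist.
Qed.

Lemma degreeX_euler j x : degreeX j x ->
  \sum_i mulX (e i) (derX (e' i) x) = j%:R *: x.
Proof.
move: x; apply: degreeX_ind => [|p c jp].
  split=> [|a x y hx hy]; first by rewrite scaler0 big1 // => i _; rewrite !raddf0.
  rewrite scalerDr scalerA mulrC -scalerA -hx -hy scaler_sumr -big_split.
  by apply: eq_bigr => i _ /=; rewrite !linearP.
rewrite -tensZl -(euler F_char0 H_cocomm H_pointed fr S_smash jp) tens_suml; apply: eq_bigr => i _.
by rewrite derXE mulXE.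
Qed.

Fact graded_s_linear : linear graded_s.
Proof.
move=> a x y; rewrite /graded_s scaler_sumr -big_split; apply: eq_bigr => i _ /=.
by rewrite !linearP.
Qed.
HB.instance Definition _ := GRing.isLinear.Build F X X *:%R graded_s graded_s_linear.
Fact graded_num_linear : linear graded_num.
Proof.
move=> a x y; rewrite /graded_num scaler_sumr -big_split; apply: eq_bigr => i _ /=.
by rewrite !linearP.
Qed.
HB.instance Definition _ := GRing.isLinear.Build F X X *:%R graded_num graded_num_linear.

Let idem i : {linear X -> X} := koszul_idem e e' epsL iotaL i.
Let idemK i x : idem i (idem i x) = idem i x.
Proof. exact: (koszul_idemK F_char0 fr iotaXC iotaX_epsX). Qed.
Let idemC i j x : idem i (idem j x) = idem j (idem i x).
Proof. exact: (koszul_idemC fr epsXC iotaXC iotaX_epsX). Qed.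
Let numE x : graded_num x = 4%:R *: \sum_i idem i x.
Proof. exact: (koszul_numE F_char0 e e' epsL iotaL x). Qed.
Let four_neq0 : 4%:R != 0 :> F. Proof. by rewrite ((pcharf0P F).1 F_char0). Qed.

Lemma graded_num_shift_inj j x :
  (0 < j)%N -> 4%:R *: (j%:R *: x) + graded_num x = 0 -> x = 0.
Proof.
move=> j0; rewrite numE -scalerDr => /eqP; rewrite scaler_eq0 (negPf four_neq0) /=.
by move/eqP; exact: (idempotents_shift_inj F_char0 idemK idemC j0).
Qed.

Lemma graded_num_shift_surj j k y : (0 < j)%N -> degreeX k y ->
  exists2 x, degreeX k x & 4%:R *: (j%:R *: x) + graded_num x = y.
Proof.
move=> j0 ky.
have [||x kx xE] := idempotents_shift_surj F_char0 idemK idemC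
    (index_enum 'I_n) (Y := degreeX k) (c := j) (y := 4%:R^-1 *: y) (lin_closed_span _) _ j0.
- move=> i x kx; apply/(lin_closedZ _ (lin_closed_span _)).
  exact/degreeX_twist/degreeX_twist.
- exact/(lin_closedZ _ (lin_closed_span _)).
exists x => //; rewrite numE -scalerDr xE scalerA mulfV ?scale1r //.
Qed.

(** Let L be d s + s d in degree j + 1, which is bijective. With y = L^-1 x, the preimage of x is
    s(y), provided that d y = 0. Since L is injective and commutes with Delta(H~) on both sides, y
    inherits invariance from x. *)
Lemma graded_exact b j x : degreeX j.+1 x -> invariant b x -> d x = 0 ->
  exists y, [/\ degreeX j y, invariant (~~ b) y & d y = x].
Proof.
move=> jx ix dx; have [y jy yE] := graded_num_shift_surj (ltn0Sn j) jx.
have hom i z : degreeX i z ->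
    d (graded_s z) + graded_s (d z) = 4%:R *: (i%:R *: z) + graded_num z.
  by move=> iz; rewrite graded_homotopy (degreeX_euler iz).
have dy : d y = 0.
  (* In degree j + 2 the homotopy is still injective, and it sends d y to d(s(d y)) = d(x - d(s y))
     = 0. *)
  apply: (@graded_num_shift_inj j.+2) => //; rewrite -hom; last exact: degreeX_d.
  rewrite graded_d2 raddf0 addr0.
  have -> : graded_s (d y) = x - d (graded_s y) by rewrite -yE -hom // addrC addKr.
  by rewrite raddfB /= dx graded_d2 subrr.
exists (graded_s y); split; first exact: degreeX_s.
  have iy : invariant b y.
    move=> k c kc; apply/eqP; rewrite -subr_eq0; apply/eqP.
    apply: (@graded_num_shift_inj j.+1) => //.
    rewrite [graded_num _]raddfB /= [graded_num (_ *: _)]linearZ /= -(graded_num_equivariant _ kc) graded_num_mulr.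
    have -> : 4%:R *: (j.+1%:R *: (Delta k * y - c ^+ b *: (y * Delta k)))
        = Delta k * (4%:R *: (j.+1%:R *: y)) - c ^+ b *: ((4%:R *: (j.+1%:R *: y)) * Delta k).
      rewrite !scalerBr -!scalerAr -!scalerAl !scalerA; congr (_ - _ *: _).
      by rewrite mulrC mulrA.
    rewrite addrACA -mulrDr yE -opprD -scalerDr -mulrDl yE (ix k c kc).
    by rewrite subrr.
  move=> k c kc; rewrite (graded_s_equivariant _ kc) (iy k c kc) linearZ /= graded_s_mulr.
  rewrite scalerA; congr (_ *: _).
  by case: (b); rewrite ?expr1 ?expr0 ?mulr1 ?(gen_sqr kc).
by rewrite -yE -hom // dy raddf0 addr0.
Qed.

(** The Clifford factor of Delta(l) can be divided out for l group-like and subtracted for l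
    primitive, so H ⊗ C is reached from C and Delta(H~). *)
Lemma degreeX0_span x : degreeX 0 x ->
  span (fun y => exists c k, y = (1 ⊗ c) * Delta k) x.
Proof.
set U := span _; have Ulin : lin_closed U by exact: lin_closed_span.
suff UH h y : U y -> U ((SH h ⊗ 1) * y).
  move: x; apply: degreeX_ind => // _ c [h ->].
  have -> : SH h ⊗ c = (SH h ⊗ 1) * ((1 ⊗ c) * Delta 1) :> X.
    by rewrite rmorph1 mulr1 tensM mulr1 mul1r.
  by apply: UH; apply: span_gen; exists c, 1.
have [k <-] := pi_surj h; move: y; apply: (pin (P := fun k =>
    forall y, U y -> U ((SH (pi k) ⊗ 1) * y))) => [|l m Ul Um y Uy|l c lc].
- split=> [y _|a l m Ul Um y Uy].
    by rewrite !raddf0 tens0l mul0r; exact: Ulin.1.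
  rewrite !linearP /= tensDl tensZl mulrDl -scalerAl; apply: Ulin.2.
    exact: Ul.
  exact: Um.
- have -> : SH (pi (l * m)) ⊗ 1 = (SH (pi l) ⊗ 1) * (SH (pi m) ⊗ 1) :> X.
    by rewrite tensM mulr1 !rmorphM.
  by rewrite -mulrA; apply/Ul/Um.
- apply: span_sub => [|_ [c0 [m ->]]].
    exact: (lin_closed_preim (lmul (SH (pi l) ⊗ 1 : X)) Ulin).
  have -> : (SH (pi l) ⊗ 1) * ((1 ⊗ c0) * Delta m)
      = (1 ⊗ c0) * ((SH (pi l) ⊗ 1) * Delta m) :> X.
    by rewrite !mulrA !tensM !mulr1 !mul1r.
  case: lc => [lg|[_ lp]].
    have [gl _ _ _ _] := lg; have [gS _] := grouplike_antipode gl.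
    have -> : SH (pi l) ⊗ 1 = (1 ⊗ gamma (antipode Ht l)) * Delta l :> X.
      by rewrite (diag_grouplike SH lg) tensM mul1r -rmorphM gS rmorph1.
    apply: span_gen; exists (c0 * gamma (antipode Ht l)), (l * m).
    by rewrite rmorphM !mulrA tensM mul1r.
  have -> : SH (pi l) ⊗ 1 = Delta l - 1 ⊗ gamma l :> X.
    by rewrite (diag_primitive SH lp) addrK.
  rewrite mulrBl mulrBr; apply: lin_closedB => //; apply: span_gen.
    by exists c0, (l * m); rewrite rmorphM.
  by exists (c0 * gamma l), m; rewrite mulrA tensM mul1r.
Qed.

Let vac := vacuum e e' epsL iotaL.
Let vac_linear : {linear X -> X} := vac.

(** C is a Fock space: left multiplication is ([eps] + [iota])/2 and [iota] kills 1, so every 1 ⊗ c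
    is a combination of creation operators applied to 1. The projection [vac] keeps only the
    constant term. *)
Lemma vacuum_clifford c : exists f : F, vac (1 ⊗ c) = f *: 1.
Proof.
(* [W j] is spanned by products of fewer than j creation operators applied to 1; in particular [W 0]
   is zero. *)
pose W := fix W (j : nat) : X -> Prop := if j is i.+1
  then span (fun x => x = 1 \/ exists v y, W i y /\ x = eps v y) else fun x => x = 0.
have Wlin j : lin_closed (W j).
  case: j => [|j]; last exact: lin_closed_span.
  by split=> // a x y -> ->; rewrite scaler0 addr0.
have WS j x : W j x -> W j.+1 x.
  elim: j x => [_ -> |j IHj]; first exact: span0.
  apply: span_mono => x [->|[v [y [Wy ->]]]]; first by left.
  by right; exists v, y; split=> //; apply: IHj.
have iota1 v : iota v 1 = 0.
  rewrite /twistX -[1]/(1 ⊗ 1) leftXE rightXE scaleN1r rmorph1 mulr1.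
  under eq_bigr => i _ do rewrite (rho1 fr S_smash) mul1r tensZl -tensZr.
  by rewrite -tens_sumr (frame_contract fr cV) subrr.
have Wiota j v x : W j x -> W j (iota v x).
  elim: j x => [_ ->|j IHj]; first exact: raddf0.
  apply: span_sub => [|_ [->|[w [y [Wy ->]]]]].
  - exact: (lin_closed_preim (iotaL v) (Wlin j.+1)).
  - by rewrite iota1; exact: (Wlin j.+1).1.
  - rewrite iotaX_epsX; apply: lin_closedB (Wlin _) _ _.
      by apply: (lin_closedZ _ (Wlin _)); exact: WS.
    by apply: span_gen; right; exists w, (iota v y); split=> //; apply: IHj.
have two_neq0 : 2%:R != 0 :> F by rewrite ((pcharf0P F).1 F_char0).
have leftXW v x : leftX v x = 2%:R^-1 *: (eps v x + iota v x).
  rewrite /twistX scale1r scaleN1r addrACA subrr addr0 -mulr2n -scaler_nat.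
  by rewrite scalerA mulVf // scale1r.
have [j Wc] : exists j, W j (1 ⊗ c).
  elim/(cm_ind C_model): c => [||v c [j Wc]].
  - split=> [|a x y [i Wi] [j Wj]]; first by exists 0; rewrite tens0r.
    have WD k l z : W k z -> W (k + l)%N z.
      move=> Wz; elim: l => [|l IHl]; first by rewrite addn0.
      by rewrite addnS; exact: WS.
    exists (i + j)%N; rewrite tensDr tensZr; apply: (Wlin _).2; first exact: WD.
    by rewrite addnC; exact: WD.
  - by exists 1%N; apply: span_gen; left.
  - exists j.+1; rewrite -[_ ⊗ _]/(1 ⊗ (cV v * c)) -leftXE leftXW.
    apply: (lin_closedZ _ (Wlin _)); apply: (lin_closedD (Wlin _)).
      by apply: span_gen; right; exists v, (1 ⊗ c).
    exact/WS/Wiota.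
have vac1 : vac 1 = 1 by apply: vacuum_id => v; exact: iota1.
case: j Wc => [->|j]; first by exists 0; rewrite scale0r; exact: (raddf0 vac_linear).
elim=> [|x [->|[v [y [_ ->]]]]|a x y _ [f fE] _ [g gE]].
- by exists 0; rewrite scale0r; exact: (raddf0 vac_linear).
- by exists 1; rewrite scale1r.
- exists 0; rewrite scale0r.
  exact: (vacuum_eps F_char0 fr (twistX_lin 1) epsXC iotaX_epsX).
- exists (a * f + g); rewrite scalerDl -scalerA -fE -gE.
  exact: (linearP vac_linear).
Qed.

(** All annihilators kill x, so x is its own vacuum projection. Since [vac] commutes with right
    multiplication by Delta(k), it reduces each (1 ⊗ c) Delta(k) to a multiple of Delta(k). *)
Lemma graded_kernel0 x : degreeX 0 x -> d x = 0 -> exists k, x = Delta k.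
Proof.
(* In degree 0, [derX v] meets only the factor [mulX (e i)] of [d], so applying it to d x = 0
   isolates [iota v x]. *)
move=> x0 dx; have iotax v : iota v x = 0.
  have := congr1 (derX v) dx; rewrite graded_dE raddf0 raddf_sum /= => <-.
  under eq_bigr => i _ do rewrite derX_mulX derX_twistX (degreeX_der0 _ x0) !raddf0 addr0.
  pose f : {linear V -> X} := HB.pack (fun w => iota w x)
    (GRing.isLinear.Build _ _ _ _ _ (twistX_lin (-1) x)).
  exact/esym/(frame_contract fr f).
rewrite -[x](vacuum_id e e' epsL iotax) -/vac.
have := degreeX0_span x0; elim=> [|_ [c [k ->]]|a y z _ [k kE] _ [l lE]].
- by exists 0; rewrite raddf0; exact: (raddf0 vac_linear).
- pose R : {linear X -> X} := rmul (Delta k : X).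
  have Reps v y : R (epsL v y) = epsL v (R y) by exact/esym/twistX_mulr.
  have Riota v y : R (iotaL v y) = iotaL v (R y) by exact/esym/twistX_mulr.
  have <- : R (vac (1 ⊗ c)) = vac ((1 ⊗ c) * Delta k) := vacuum_comm e e' Reps Riota _.
  have [f fE] := vacuum_clifford c; exists (f *: k).
  rewrite fE (linearZ_LR R) [Delta _]linearZ; congr (_ *: _); exact: mul1r.
- exists (a *: k + l); have -> : Delta (a *: k + l) = a *: Delta k + Delta l.
    exact: linearP.
  by rewrite -kE -lE; exact: (linearP vac_linear).
Qed.
End GradedDirac.

(** * The PBW filtration *)

Section Symbol.
Variables (F : fieldType) (A : algType F) (fA : filtration A).

Lemma symbolE n a (fa : fA n a) :
  symbol fA n a = qproj (gr_proper (fA := fA)) (Rees (rees_monomial_subproof fa)).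
Proof.
rewrite /symbol; case: pselect => // fa'; congr (qproj _ _).
by apply: val_inj.
Qed.

Lemma symbol_linear n c a b : fA n a -> fA n b ->
  symbol fA n (c *: a + b) = c *: symbol fA n a + symbol fA n b.
Proof.
move=> fa fb; rewrite (symbolE fa) (symbolE fb) (symbolE (fil_lin c fa fb)) -linearP.
congr (qproj _ _); apply: val_inj => /=; apply/polyP => i.
rewrite coefD coef_polyFZ !coefZ.
by rewrite mulrDl scalerAl.
Qed.

Lemma symbolM m n a b : fA m a -> fA n b ->
  symbol fA (m + n) (a * b) = symbol fA m a * symbol fA n b.
Proof.
move=> fa fb; rewrite (symbolE fa) (symbolE fb) (symbolE (filM fa fb)) -rmorphM.
congr (qproj _ _); apply: val_inj => /=.
rewrite -[RHS]/((a *: 'X^m : {poly A}) * (b *: 'X^n : {poly A})).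
by rewrite -scalerAl -(commr_polyXn _ m) -scalerAl scalerA -exprD addnC.
Qed.

Lemma symbol_eq0 n a : fA n a -> symbol fA n a = 0 <-> fil_pred fA n a.
Proof.
move=> fa; rewrite (symbolE fa); split.
  move/((qprojP (gr_proper (fA := fA))).2 _).1/rees_lower_ideal/(_ n).
  by rewrite /= coefZ coefXn eqxx mulr1.
move=> pa; apply/((qprojP (gr_proper (fA := fA))).2 _).2/ideal_gen => k /=.
rewrite coefZ coefXn; case: eqP => [->|_]; first by rewrite mulr1.
by rewrite mulr0; case: k => //= k; exact: fil0.
Qed.
End Symbol.

(* [rel n a p]: a lies in the n-th filtration step of A, p in S is            *)
(* homogeneous of degree n, and a has symbol p.                               *)
Record pbw_model (F : fieldType) (H : hopfAlg F) (V : lmodType F)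
    (S : algType F) (SV : {linear V -> S}) (SH : {lrmorphism H -> S})
    (A : algType F) (jV : {linear V -> A}) (jH : {lrmorphism H -> A})
    (rel : nat -> A -> S -> Prop) : Prop := {
  pbw_degree : forall n a p, rel n a p -> sym_degree SV SH n p;
  pbw_lin : forall n c a b p q,
    rel n a p -> rel n b q -> rel n (c *: a + b) (c *: p + q);
  pbw_0 : forall n, rel n 0 0;
  pbw_mul : forall m n a b p q, rel m a p -> rel n b q -> rel (m + n)%N (a * b) (p * q);
  pbw_V : forall v, rel 1%N (jV v) (SV v);
  pbw_H : forall h, rel 0%N (jH h) (SH h);
  pbw_weaken : forall n a p, rel n a p -> rel n.+1 a 0;
  pbw_lower : forall n a, rel n.+1 a 0 -> exists q, rel n a q;
  pbw_lower0 : forall a, rel 0%N a 0 -> a = 0;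
  pbw_inj : forall n p, rel n 0 p -> p = 0;
  pbw_total : forall a, exists n p, rel n a p
}.

Section HeckePBW.
Variables (F : fieldType) (F_char0 : [pchar F] =i pred0).
Variables (H : hopfAlg F) (H_cocomm : cocommutative H) (H_pointed : pointed H).
Variables (V : vectType F) (act : H -> V -> V) (act_module : is_module act).
Variable kappa : {linear ext_square V -> H}.
Variables (A : algType F) (qA : {lrmorphism smash act -> A}).
Hypothesis A_hecke : hopf_hecke kappa qA.

Local Notation S := (sym_smash act).
Let SV : {linear V -> S} := sym_smashV act.
Let SH : {lrmorphism H -> S} := sym_smashH act.
Local Notation fA := (hecke_fil qA).
Let S_smash : is_sym_smash act SV SH :=
  sym_smash_is_sym_smash F_char0 H_cocomm H_pointed act_module.

(** The relation pairs a in F_n with the homogeneous p of degree n whose image under the PBW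
    isomorphism is the class of a. Injectivity of [phi] makes the symbol unique; multiplying out
    words shows that it exists. *)
Lemma hecke_pbw : exists rel, @pbw_model F H V S SV SH A (heckeV qA) (heckeH qA) rel.
Proof.
have [phi [phiV phiH phi_bij]] := A_hecke.2.
have phi_inj : injective phi := bij_inj phi_bij.
pose rel n a p := [/\ fA n a, sym_degree SV SH n p & symbol fA n a = phi p].
have fV v : fA 1%N (heckeV qA v).
  by apply: span_gen; exists [:: inl v]; rewrite big_seq1.
have fH h : fA 0%N (heckeH qA h).
  by apply: span_gen; exists [:: inr h]; rewrite big_seq1.
have rel0 n : rel n 0 0.
  split; [exact: fil0|exact: (sym_degree_lin SV SH n).1|].
  rewrite raddf0; apply/symbol_eq0; first exact: fil0.
  by case: n => //= n; exact: (fil0 fA).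
have rel_lin n c a b p q : rel n a p -> rel n b q -> rel n (c *: a + b) (c *: p + q).
  move=> [fa dp ap] [fb dq bq]; split; first exact: fil_lin.
    exact: (sym_degree_lin SV SH n).2.
  by rewrite symbol_linear // ap bq linearP.
have degM m n p q : sym_degree SV SH m p -> sym_degree SV SH n q ->
    sym_degree SV SH (m + n) (p * q).
  move=> dp dq; elim: m p dp => [_ [h ->]|m IHm]; first exact: (sym_degreeH F_char0 H_cocomm H_pointed S_smash).
  apply: span_sub => [|_ [v [p [dp ->]]]].
    exact: (lin_closed_preim (rmul q) (sym_degree_lin SV SH (m + n).+1)).
  by rewrite -mulrA; apply/sym_degreeV/IHm.
have rel_mul m n a b p q : rel m a p -> rel n b q -> rel (m + n)%N (a * b) (p * q).
  move=> [fa dp ap] [fb dq bq]; split; [exact: filM|exact: degM|].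
  by rewrite symbolM // ap bq rmorphM.
have relV v : rel 1%N (heckeV qA v) (SV v).
  split=> //; last by rewrite phiV.
  by rewrite -[SV v]mulr1; apply/sym_degreeV; exists 1; rewrite rmorph1.
have relH h : rel 0%N (heckeH qA h) (SH h).
  by split=> //; [exists h | rewrite phiH].
have weaken n a : fA n a -> rel n.+1 a 0.
  move=> fa; split; [exact: filS|exact: (sym_degree_lin SV SH n.+1).1|].
  by rewrite raddf0; apply/symbol_eq0 => //; exact: filS.
have exists_symbol n a : fA n a -> exists p, rel n a p.
  elim=> [|_ [w [wn ->]]|c {}a b _ [p ap] _ [q bq]]; first by exists 0.
    have [p wp] : exists p, rel (count (fun x : V + H => if x is inl _ then true else false) w)
        (\prod_(x <- w) match x with inl v => heckeV qA v | inr h => heckeH qA h end) p.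
      elim: w {wn} => [|x w [p wp]].
        by exists 1; rewrite big_nil -(rmorph1 (heckeH qA)) -(rmorph1 SH); exact: relH.
      rewrite big_cons /=; case: x => [v|h].
        by exists (SV v * p); exact: (rel_mul 1%N _ _ _ _ _ (relV v) wp).
      by exists (SH h * p); exact: (rel_mul 0%N _ _ _ _ _ (relH h) wp).
    (* A word with fewer than n letters from V lies in a lower filtration step, so its symbol in
       degree n is 0. *)
    move: wn; rewrite leq_eqVlt => /orP[/eqP <-|]; first by exists p.
    move=> wn; exists 0; case: n wn => // n; rewrite ltnS => wn.
    apply: weaken; apply: span_gen; exists w; by split.
  by exists (c *: p + q); exact: rel_lin.
exists rel; split=> //.
- by move=> n a p [].
- by move=> n a p [fa _ _]; exact: weaken.
- move=> n a [fa _]; rewrite raddf0 => /(symbol_eq0 fa) /= fa'.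
  exact: exists_symbol.
- by move=> a [fa _]; rewrite raddf0 => /(symbol_eq0 fa).
- move=> n p [f0 _]; rewrite (_ : symbol _ _ _ = 0); last first.
    by apply/(symbol_eq0 f0); case: n f0 => //= n _; exact: (fil0 fA).
  by rewrite -(raddf0 phi) => /phi_inj.
- move=> a; suff [n /exists_symbol[p ap]] : exists n, fA n a by exists n, p.
  have mono m n b : (m <= n)%N -> fA m b -> fA n b.
    by move=> /subnK <-; elim: (n - m)%N => // k IHk fb; exact/filS/IHk.
  have [x <-] := A_hecke.1.1 a; have [y <-] := (qprojP (@smash_proper F H V act)).1 x.
  elim/free_alg_ind: y => [||x' y [n fy]].
  + split=> [|c y z [m fy] [n fz]]; first by exists 0; rewrite !raddf0; exact: fil0.
    exists (maxn m n); rewrite !linearP; apply: fil_lin.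
      by apply: mono fy; exact: leq_maxl.
    by apply: mono fz; exact: leq_maxr.
  + by exists 0; rewrite !rmorph1; exact: fil_1.
  + case: x' => [v|h]; rewrite !rmorphM.
      by exists (1 + n)%N; exact: (filM (fV v) fy).
    by exists (0 + n)%N; exact: (filM (fH h) fy).
Qed.
End HeckePBW.

Section TensorSliceMul.
Variables (F : fieldType) (A C : algType F).
Implicit Types (x : tensor A C) (f : {linear C -> F^o}).

Lemma slicer_mull f a c x :
  slicer f ((a ⊗ c) * x) = a * slicer (f \o lmul c) x.
Proof.
elim/tensor_ind: x => [a' c'|k x y hx hy].
  by rewrite tensM !slicerE -scalerAr.
by rewrite mulrDr -scalerAr !linearP /= hx hy mulrDr -scalerAr.
Qed.

Lemma slicer_mulr f a c x :
  slicer f (x * (a ⊗ c)) = slicer (f \o rmul c) x * a.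
Proof.
elim/tensor_ind: x => [a' c'|k x y hx hy].
  by rewrite tensM !slicerE -scalerAl.
by rewrite mulrDl -scalerAl !linearP /= hx hy mulrDl -scalerAl.
Qed.

Lemma slicer_tmap (g : {linear C -> C}) f x :
  slicer f (tmap (@idfun A) g x) = slicer (f \o g) x.
Proof.
by apply: (tensor_eq (f := slicer f \o tmap idfun g)) => a c /=; rewrite tmapE !slicerE.
Qed.
End TensorSliceMul.

(** * Symmetrization as a section of the symbol map *)

Section SymbolSection.
Variables (F : fieldType) (F_char0 : [pchar F] =i pred0).
Variables (H : hopfAlg F) (H_cocomm : cocommutative H) (H_pointed : pointed H).
Variables (V : lmodType F) (act : H -> V -> V).
Variables (B : V -> V -> F) (n : nat) (e e' : 'I_n -> V).
Hypothesis fr : orthogonal_frame act B e e'.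
Variables (S : algType F) (SV : {linear V -> S}) (SH : {lrmorphism H -> S}).
Hypothesis S_smash : is_sym_smash act SV SH.
Variables (A : algType F) (jV : {linear V -> A}) (jH : {lrmorphism H -> A}).
Hypothesis A_compat : smash_compat act jV jH.
Variable rel : nat -> A -> S -> Prop.
Hypothesis pbw : pbw_model SV SH jV jH rel.

Local Notation der := (der fr S_smash).
Local Notation degree := (sym_degree SV SH).

Lemma pbwZ m c a p : rel m a p -> rel m (c *: a) (c *: p).
Proof.
move=> ap; rewrite -[_ *: a]addr0 -[_ *: p]addr0.
by apply: (pbw_lin pbw) => //; exact: (pbw_0 pbw).
Qed.
Lemma pbw_sum m r (a : 'I_r -> A) (p : 'I_r -> S) :
  (forall i, rel m (a i) (p i)) -> rel m (\sum_i a i) (\sum_i p i).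
Proof.
move=> ap; elim/big_rec2: _ => [|i x y _ xy]; first exact: (pbw_0 pbw).
by rewrite -[a i]scale1r -[p i]scale1r; exact: (pbw_lin pbw).
Qed.

Fact projH_exists : exists f : {lrmorphism S -> H},
  (forall v, f (SV v) = 0) /\ (forall h, f (SH h) = h).
Proof.
apply: (ss_univ S_smash (jV := \0) (jH := idfun)) => [|v w]; last by rewrite /= mul0r.
by split=> *; rewrite /= ?mul0r ?mulr0 ?addr0.
Qed.
Definition projH : {lrmorphism S -> H} := projT1 (cid projH_exists).
Lemma projHK h : projH (SH h) = h.
Proof. by rewrite /projH; case: cid => f []. Qed.

(* A section of the symbol map in degree k that is H-linear on both sides.    *)
Fixpoint theta k (p : S) : A :=
  if k is k'.+1 then k%:R^-1 *: \sum_i jV (e i) * theta k' (der (e' i) p)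
  else jH (projH p).

Fact theta_linear k : linear (theta k).
Proof.
elim: k => [|k IHk] a p q; first by rewrite /= !linearP.
rewrite [theta _ _]/= scalerA mulrC -scalerA -scalerDr; congr (_ *: _).
rewrite scaler_sumr -big_split; apply: eq_bigr => i _ /=.
by rewrite linearP IHk mulrDr -scalerAr.
Qed.
HB.instance Definition _ k := GRing.isLinear.Build F S A *:%R (theta k) (theta_linear k).

Lemma theta_mulr k p h : theta k (p * SH h) = theta k p * jH h.
Proof.
elim: k p => [|k IHk] p; first by rewrite /= rmorphM /= projHK rmorphM.
rewrite /= -scalerAl mulr_suml; congr (_ *: _); apply: eq_bigr => i _.
by rewrite (der_mulH F_char0 H_cocomm H_pointed) IHk mulrA.
Qed.

(** Each recursive step contracts [jV] with [der] over dual bases; both are H-equivariant and the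
    Casimir tensor is invariant. *)
Lemma theta_mull k h p : theta k (SH h * p) = jH h * theta k p.
Proof.
elim: k p h => [|k IHk] p h; first by rewrite /= rmorphM /= projHK rmorphM.
have bil q : is_bilinear (fun v w => jV v * theta k (der w q)).
  split=> [w a u v|u a v w] /=; first by rewrite linearP mulrDl scalerAl.
  by rewrite der_linear linearP /= mulrDr scalerAr.
move: p; apply: (hopf_ind F_char0 H_cocomm H_pointed (P := fun h =>
  forall p, theta k.+1 (SH h * p) = jH h * theta k.+1 p)) => [|x y hx hy p|g gl p|x px p].
- split=> [p|a x y hx hy p]; first by rewrite !raddf0 !mul0r raddf0.
  rewrite linearP mulrDl -scalerAl theta_linear hx hy.
  by rewrite linearP mulrDl -scalerAl.
- by rewrite !rmorphM -!mulrA hx hy.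
- rewrite /= -scalerAr mulr_sumr; congr (_ *: _).
  rewrite -(frame_casimir_grouplike fr (bil _) gl); apply: eq_bigr => i _.
  by rewrite der_grouplike // IHk !mulrA A_compat.1.
- rewrite /= -scalerAr mulr_sumr; congr (_ *: _).
  under eq_bigr => i _ do rewrite der_primitive // raddfB /= mulrBr IHk.
  rewrite sumrB -(frame_casimir_primitive fr (bil _) px) -big_split.
  apply: eq_bigr => i _ /=.
  by rewrite !mulrA A_compat.2 // mulrDl addrC.
Qed.

Lemma theta_rel k p : degree k p -> rel k (theta k p) p.
Proof.
elim: k p => [_ [h ->]|k IHk p kp]; first by rewrite /= projHK; exact: (pbw_H pbw).
have -> : rel k.+1 (theta k.+1 p) p
    = rel k.+1 (theta k.+1 p) (k.+1%:R^-1 *: \sum_i SV (e i) * der (e' i) p).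
  rewrite (euler F_char0 H_cocomm H_pointed fr S_smash kp) scalerA mulVf ?scale1r //.
  by rewrite ((pcharf0P F).1 F_char0).
apply: pbwZ; apply: pbw_sum => i; apply: (pbw_mul pbw (m := 1) (n := k)); first exact: (pbw_V pbw).
by apply: IHk; exact: (sym_degree_der F_char0 H_cocomm H_pointed).
Qed.
End SymbolSection.

(** * Exactness *)

Section DiracExactness.
Variables (F : fieldType) (F_char0 : [pchar F] =i pred0).
Variables (H : hopfAlg F) (H_cocomm : cocommutative H) (H_pointed : pointed H).
Variables (Ht : hopfAlg F) (V : lmodType F) (act : H -> V -> V).
Variables (B : V -> V -> F) (n : nat) (e e' : 'I_n -> V).
Hypothesis fr : orthogonal_frame act B e e'.
Variables (C : algType F) (cV : {linear V -> C}) (alpha : {lrmorphism C -> C}).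
Hypothesis C_model : clifford_model B cV alpha.
Variables (pi : {lrmorphism Ht -> H}) (gamma : {lrmorphism Ht -> C}).
Hypothesis pin : pin_model act cV alpha pi gamma.
Hypothesis pi_surj : forall h, exists k, pi k = h.
Variables (S : algType F) (SV : {linear V -> S}) (SH : {lrmorphism H -> S}).
Hypothesis S_smash : is_sym_smash act SV SH.
Variables (A : algType F) (jV : {linear V -> A}) (jH : {lrmorphism H -> A}).
Hypothesis A_compat : smash_compat act jV jH.
Variable rel : nat -> A -> S -> Prop.
Hypothesis pbw : pbw_model SV SH jV jH rel.

Local Notation T := (tensor A C).
Local Notation X := (tensor S C).
Local Notation Delta := (diag_map jH pi gamma).
Local Notation DeltaX := (diag_map SH pi gamma).
Local Notation D := (dirac_elt e e' cV jV).
Local Notation d := (dirac_d e e' cV alpha jV).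
Local Notation dX := (dirac_d e e' cV alpha SV).
Local Notation invariantX := (invariant act cV alpha pi gamma SH).
Local Notation invariant := (invariant act cV alpha pi gamma jH).
Local Notation degreeX := (@degreeX F H V C S SV SH).

(* A ⊗ C is filtered through A: x has symbol xi when all its slices do        *)
Definition relX m (x : T) (xi : X) : Prop :=
  forall f : {linear C -> F^o}, rel m (slicer f x) (slicer f xi).

Lemma relX_lin m c x y xi eta :
  relX m x xi -> relX m y eta -> relX m (c *: x + y) (c *: xi + eta).
Proof. by move=> xxi yeta f; rewrite !linearP; exact: (pbw_lin pbw _ (xxi f) (yeta f)). Qed.
Lemma relX0 m : relX m 0 0.
Proof. by move=> f; rewrite !raddf0; exact: (pbw_0 pbw). Qed.
Lemma relXB m x y xi eta : relX m x xi -> relX m y eta -> relX m (x - y) (xi - eta).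
Proof. by move=> xxi yeta; rewrite -!(addrC (- _)) -!scaleN1r; exact: relX_lin. Qed.
Lemma relXZ m c x xi : relX m x xi -> relX m (c *: x) (c *: xi).
Proof.
by move=> xxi; rewrite -[_ *: x]addr0 -[_ *: xi]addr0; apply: relX_lin (relX0 m).
Qed.
Lemma relX_sum m r (x : 'I_r -> T) (xi : 'I_r -> X) :
  (forall i, relX m (x i) (xi i)) -> relX m (\sum_i x i) (\sum_i xi i).
Proof.
move=> xxi; elim/big_rec2: _ => [|i y eta _ yeta]; first exact: relX0.
by rewrite -[x i]scale1r -[xi i]scale1r; exact: relX_lin.
Qed.
Lemma relX_tens m a p c : rel m a p -> relX m (a ⊗ c) (p ⊗ c).
Proof. by move=> ap f; rewrite !slicerE; exact: (pbwZ pbw). Qed.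

Lemma relX_mull k m a p c x xi : rel k a p -> relX m x xi ->
  relX (k + m)%N ((a ⊗ c) * x) ((p ⊗ c) * xi).
Proof. by move=> ap xxi f; rewrite !slicer_mull; exact: (pbw_mul pbw ap (xxi _)). Qed.
Lemma relX_mulr k m a p c x xi : rel k a p -> relX m x xi ->
  relX (m + k)%N (x * (a ⊗ c)) (xi * (p ⊗ c)).
Proof. by move=> ap xxi f; rewrite !slicer_mulr; exact: (pbw_mul pbw (xxi _) ap). Qed.
Lemma relX_parity m x xi : relX m x xi ->
  relX m (parity_map alpha x) (parity_map alpha xi).
Proof. by move=> xxi f; rewrite /parity_map !slicer_tmap; exact: xxi. Qed.

Lemma relX_d m x xi : relX m x xi -> relX m.+1 (d x) (dX xi).
Proof.
move=> xxi; apply: relXB; rewrite ?mulr_suml ?mulr_sumr; apply: relX_sum => i.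
  by rewrite -add1n; apply: relX_mull xxi; exact: (pbw_V pbw).
by rewrite -addn1; apply: relX_mulr (relX_parity xxi); exact: (pbw_V pbw).
Qed.

Lemma relX_diagl m k x xi : relX m x xi -> relX m (Delta k * x) (DeltaX k * xi).
Proof.
move=> xxi; rewrite /diag_map /=; elim/tensor_ind: (comul Ht k) => [a b|c s t hs ht].
  by rewrite !tmapE; apply: (relX_mull (k := 0)) xxi; exact: (pbw_H pbw).
by rewrite !linearP !mulrDl -!scalerAl; exact: relX_lin.
Qed.
Lemma relX_diagr m k x xi : relX m x xi -> relX m (x * Delta k) (xi * DeltaX k).
Proof.
move=> xxi; rewrite /diag_map /=; elim/tensor_ind: (comul Ht k) => [a b|c s t hs ht].
  by rewrite !tmapE -[m]addn0; apply: relX_mulr xxi; exact: (pbw_H pbw).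
by rewrite !linearP !mulrDr -!scalerAr; exact: relX_lin.
Qed.
Lemma relX_diag k : relX 0 (Delta k) (DeltaX k).
Proof.
rewrite -[Delta k]mulr1 -[DeltaX k]mulr1; apply: relX_diagl.
by apply: relX_tens; rewrite -(rmorph1 jH) -(rmorph1 SH); exact: (pbw_H pbw).
Qed.

Lemma relX_weaken m x xi : relX m x xi -> relX m.+1 x 0.
Proof. by move=> xxi f; rewrite raddf0; exact: (pbw_weaken pbw (xxi f)). Qed.
Lemma relX_weaken0 m x xi : relX 0 x xi -> relX m.+1 x 0.
Proof. by move=> xxi; elim: m => [|m]; exact: relX_weaken. Qed.
Lemma relX_inj m xi : relX m 0 xi -> xi = 0.
Proof.
move=> xi0; apply: slicer_eq0 => f; apply: (pbw_inj pbw (n := m)).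
by have := xi0 f; rewrite raddf0.
Qed.
Lemma relX_lower0 x : relX 0 x 0 -> x = 0.
Proof.
move=> x0; apply: slicer_eq0 => f; apply: (pbw_lower0 pbw).
by have := x0 f; rewrite raddf0.
Qed.
Lemma relX_lower m x : relX m.+1 x 0 -> exists xi, relX m x xi.
Proof.
have [r [u [w [-> _ /free_dual[f fw]]]]] := tensor_sum_free x => x0.
have /choice[q uq] i : exists q, rel m (u i) q.
  apply: (pbw_lower pbw); have := x0 (f i).
  rewrite raddf0 slicer_sum (bigD1 i) //= fw eqxx scale1r big1 ?addr0 //.
  by move=> j ji; rewrite fw eq_sym (negPf ji) scale0r.
by exists (\sum_i q i ⊗ w i); apply: relX_sum => i; exact: relX_tens.
Qed.
Lemma relX_degree m x xi : relX m x xi -> degreeX m xi.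
Proof.
move=> xxi; have := slicer_span (sym_degree_lin SV SH m) (fun f => pbw_degree pbw (xxi f)).
by apply: span_mono => _ [p mp [c ->]]; exists p, c.
Qed.
Lemma relX_total x : exists m xi, relX m x xi.
Proof.
elim/tensor_ind: x => [a c|c x y [m [xi xxi]] [m' [eta yeta]]].
  by have [m [p ap]] := pbw_total pbw a; exists m, (p ⊗ c); exact: relX_tens.
have up k l z zeta : relX k z zeta -> relX (l + k).+1 z 0.
  move=> zz; elim: l => [|l IHl]; first exact: relX_weaken zz.
  exact: relX_weaken IHl.
exists (m + m').+1, (c *: 0 + 0); apply: relX_lin; last exact: up yeta.
by rewrite addnC; exact: up xxi.
Qed.

Definition Theta m : X -> T := tmap (theta fr S_smash jV jH m) (@idfun C).
HB.instance Definition _ m := GRing.Linear.on (Theta m).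

Lemma Theta_rel m xi : degreeX m xi -> relX m (Theta m xi) xi.
Proof.
move: xi; apply: degreeX_ind => [|p c mp].
  split=> [|a x y hx hy]; first by rewrite raddf0; exact: relX0.
  by rewrite linearP; exact: relX_lin.
rewrite /Theta tmapE; apply: relX_tens.
exact: (theta_rel F_char0 H_cocomm H_pointed fr S_smash pbw).
Qed.

Lemma Theta_diagl m k xi : Theta m (DeltaX k * xi) = Delta k * Theta m xi.
Proof.
rewrite /diag_map /=; elim/tensor_ind: (comul Ht k) => [a b|c s t hs ht]; last first.
  by rewrite !linearP /= !mulrDl -!scalerAl linearP /= hs ht.
rewrite !tmapE /=; elim/tensor_ind: xi => [p c|c x y hx hy]; last first.
  by rewrite mulrDr -scalerAr !linearP /= hx hy mulrDr -scalerAr.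
by rewrite tensM /Theta !tmapE /= theta_mull // tensM.
Qed.
Lemma Theta_diagr m k xi : Theta m (xi * DeltaX k) = Theta m xi * Delta k.
Proof.
rewrite /diag_map /=; elim/tensor_ind: (comul Ht k) => [a b|c s t hs ht]; last first.
  by rewrite !linearP /= !mulrDr -!scalerAr linearP /= hs ht.
rewrite !tmapE /=; elim/tensor_ind: xi => [p c|c x y hx hy]; last first.
  by rewrite mulrDl -scalerAl !linearP /= hx hy mulrDl -scalerAl.
by rewrite tensM /Theta !tmapE /= theta_mulr // tensM.
Qed.
Lemma Theta_invariant m b xi : invariantX b xi -> invariant b (Theta m xi).
Proof. by move=> ixi k c kc; rewrite -Theta_diagl (ixi k c kc) linearZ /= Theta_diagr. Qed.

Lemma relX_invariant m b x xi : relX m x xi -> invariant b x -> invariantX b xi.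
Proof.
move=> xxi ix k c kc; apply/eqP; rewrite -subr_eq0; apply/eqP/(@relX_inj m).
have -> : 0 = Delta k * x - c ^+ b *: (x * Delta k) by rewrite (ix k c kc) subrr.
by apply: relXB; [exact: relX_diagl | exact/relXZ/relX_diagr].
Qed.

Hypothesis D2_comm : forall b x, invariant b x -> D * D * x = x * (D * D).

Lemma dirac_d2_invariant b x : invariant b x -> d (d x) = 0.
Proof. by move=> ix; rewrite (dirac_d2 e e' C_model) (D2_comm ix) subrr. Qed.

(** Descent on the degree m of x. It is enough that d x lies in filtration degree 0, since its
    symbol in degree m + 1 then vanishes already; [dirac_unique] relies on this slack. *)
Lemma dirac_exact m b x xi zeta : relX m x xi -> invariant b x -> relX 0 (d x) zeta ->
  exists k y, invariant (~~ b) y /\ x = Delta k + d y.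
Proof.
move=> xxi ix dx; have ixi := relX_invariant xxi ix.
elim: m => [|m IHm] in x xi xxi ix ixi dx *;
    have dxi : dX xi = 0 by apply: (@relX_inj _ (dX xi)); rewrite -(subrr (d x));
      rewrite -[dX xi]subr0; apply: relXB (relX_d xxi) (relX_weaken0 _ dx).
  have [k xiE] := graded_kernel0 F_char0 H_cocomm H_pointed fr C_model pin pi_surj S_smash (relX_degree xxi) dxi.
  exists k, 0; split; first exact: (invariant_lin _ _ _ _ _ _ _).1.
  rewrite raddf0 addr0; apply/eqP; rewrite -subr_eq0; apply/eqP/relX_lower0.
  by rewrite -(subrr xi) {2}xiE; apply: relXB xxi (relX_diag k).
(* A preimage of the symbol is lifted by the equivariant section [Theta]; subtracting d of the lift
   cancels the leading term without changing d x. *)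
have [eta [meta ieta etaE]] :=
  graded_exact F_char0 H_cocomm H_pointed fr C_model pin S_smash (relX_degree xxi) ixi dxi.
pose y := Theta m eta; have iy : invariant (~~ b) y by exact: Theta_invariant.
have ix' : invariant b (x - d y).
  apply: (lin_closedB (invariant_lin _ _ _ _ _ _ _)) => //.
  by rewrite -[b]negbK; exact: (invariant_d fr A_compat iy).
have [xi' xxi'] : exists xi', relX m (x - d y) xi'.
  apply: relX_lower; rewrite -(subrr xi) -{2}etaE.
  exact: (relXB xxi (relX_d (Theta_rel meta))).
have [|k [z [iz zE]]] := IHm (x - d y) xi' xxi' ix' (relX_invariant xxi' ix').
  by rewrite raddfB /= (dirac_d2_invariant iy) subr0.
exists k, (y + z); split; first exact: (lin_closedD (invariant_lin _ _ _ _ _ _ _)).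
by rewrite raddfD /= addrCA -zE addrC subrK.
Qed.

(** Since Delta(k) has filtration degree 0, [dirac_exact] applies to y itself and gives y = Delta(l)
    + d w; both summands are killed by d. *)
Lemma dirac_unique b y k : invariant b y -> d y = Delta k -> Delta k = 0.
Proof.
move=> iy dy; have [m [xi yxi]] := relX_total y.
have [|l [w [iw yE]]] := dirac_exact (zeta := DeltaX k) yxi iy.
  by rewrite dy; exact: relX_diag.
rewrite -dy yE raddfD /= (dirac_d_diag fr pin A_compat) add0r.
exact: (dirac_d2_invariant iw).
Qed.

(** * The map zeta on the center of A *)

Local Notation talpha := (@parity_map F C alpha A).
Local Notation K := (kerquot Delta).

Let central_tens (z : center A) (x : T) : (center_val z ⊗ 1) * x = x * (center_val z ⊗ 1).
Proof.
have /centralP zC := valP z; elim/tensor_ind: x => [a c|c x y hx hy].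
  by rewrite !tensM mul1r mulr1; congr (_ ⊗ _); exact: zC.
by rewrite mulrDr mulrDl -scalerAr -scalerAl hx hy.
Qed.

Let d_centralM (z : center A) x : d ((center_val z ⊗ 1) * x) = (center_val z ⊗ 1) * d x.
Proof.
rewrite /dirac_d rmorphM /= /parity_map tmapE /= rmorph1 mulrBr !mulrA.
by rewrite -(central_tens z D).
Qed.

Let zeta_rel (z : center A) (k : Ht) : Prop :=
  exists2 y, invariant true y & center_val z ⊗ 1 = Delta k + d y.

Let zeta_rel_exists z : exists k, zeta_rel z k.
Proof.
have [m [xi zxi]] := relX_total (center_val z ⊗ 1).
have dz : d (center_val z ⊗ 1) = 0.
  rewrite /dirac_d /parity_map tmapE rmorph1 central_tens.
  exact: subrr.
have [||k [y [iy zE]]] := dirac_exact (zeta := 0) (b := false) zxi.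
- by move=> k c _; rewrite scale1r central_tens.
- by rewrite dz; exact: relX0.
- by exists k, y.
Qed.

Let zeta_rel_lin a z w k l : zeta_rel z k -> zeta_rel w l ->
  zeta_rel (a *: z + w) (a *: k + l).
Proof.
move=> [y iy zE] [x ix wE]; exists (a *: y + x).
  exact: (invariant_lin _ _ _ _ _ _ _).2.
have -> : Delta (a *: k + l) = a *: Delta k + Delta l by exact: linearP.
rewrite linearP addrACA -scalerDr -zE -wE -tensZl -tensDl.
by congr (_ ⊗ _); exact: (linearP val).
Qed.

Let zeta_rel_unique z k l : zeta_rel z k -> zeta_rel z l -> Delta k = Delta l.
Proof.
move=> [y iy zE] [x ix]; rewrite zE => kl; apply/eqP; rewrite -subr_eq0; apply/eqP.
rewrite -(raddfB Delta).
apply: (dirac_unique (b := true) (y := x - y)).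
  exact: (lin_closedB (invariant_lin _ _ _ _ _ _ _)).
have -> : Delta (k - l) = Delta k - Delta l by exact: raddfB.
have dxE : d x = - Delta l + (Delta k + d y) by rewrite kl addKr.
by rewrite raddfB /= dxE addrA addrK addrC.
Qed.

Let zeta_rel_central z k l : zeta_rel z k -> Delta k * Delta l = Delta l * Delta k.
Proof.
move=> [y iy /(canLR (addrK _)) <-]; rewrite mulrBl mulrBr central_tens; congr (_ - _).
exact/esym/(invariant_comm pin (invariant_d fr A_compat iy)).
Qed.

Let zeta_rel1 : zeta_rel 1 1.
Proof.
exists 0; first exact: (invariant_lin _ _ _ _ _ _ _).1.
by rewrite raddf0 addr0 rmorph1.
Qed.

Let zeta_relM z w k l : zeta_rel z k -> zeta_rel w l -> zeta_rel (z * w) (k * l).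
Proof.
move=> zk wl; have [y iy zE] := zk; have [x ix wE] := wl.
(* From (z ⊗ 1)(w ⊗ 1) = (Delta(k) + d y) Delta(l) + (z ⊗ 1) d x, as d is linear over Delta on the
   right and over central elements on the left. *)
exists (y * Delta l + (center_val z ⊗ 1) * x).
  move=> j c jc; rewrite mulrDr mulrDl scalerDr; congr (_ + _).
    rewrite mulrA (iy j c jc) -scalerAl -!mulrA.
    by rewrite (zeta_rel_central j wl).
  by rewrite mulrA -central_tens -!mulrA (ix j c jc) -scalerAr.
have -> : Delta (k * l) = Delta k * Delta l by exact: rmorphM.
rewrite [d _]raddfD [X in _ + (_ + X)]d_centralM [X in _ + (X + _)](dirac_dMr fr pin A_compat) addrA -mulrDl -zE.
by rewrite -mulrDr -wE tensM mulr1.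
Qed.

(** The parity automorphism fixes z ⊗ 1 and maps a decomposition of it to another one, so uniqueness
    applies. *)
Let zeta_rel_parity z k : zeta_rel z k -> talpha (Delta k) = Delta k.
Proof.
move=> zk; have [y iy zE] := zk; have [k' kE] := parity_diag_range pin jH k.
rewrite kE; apply: (zeta_rel_unique (z := z)) => //; exists (- talpha y).
  rewrite -scaleN1r; apply: (lin_closedZ _ (invariant_lin _ _ _ _ _ _ _)).
  exact: invariant_parity.
have -> : d (- talpha y) = talpha (d y).
  by rewrite raddfN /= (dirac_d_parity e e' C_model) opprK.
rewrite -kE -(raddfD talpha) -zE.
by rewrite /= /parity_map tmapE rmorph1.
Qed.

Let kerproj_eq k l : Delta k = Delta l -> kerproj Delta k = kerproj Delta l.
Proof.
move=> kl; apply/eqP; rewrite -subr_eq0 -raddfB; apply/eqP/kerproj_eq0.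
have -> : Delta (k - l) = Delta k - Delta l by exact: raddfB.
by rewrite kl subrr.
Qed.

Lemma dirac_center_map : exists zeta : {lrmorphism center A -> center K},
  forall z, exists x, center_val z ⊗ 1 = kermap (center_val (zeta z)) + x * D + D * x.
Proof.
have /choice[k kP] := zeta_rel_exists.
have central_k z : kerproj Delta (k z) \in @central F K.
  apply/centralP => x; have [l <-] := kerproj_surj x.
  rewrite -!rmorphM; apply: kerproj_eq.
  have DM i j : Delta (i * j) = Delta i * Delta j by exact: rmorphM.
  by rewrite !DM (zeta_rel_central l (kP z)).
pose f z : center K := Center (central_k z).
have fE z l : zeta_rel z l -> kerproj Delta (k z) = kerproj Delta l.
  by move=> zl; apply/kerproj_eq/(zeta_rel_unique (kP z)).
have f_lin : linear f.
  move=> a z w; apply: val_inj; rewrite /= (fE _ _ (zeta_rel_lin a (kP z) (kP w))).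
  exact: linearP.
have f_mon : monoid_morphism f.
  split=> [|z w]; apply: val_inj; rewrite /=.
    by rewrite (fE _ _ zeta_rel1) rmorph1.
  by rewrite (fE _ _ (zeta_relM (kP z) (kP w))) rmorphM.
pose zeta : {lrmorphism center A -> center K} := HB.pack f
  (GRing.isLinear.Build F (center A) (center K) *:%R f f_lin)
  (GRing.isMonoidMorphism.Build (center A) (center K) f f_mon).
exists zeta => z; have [y iy zE] := kP z.
have dy : talpha (d y) = d y.
  rewrite -(canLR (addKr _) zE) raddfD raddfN /= (zeta_rel_parity (kP z)).
  by rewrite /parity_map tmapE rmorph1.
(* The odd part of y. As d y is even, it has the same image under d, and for an odd element d is the
   anticommutator with D. *)
pose x := 2%:R^-1 *: (y - talpha y).
have ax : talpha x = - x.
  by rewrite /x linearZ raddfB /= (parity_mapK C_model) -scalerN opprB.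
have dx : d x = d y.
  pose dl : {linear T -> T} := d; rewrite -[d x]/(dl x) (linearZ_LR dl) (raddfB dl).
  rewrite /dl /= (dirac_d_parity e e' C_model) dy opprK -mulr2n.
  by rewrite -scaler_nat scalerA mulVf ?scale1r // ((pcharf0P F).1 F_char0).
exists x; rewrite kermapE zE -dx /dirac_d ax mulNr opprK -addrA.
by congr (_ + _); rewrite addrC.
Qed.
End DiracExactness.

(** * Frames and pin generators from the given data *)

Lemma orthogonal_module_frame (F : fieldType) (H : hopfAlg F) (V : vectType F)
    (form : {symmetric V}) (act : H -> V -> V) n (e e' : n.-tuple V) :
  orthogonal_module form act -> dual_bases form e e' ->
  orthogonal_frame act form (tnth e) (tnth e').
Proof.
move=> [md orth] [be be' dual].
have formC v w : form v w = form w v by rewrite hermC expr0 mul1r.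
have formP a u v w : form (a *: u + v) w = a * form u w + form v w by exact: linearPl.
have bil v w : is_bilinear (fun a b : H => form (act a v) (act b w) : F^o).
  split=> [c a x y|c a x y] /=; first by rewrite (act_linearl md) formP.
  by rewrite (act_linearl md) formC formP !(formC _ (act c v)).
have expand (f f' : n.-tuple V) v : basis_of {:V} f ->
    (forall i j, form (tnth f i) (tnth f' j) = (i == j)%:R) ->
    v = \sum_i form v (tnth f' i) *: tnth f i.
  move=> bf ff'; have vE := coord_basis bf (memvf v).
  rewrite [LHS]vE; apply: eq_bigr => i _; rewrite (tnth_nth 0 f); congr (_ *: _).
  have g_lin : linear (fun v => form v (tnth f' i) : F^o) by move=> a x y; exact: formP.
  pose g : {linear V -> F^o} := HB.pack (fun v => form v (tnth f' i) : F^o)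
    (GRing.isLinear.Build _ _ _ _ _ g_lin).
  have gf (j : 'I_n) : g f`_j = (j == i)%:R by rewrite /g /= -tnth_nth; exact: ff'.
  rewrite {2}vE; transitivity (g (\sum_j coord f j v *: f`_j)) => //.
  rewrite linear_sum; under eq_bigr => j _ do rewrite (linearZ_LR g) gf.
  rewrite (bigD1 i) //= eqxx big1 => [|j /negPf->]; last exact: mulr0.
  by rewrite addr0; exact/esym/mulr1.
split=> //.
- by move=> v; exact: expand.
- move=> v; apply: expand => // i j.
  by rewrite formC dual eq_sym.
- move=> g v w gl; have := orth g v w.
  by rewrite (tliftE (bil v w)) gl.1 tlinE gl.2 mul1r.
- move=> x v w px; have := orth x v w.
  rewrite (tliftE (bil v w)) px raddfD /= !tlinE !(act1 md) primitive_counit //.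
  by rewrite mul0r => /eqP; rewrite addr_eq0 => /eqP.
Qed.

Section PinCoverModel.
Variables (F : fieldType) (F_char0 : [pchar F] =i pred0).
Variables (H : hopfAlg F) (V : vectType F) (form : {symmetric V}) (act : H -> V -> V).
Variables (C : algType F) (qC : {lrmorphism talg V -> C}).
Hypothesis C_cliff : is_clifford form qC.
Variables (Ht : hopfAlg F) (pi : {lrmorphism Ht -> H}) (gamma : {lrmorphism Ht -> C}).
Hypothesis pin_cover : is_pin_cover form act qC pi gamma.

Local Notation cV := (cliffV qC).
Local Notation alpha := (cliff_involution C_cliff).

Lemma clifford_is_model : clifford_model form (cliffV qC) alpha.
Proof.
split; [exact: cliffM | exact: involutionV | exact: involutionK | ].
exact: (clifford_ind C_cliff).
Qed.

(** A unit vector v has square 1 and satisfies v u = - tau_v(u) v in C; induct on the number of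
    factors. The exponent k is that number. *)
Lemma pin_overM p f : pin_over form qC p f ->
  exists2 k, alpha p = (-1) ^+ k *: p & forall u, p * cV u = (-1) ^+ k *: (cV (f u) * p).
Proof.
move=> [vs [unit -> fE]]; exists (size vs) => [|u].
  rewrite -signr_odd; apply: (cliff_parity_involution C_cliff).
  by apply: span_gen; exists vs.
rewrite fE {fE}; elim: vs unit => [|v vs IHvs] unit.
  by rewrite big_nil expr0 scale1r mulr1 mul1r.
have unit' w : w \in vs -> form w w = 1 by move=> ws; apply: unit; rewrite in_cons ws orbT.
have vv : form v v = 1 by apply: unit; exact: mem_head.
rewrite big_cons -mulrA (IHvs unit') /= -scalerAr !mulrA exprS mulN1r scaleNr -scalerN.
congr (_ *: _); rewrite -mulNr; congr (_ * _); set w := foldr _ _ _.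
have cvv : cV v * cV v = 1.
  apply: (scalerI (a := 2%:R)); first by rewrite ((pcharf0P F).1 F_char0).
  by rewrite scaler_nat mulr2n (cliffM C_cliff) vv mulr1.
rewrite /reflection raddfB /= linearZ /= mulrBl -scalerAl cvv.
by rewrite -(cliffM C_cliff) opprB addrC addKr.
Qed.

Lemma pin_signed_grouplike g : grouplike g ->
  exists c, signed_grouplike act cV alpha pi gamma g c.
Proof.
move=> gl; have [[co cu] _] := pin_hopf_morphism pin_cover.
have pg : grouplike (pi g) by split; [rewrite co gl.1 tmapE | rewrite cu gl.2].
have [_ /pin_overM[k ag gv]] : grouplike (pi g) /\ pin_over form qC (gamma g) (act (pi g)).
  by apply/(pin_pullback_im pin_cover); exists g.
exists ((-1) ^+ k); split=> //.
by rewrite -signr_odd; case: odd; [right|left].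
Qed.

Lemma pin_spin_primitive x : primitive x -> spin_primitive act cV alpha pi gamma x.
Proof.
move=> px; have [[co _] _] := pin_hopf_morphism pin_cover; split=> //.
- by rewrite /primitive co px raddfD /= !tmapE rmorph1.
- have := pin_prim_span pin_cover px; elim=> [|_ [v [w ->]]|a c d _ hc _ hd].
  + exact: raddf0.
  + by rewrite raddfB /= !rmorphM /= !involutionV !mulrNN.
  + by rewrite linearP /= hc hd.
- by move=> v; have /= <- := pin_prim_comm pin_cover v px; rewrite subrK.
Qed.

Lemma pin_cover_model : pin_model act cV alpha pi gamma.
Proof.
move=> P Plin PM Pgen.
apply: (hopf_ind F_char0 (pin_cocommutative pin_cover) (pin_pointed pin_cover)) => //.
  by move=> g /pin_signed_grouplike[c gc]; apply: (Pgen g c); left.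
by move=> x /pin_spin_primitive xs; apply: (Pgen x 1); right.
Qed.

(** An even element is a combination of products of primitives with a group-like of determinant 1,
    and each such factor carries the sign +1. *)
Lemma parity_even_comm (A : algType F) (jH : {lrmorphism H -> A}) b x h :
  parity (fun k => act (pi k)) false h -> invariant act cV alpha pi gamma jH b x ->
  diag_map jH pi gamma h * x = x * diag_map jH pi gamma h.
Proof.
move=> h_even ix; elim: h_even => [|_ [xs [g [xsP gl detg ->]]]|a k l _ hk _ hl].
- by rewrite raddf0 mul0r mulr0.
- elim: xs xsP => [_|y xs IHxs xsP]; last first.
    have yP : primitive y by apply: xsP; exact: mem_head.
    have {}IHxs := IHxs (fun z zxs => xsP z (mem_behead (s := y :: xs) zxs)).
    rewrite big_cons -mulrA rmorphM -mulrA IHxs mulrA.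
    have := ix y 1 (or_intror (conj erefl (pin_spin_primitive yP))).
    by rewrite expr1n scale1r => ->; rewrite -mulrA.
  rewrite big_nil mul1r; have [c gc] := pin_signed_grouplike gl.
  rewrite (ix g c (or_introl gc)); have [_ _ c1 ag _] := gc.
  case: c1 gc ag => -> gc ag; first by rewrite expr1n scale1r.
  (* The sign -1 is impossible here: [gamma g] would be both even and odd, hence 0, although it is
     invertible. *)
  have pg : parity (fun k => act (pi k)) false g.
    by apply: span_gen; exists [::], g; split=> //; rewrite ?big_nil ?mul1r.
  have := cliff_parity_involution C_cliff (pin_parity pin_cover pg).
  rewrite ag expr0 scale1r => /eqP; rewrite scaleN1r eq_sym -addr_eq0 -mulr2n -scaler_nat.
  rewrite scaler_eq0 ((pcharf0P F).1 F_char0) /= => /eqP g0.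
  have := congr1 gamma (grouplike_antipode gl).1; rewrite rmorphM /= g0 mulr0 rmorph1.
  by move/esym/eqP; rewrite oner_eq0.
- have -> : diag_map jH pi gamma (a *: k + l)
      = a *: diag_map jH pi gamma k + diag_map jH pi gamma l by exact: linearP.
  by rewrite mulrDl mulrDr -scalerAl -scalerAr hk hl.
Qed.
End PinCoverModel.

Theorem proposition1p1
    (F : fieldType) (F_char0 : [pchar F] =i pred0)
    (H : hopfAlg F) (H_cocomm : cocommutative H) (H_pointed : pointed H)
    (V : vectType F) (form : {symmetric V}) (form_nondeg : nondegenerate form)
    (act : H -> V -> V) (act_orth : orthogonal_module form act)
    (kappa : {linear ext_square V -> H})
    (A : algType F) (qA : {lrmorphism smash act -> A})
    (A_hecke : hopf_hecke kappa qA)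
    (C : algType F) (qC : {lrmorphism talg V -> C})
    (C_cliff : is_clifford form qC)
    (Ht : hopfAlg F) (pi : {lrmorphism Ht -> H}) (gamma : {lrmorphism Ht -> C})
    (pin_cover : is_pin_cover form act qC pi gamma)
    (n : nat) (e e' : n.-tuple V) (e_dual : dual_bases form e e') :
  let D : tensor A C := dirac (heckeV qA) (cliffV qC) e e' in
  parthasarathy (heckeH qA) pi gamma act D ->
  exists zeta :
      {lrmorphism center A -> center (kerquot (diag_map (heckeH qA) pi gamma))},
    forall z : center A, exists b : tensor A C,
      center_val z ⊗ 1 = kermap (center_val (zeta z)) + b * D + D * b.
Proof.
move=> D [z0 [h0 [/centralP z0C h0_even DE]]].
have md := act_orth.1; have fr := orthogonal_module_frame act_orth e_dual.
have S_smash := sym_smash_is_sym_smash F_char0 H_cocomm H_pointed md.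
have [relg relx] := smash_compat_smash md.
have A_compat : smash_compat act (heckeV qA) (heckeH qA).
  split=> [g v gl|x v px]; rewrite /= -[LHS](rmorphM qA).
    by rewrite relg // rmorphM.
  by rewrite relx // raddfD /= !rmorphM.
have [rel pbw] := hecke_pbw F_char0 H_cocomm H_pointed md A_hecke.
apply: (dirac_center_map F_char0 H_cocomm H_pointed fr (clifford_is_model C_cliff)
  (pin_cover_model F_char0 (C_cliff := C_cliff) pin_cover) (pin_surjective pin_cover) S_smash A_compat pbw).
(* By the Parthasarathy condition D^2 is [z0] plus Delta of the even element [h0], and both commute
   with every invariant. *)
move=> b x ix; rewrite -[dirac_elt _ _ _ _]/D DE mulrDl mulrDr z0C.
by rewrite (parity_even_comm F_char0 (C_cliff := C_cliff) pin_cover h0_even ix).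
Qed.
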